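(* Let $\alpha\in(0,2)\setminus\{1\}$ and let $c_-,c_+\ge 0$, not both zero. Let $X\sim S_\alpha(c_-,c_+)$ be a strictly stable process with infinitesimal generator $\mathcal{L}$. Then $\mathcal{L}$ is invertible in the Lizorkin space $\Phi$, and for every $\phi\in\Phi$ $$\mathcal{L}^{-1}\phi(x)=K_-\,I_-^{\alpha}\phi(x)+K_+\,I_+^{\alpha}\phi(x),$$ where $$K_\pm=\frac{M_\pm}{M_-^2+M_+^2+2M_-M_+\cos(\pi\alpha)},\qquad M_\pm=c_\pm\,\Gamma(-\alpha).$$
   Context: $X\sim S_\alpha(c_-,c_+)$ means that $X$ is the one-dimensional strictly $\alpha$-stable Lévy process with Lévy measure $\nu(dh)=\left(c_-\mathbf 1_{\{h<0\}}+c_+\mathbf 1_{\{h>0\}}\right)|h|^{-\alpha-1}dh$. Its infinitesimal generator acts on $\varphi$ in the Schwartz space $\mathcal S(\mathbb R)$ by $\mathcal L\varphi(x)=\int_{\mathbb R\setminus\{0\}}[\varphi(x+y)-\varphi(x)]\,\nu(dy)$ if $\alpha\in(0,1)$, and $\mathcal L\varphi(x)=\int_{\mathbb R\setminus\{0\}}[\varphi(x+y)-\varphi(x)-y\varphi'(x)]\,\nu(dy)$ if $\alpha\in(1,2)$. Lizorkin space: let $\Psi=\{\psi\in\mathcal S(\mathbb R):\psi^{(j)}(0)=0 \text{ for all } j=0,1,2,\dots\}$ and $\Phi=\{\phi\in\mathcal S(\mathbb R):\mathcal F[\phi]\in\Psi\}$, where $\mathcal F[\phi](u)=\int_{\mathbb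 R}\phi(x)e^{iux}dx$. Riemann–Liouville fractional integrals of order $\alpha>0$: $I_-^\alpha\varphi(x)=\frac1{\Gamma(\alpha)}\int_{-\infty}^x(x-t)^{\alpha-1}\varphi(t)\,dt$ and $I_+^\alpha\varphi(x)=\frac1{\Gamma(\alpha)}\int_x^{\infty}(t-x)^{\alpha-1}\varphi(t)\,dt$. *)

(* Defs.v *)
From HB Require Import structures.
From mathcomp Require Import all_boot all_order all_algebra.
From mathcomp Require Import all_classical all_reals all_analysis.
From mathcomp Require Import complex.

Set Implicit Arguments.
Unset Strict Implicit.
Unset Printing Implicit Defensive.

Import Order.TTheory GRing.Theory Num.Theory.
Import numFieldNormedType.Exports.

Local Open Scope classical_set_scope.
Local Open Scope complex_scope.
Local Open Scope ring_scope.

(** Complex-valued functions are functions into [R[i]].  The library has no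
    normed-module structure over [R] on [R[i]], so derivatives and integrals of
    such functions are taken on real and imaginary parts. *)

Section ComplexValued.
Context {R : realType}.

Definition rpart {T : Type} (f : T -> R[i]) : T -> R := fun x => complex.Re (f x).
Definition ipart {T : Type} (f : T -> R[i]) : T -> R := fun x => complex.Im (f x).

Definition modulus (z : R[i]) : R := complex.ComplexField.Normc.normc z.

Definition expi (x : R) : R[i] := cos x +i* sin x.
Definition cexp (z : R[i]) : R[i] := (expR (complex.Re z))%:C * expi (complex.Im z).

Definition cintegral {d} {T : measurableType d} (mu : {measure set T -> \bar R})
    (D : set T) (f : T -> R[i]) : R[i] :=
  Rintegral mu D (rpart f) +i* Rintegral mu D (ipart f).

Definition cderiv (n : nat) (f : R -> R[i]) (x : R) : R[i] :=
  derive1n n (rpart f) x +i* derive1n n (ipart f) x.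

Definition smooth (f : R -> R[i]) : Prop :=
  forall n x, derivable (derive1n n (rpart f)) x 1 /\ derivable (derive1n n (ipart f)) x 1.

End ComplexValued.

Section FunctionSpaces.
Context {R : realType}.

Definition schwartz : set (R -> R[i]) :=
  [set f | smooth f /\
    forall m n : nat, exists M : R,
      forall x, modulus ((x ^+ m)%:C * cderiv n f x) <= M].

Definition fourier (f : R -> R[i]) (u : R) : R[i] :=
  cintegral lebesgue_measure setT (fun x => f x * expi (u * x)).

Definition lizorkin_dual : set (R -> R[i]) :=
  [set psi | schwartz psi /\ forall j : nat, cderiv j psi 0 = 0].

Definition lizorkin : set (R -> R[i]) :=
  [set phi | schwartz phi /\ lizorkin_dual (fourier phi)].

(** [C_0(R)], the Banach space on which the transition semigroup acts. *)
Definition vanishing_at_infinity : set (R -> R[i]) :=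
  [set f | [/\ continuous (rpart f), continuous (ipart f),
               modulus (f x) @[x --> +oo] --> (0 : R) &
               modulus (f x) @[x --> -oo] --> (0 : R)]].

End FunctionSpaces.

Section GammaFunction.
Context {R : realType}.

Definition Gamma_integral (s : R) : R :=
  Rintegral lebesgue_measure `]0, +oo[ (fun t => t `^ (s - 1) * expR (- t)).

(** Outside the positive axis: continuation by [Gamma (x + 1) = x * Gamma x],
    shifting by an [n] with [0 < x + n].  Junk at the poles. *)
Definition Gamma (x : R) : R :=
  let n := if 0 < x then 0%N else (Num.truncn `|x|).+1 in
  Gamma_integral (x + n%:R) / \prod_(k < n) (x + k%:R).

End GammaFunction.

Section FractionalIntegrals.
Context {R : realType}.

Definition I_minus (alpha : R) (phi : R -> R[i]) (x : R) : R[i] :=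
  ((Gamma alpha)^-1)%:C *
  cintegral lebesgue_measure `]-oo, x[
    (fun t => ((x - t) `^ (alpha - 1))%:C * phi t).

Definition I_plus (alpha : R) (phi : R -> R[i]) (x : R) : R[i] :=
  ((Gamma alpha)^-1)%:C *
  cintegral lebesgue_measure `]x, +oo[
    (fun t => ((t - x) `^ (alpha - 1))%:C * phi t).

End FractionalIntegrals.

Section Processes.
Context {R : realType} {d : measure_display} {T : measurableType d}.
Variable P : probability T R.

(** Processes are indexed by all of [R]; only times [t >= 0] matter. *)
Implicit Type X : R -> {RV P >-> R}.

Definition same_law (Y Z : T -> R) : Prop :=
  forall B : set R, measurable B -> P (Y @^-1` B) = P (Z @^-1` B).

Definition increment X (s t : R) : T -> R := fun w => X t w - X s w.

Definition independent_increments X : Prop :=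
  forall (n : nat) (t : nat -> R) (B : nat -> set R),
    0 <= t 0%N -> (forall i, t i <= t i.+1) -> (forall i, measurable (B i)) ->
    P (\bigcap_(i in `I_n) (increment X (t i) (t i.+1) @^-1` B i)) =
    (\prod_(i < n) P (increment X (t i) (t i.+1) @^-1` B i))%E.

Definition stationary_increments X : Prop :=
  forall s t : R, 0 <= s -> 0 <= t -> same_law (increment X s (s + t)) (X t).

Definition stochastically_continuous X : Prop :=
  forall s eps : R, 0 <= s -> 0 < eps ->
    P [set w | eps < `|X t w - X s w|] @[t --> within [set r | 0 <= r] (nbhs s)]
      --> 0%E.

Definition levy_process X : Prop :=
  [/\ {ae P, forall w, X 0 w = 0}, independent_increments X,
      stationary_increments X & stochastically_continuous X].

(** Lévy-Khintchine exponent of the triplet (drift [b], Gaussian variance [s2],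
    jump measure [nu]), with truncation on [-1, 1]. *)
Definition levy_khintchine (b s2 : R) (nu : {measure set R -> \bar R}) (u : R) : R[i] :=
  (- (s2 * u ^+ 2 / 2)) +i* (b * u) +
  cintegral nu setT
    (fun y => expi (u * y) - 1 - (if `|y| <= 1 then 0 +i* (u * y) else 0)).

Definition has_levy_measure X (nu : {measure set R -> \bar R}) : Prop :=
  [/\ nu [set 0] = 0%E,
      (\int[nu]_y (Num.min 1 (y ^+ 2))%:E < +oo)%E &
      exists b s2 : R, 0 <= s2 /\
        forall t u : R, 0 <= t ->
          cintegral P setT (fun w => expi (u * X t w)) =
          cexp (t%:C * levy_khintchine b s2 nu u)].

Definition strictly_stable (alpha : R) X : Prop :=
  forall a t : R, 0 < a -> 0 <= t ->
    same_law (X (a * t)) (fun w => a `^ alpha^-1 * X t w).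

Definition stable_density (alpha cm cp h : R) : R :=
  ((if h < 0 then cm else 0) + (if 0 < h then cp else 0)) *
  `|h| `^ (- alpha - 1).

Definition stable_process (alpha cm cp : R) X : Prop :=
  [/\ levy_process X, strictly_stable alpha X &
      exists nu : {measure set R -> \bar R},
        (forall A : set R, measurable A ->
           nu A = (\int[lebesgue_measure]_(h in A)
                     (stable_density alpha cm cp h)%:E)%E) /\
        has_levy_measure X nu].

Definition semigroup X (t : R) (f : R -> R[i]) (x : R) : R[i] :=
  cintegral P setT (fun w => f (x + X t w)).

(** [g] is the limit, uniformly on [R], of [(P_t f - f) / t] as [t] decreases
    to [0]. *)
Definition semigroup_derivative X (f g : R -> R[i]) : Prop :=
  forall eps : R, 0 < eps -> \forall t \near 0^'+, forall x : R,
    modulus ((t^-1)%:C * (semigroup X t f x - f x) - g x) <= eps.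

Definition generator_domain X : set (R -> R[i]) :=
  [set f | vanishing_at_infinity f /\ exists2 g, vanishing_at_infinity g & semigroup_derivative X f g].

(** [L] is unconstrained outside the domain. *)
Definition infinitesimal_generator X (L : (R -> R[i]) -> (R -> R[i])) : Prop :=
  forall f, generator_domain X f ->
    vanishing_at_infinity (L f) /\ semigroup_derivative X f (L f).

End Processes.

Definition inverse_in {E : Type} (D : set E) (L Linv : E -> E) : Prop :=
  [/\ forall f, D f -> D (L f), forall f, D f -> D (Linv f),
      forall f, D f -> Linv (L f) = f & forall f, D f -> L (Linv f) = f].

Definition inverse_coef {R : realType} (alpha M Mm Mp : R) : R :=
  M / (Mm ^+ 2 + Mp ^+ 2 + 2 * Mm * Mp * cos (pi * alpha)).

(* Main.v *)
(** On the Fourier side every operator involved is multiplication by a homogeneous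
    function.  By the Levy-Khintchine formula and strict stability the exponent of
    [X] is homogeneous of degree [alpha], with value
    [Gamma (- alpha) * (cp * e^{-i theta} + cm * e^{i theta})] at [1] and its
    conjugate at [-1], where [theta = pi * alpha / 2]; expanding the semigroup to
    second order in the exponent shows that [L] is the corresponding multiplier.
    The fractional integrals are the multipliers of degree [- alpha] with values
    [e^{i theta}, e^{- i theta}] and [e^{- i theta}, e^{i theta}].  The functions
    of [lizorkin_dual] vanish to infinite order at 0, so multiplication by a
    homogeneous function of any degree preserves this space, and inverting [L]
    amounts to inverting two complex numbers. *)
Require Import Defs.
From mathcomp Require Import all_boot all_order all_algebra.
From mathcomp Require Import all_classical all_reals all_analysis.
From mathcomp Require Import measurable_realfun gauss_integral complex ring lra.

Set Implicit Arguments.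
Unset Strict Implicit.
Unset Printing Implicit Defensive.

Import Order.TTheory GRing.Theory Num.Theory.
Import numFieldNormedType.Exports.

Local Open Scope classical_set_scope.
Local Open Scope complex_scope.
Local Open Scope ring_scope.

(** * Complex-valued functions and their integrals *)

(** The two explicit symbols come from integrals of [y^p phi(y z)] over the half line, where [phi]
    is an exponential minus part of its Taylor polynomial. On the imaginary axis they converge badly
    or not at all, so they are evaluated for [Re z > 0] and then passed to the limit. Rotation of
    the contour is replaced by a linear differential equation along the line [Re z = 1], and
    integration by parts by Euler's identity for homogeneous functions; scaling reaches the other
    points. For the exponent the limit is dominated in the jump size. The kernel of the fractional
    integrals is not integrable at infinity, so there the limit is taken after pairing with a
    transform that is flat at 0 and absorbs the singularity of order [alpha]. Since [fourier] uses
    the kernel [e^{iux}], inversion uses [e^{-iux}], and the generator multiplies by the exponent at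
    [- u]: its two coefficients appear swapped. The denominator of [K] is the squared modulus of
    [Mp e^{i theta} + Mm e^{- i theta}]; it is nonzero because [alpha != 1] keeps [cos theta] away
    from 0. *)

Section Modulus.
Context {R : realType}.
Implicit Types z w : R[i].

Lemma modulusE z : modulus z = Num.sqrt (complex.Re z ^+ 2 + complex.Im z ^+ 2).
Proof. by case: z. Qed.

Lemma modulus_ge0 z : 0 <= modulus z.
Proof. by rewrite modulusE sqrtr_ge0. Qed.

Lemma modulusM z w : modulus (z * w) = modulus z * modulus w.
Proof. exact: complex.ComplexField.Normc.normcM. Qed.

Lemma modulusD z w : modulus (z + w) <= modulus z + modulus w.
Proof. exact: le_normcD. Qed.

Lemma modulusN z : modulus (- z) = modulus z.
Proof. exact: normcN. Qed.

Lemma modulusB z w : modulus (z - w) <= modulus z + modulus w.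
Proof. by rewrite -[modulus w]modulusN; exact: modulusD. Qed.

Lemma modulusR (x : R) : modulus x%:C = `|x|.
Proof. by rewrite modulusE /= expr0n /= addr0 sqrtr_sqr. Qed.

Lemma modulus0 : modulus (0 : R[i]) = 0.
Proof. by rewrite (modulusR 0) normr0. Qed.

Lemma modulus0_eq0 z : modulus z = 0 -> z = 0.
Proof. exact: complex.ComplexField.Normc.eq0_normc. Qed.

Lemma modulusX z n : modulus (z ^+ n) = modulus z ^+ n.
Proof.
elim: n => [|n IHn]; first by rewrite !expr0 (modulusR 1) normr1.
by rewrite !exprS modulusM IHn.
Qed.

Lemma le_Re_modulus z : `|complex.Re z| <= modulus z.
Proof.
by rewrite modulusE -[leLHS]sqrtr_sqr ler_sqrt ?lerDl ?sqr_ge0// addr_ge0 ?sqr_ge0.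
Qed.

Lemma le_Im_modulus z : `|complex.Im z| <= modulus z.
Proof.
by rewrite modulusE -[leLHS]sqrtr_sqr ler_sqrt ?lerDr ?sqr_ge0// addr_ge0 ?sqr_ge0.
Qed.

Lemma modulus_le_ReIm z : modulus z <= `|complex.Re z| + `|complex.Im z|.
Proof.
rewrite modulusE -[leRHS]ger0_norm ?addr_ge0// -sqrtr_sqr ler_sqrt ?sqr_ge0//.
by rewrite sqrrD !real_normK ?num_real// lerD2r lerDl mulrn_wge0 ?mulr_ge0.
Qed.

Lemma modulus_expi (x : R) : modulus (expi x) = 1.
Proof. by rewrite modulusE /= cos2Dsin2 sqrtr1. Qed.

Lemma modulus_cexp z : modulus (cexp z) = expR (complex.Re z).
Proof. by rewrite modulusM modulus_expi mulr1 modulusR ger0_norm ?expR_ge0. Qed.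

Lemma expiD (x y : R) : expi (x + y) = expi x * expi y.
Proof. by rewrite /expi cosD sinD; apply/eqP; rewrite eq_complex /=; apply/andP; split; apply/eqP; ring. Qed.

Lemma expi0 : expi (0 : R) = 1.
Proof. by rewrite /expi cos0 sin0. Qed.

Lemma cexpD z w : cexp (z + w) = cexp z * cexp w.
Proof.
case: z w => [a b] [c d]; rewrite /cexp /= expRD expiD.
by rewrite rmorphM /=; ring.
Qed.

Lemma cexp0 : cexp (0 : R[i]) = 1.
Proof. by rewrite /cexp /= expR0 expi0 mulr1. Qed.

Lemma cexp_i (x : R) : cexp (0 +i* x) = expi x.
Proof. by rewrite /cexp /= expR0 mul1r. Qed.

End Modulus.

Section ComplexIntegral.
Context {R : realType} {d : measure_display} {T : measurableType d}.
Implicit Types f g : T -> R[i].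

Definition cmeasurable f :=
  measurable_fun setT (rpart f) /\ measurable_fun setT (ipart f).

Lemma cmeasurableD f g :
  cmeasurable f -> cmeasurable g -> cmeasurable (fun x => f x + g x).
Proof.
move=> [mf1 mf2] [mg1 mg2]; split.
  rewrite (_ : rpart _ = rpart f \+ rpart g); first exact: measurable_funD.
  by apply/funext => x; rewrite /rpart /=; case: (f x) (g x) => [? ?] [? ?].
rewrite (_ : ipart _ = ipart f \+ ipart g); first exact: measurable_funD.
by apply/funext => x; rewrite /ipart /=; case: (f x) (g x) => [? ?] [? ?].
Qed.

Lemma cmeasurableM f g :
  cmeasurable f -> cmeasurable g -> cmeasurable (fun x => f x * g x).
Proof.
move=> [mf1 mf2] [mg1 mg2]; split.
  rewrite (_ : rpart _ = (fun x => rpart f x * rpart g x - ipart f x * ipart g x)).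
    by apply: measurable_funB; apply: measurable_funM.
  by apply/funext => x; rewrite /rpart /ipart /=; case: (f x) (g x) => [? ?] [? ?].
rewrite (_ : ipart _ = (fun x => rpart f x * ipart g x + ipart f x * rpart g x)).
  by apply: measurable_funD; apply: measurable_funM.
by apply/funext => x; rewrite /rpart /ipart /=; case: (f x) (g x) => [? ?] [? ?].
Qed.

Lemma cmeasurableR (f : T -> R) :
  measurable_fun setT f -> cmeasurable (fun x => (f x)%:C).
Proof. by move=> mf; split; [exact: mf | exact: measurable_cst]. Qed.

Lemma cmeasurable_cst (c : R[i]) : cmeasurable (fun=> c).
Proof. by split; exact: measurable_cst. Qed.

Lemma cmeasurableN f : cmeasurable f -> cmeasurable (fun x => - f x).
Proof.
move=> mf; rewrite (_ : (fun _ => _) = (fun x => -1 * f x)); last first.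
  by apply/funext => x; rewrite mulN1r.
by apply: cmeasurableM => //; exact: cmeasurable_cst.
Qed.

Lemma cmeasurableB f g :
  cmeasurable f -> cmeasurable g -> cmeasurable (fun x => f x - g x).
Proof. by move=> mf mg; apply: cmeasurableD => //; exact: cmeasurableN. Qed.

Lemma cmeasurable_expi (f : T -> R) :
  measurable_fun setT f -> cmeasurable (fun x => expi (f x)).
Proof.
move=> mf; split; rewrite /rpart /ipart /=; apply: measurableT_comp => //.
- by apply: continuous_measurable_fun; exact: continuous_cos.
- by apply: continuous_measurable_fun; exact: continuous_sin.
Qed.

Lemma cmeasurable_cexp f : cmeasurable f -> cmeasurable (fun x => cexp (f x)).
Proof.
move=> [mf1 mf2]; apply: cmeasurableM.
  by apply: cmeasurableR; apply: measurableT_comp mf1; exact: measurable_expR.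
exact: cmeasurable_expi.
Qed.

Lemma measurable_modulus f : cmeasurable f -> measurable_fun setT (fun x => modulus (f x)).
Proof.
move=> [mf1 mf2]; rewrite (_ : (fun _ => _) = (fun x => Num.sqrt (rpart f x ^+ 2 + ipart f x ^+ 2))).
  apply: measurableT_comp; first by apply: continuous_measurable_fun; exact: sqrt_continuous.
  by apply: measurable_funD; apply: measurable_funX.
by apply/funext => x; rewrite modulusE.
Qed.

Definition cintegrable (mu : {measure set T -> \bar R}) f :=
  mu.-integrable setT (EFin \o rpart f) /\ mu.-integrable setT (EFin \o ipart f).

Variable mu : {measure set T -> \bar R}.

Lemma cintegrable_measurable f : cintegrable mu f -> cmeasurable f.
Proof. by move=> [/measurable_int/measurable_EFinP ? /measurable_int/measurable_EFinP ?]. Qed.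

Lemma cintegrable_le f (g : T -> R) : cmeasurable f ->
  mu.-integrable setT (EFin \o g) -> (forall x, modulus (f x) <= g x) ->
  cintegrable mu f.
Proof.
move=> [mf1 mf2] ig fg; split; apply: le_integrable ig => //.
- exact/measurable_EFinP.
- move=> x _ /=; rewrite lee_fin (le_trans (le_Re_modulus (f x)))//.
  by rewrite (le_trans (fg x))// ler_norm.
- exact/measurable_EFinP.
- move=> x _ /=; rewrite lee_fin (le_trans (le_Im_modulus (f x)))//.
  by rewrite (le_trans (fg x))// ler_norm.
Qed.

Lemma integrable_modulus f : cintegrable mu f ->
  mu.-integrable setT (EFin \o (fun x => modulus (f x))).
Proof.
move=> fi; have [mf1 mf2] := cintegrable_measurable fi.
case: fi => i1 i2.
have i : mu.-integrable setT (EFin \o (fun x => `|rpart f x| + `|ipart f x|)).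
  rewrite (_ : _ \o _ = (abse \o (EFin \o rpart f)) \+ (abse \o (EFin \o ipart f)))%E//.
  by apply: integrableD => //; exact: integrable_abse.
apply: le_integrable i => //.
  by apply/measurable_EFinP; apply: measurable_modulus.
move=> x _ /=; rewrite lee_fin ger0_norm ?modulus_ge0//.
by rewrite ger0_norm ?addr_ge0// modulus_le_ReIm.
Qed.

Lemma cintegrable_modulus f : cmeasurable f ->
  mu.-integrable setT (EFin \o (fun x => modulus (f x))) -> cintegrable mu f.
Proof. by move=> mf i; apply: (cintegrable_le mf i) => x. Qed.

Lemma cintegrableD f g : cintegrable mu f -> cintegrable mu g ->
  cintegrable mu (fun x => f x + g x).
Proof.
move=> fi gi; apply: cintegrable_modulus.
  by apply: cmeasurableD; exact: cintegrable_measurable.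
have i : mu.-integrable setT (EFin \o (fun x => modulus (f x) + modulus (g x))).
  rewrite (_ : _ \o _ = (EFin \o (fun x => modulus (f x))) \+ (EFin \o (fun x => modulus (g x))))%E//.
  by apply: integrableD => //; exact: integrable_modulus.
apply: le_integrable i => //.
  by apply/measurable_EFinP; apply: measurable_modulus; apply: cmeasurableD; exact: cintegrable_measurable.
move=> x _ /=; rewrite lee_fin ger0_norm ?modulus_ge0//.
by rewrite ger0_norm ?addr_ge0 ?modulus_ge0// modulusD.
Qed.

Lemma cintegrableMl f g (M : R) : cmeasurable g -> (forall x, modulus (g x) <= M) ->
  cintegrable mu f -> cintegrable mu (fun x => g x * f x).
Proof.
move=> mg gM fi; have i := integrable_modulus fi.
have i2 : mu.-integrable setT (EFin \o (fun x => M * modulus (f x))).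
  rewrite (_ : _ \o _ = (fun x => M%:E * (EFin \o (fun x => modulus (f x))) x)%E)//.
  exact: integrableZl.
apply: cintegrable_le i2 _.
  by apply: cmeasurableM => //; exact: cintegrable_measurable.
by move=> x; rewrite modulusM ler_wpM2r ?modulus_ge0.
Qed.

Lemma cintegrableZ (c : R[i]) f : cintegrable mu f -> cintegrable mu (fun x => c * f x).
Proof. by apply: cintegrableMl (cmeasurable_cst c) _ => x; exact: lexx. Qed.

Lemma cintegrableB f g : cintegrable mu f -> cintegrable mu g ->
  cintegrable mu (fun x => f x - g x).
Proof.
move=> fi gi; apply: cintegrableD => //.
rewrite (_ : (fun _ => _) = (fun x => -1 * g x)); first exact: cintegrableZ.
by apply/funext => x; rewrite mulN1r.
Qed.

Lemma eq_cintegral f g : f =1 g -> cintegral mu setT f = cintegral mu setT g.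
Proof. by move=> /funext ->. Qed.

Lemma cintegralD f g : cintegrable mu f -> cintegrable mu g ->
  cintegral mu setT (fun x => f x + g x) = cintegral mu setT f + cintegral mu setT g.
Proof.
move=> [f1 f2] [g1 g2]; rewrite /cintegral.
apply/eqP; rewrite eq_complex /=; apply/andP; split; apply/eqP.
  rewrite -RintegralD//; apply: eq_Rintegral => x _.
  by rewrite /rpart; case: (f x) (g x) => [? ?] [? ?].
rewrite -RintegralD//; apply: eq_Rintegral => x _.
by rewrite /ipart; case: (f x) (g x) => [? ?] [? ?].
Qed.

Lemma integrable_scale (a : R) (h : T -> R) :
  mu.-integrable setT (EFin \o h) -> mu.-integrable setT (EFin \o (fun x => a * h x)).
Proof.
move=> ih; rewrite (_ : _ \o _ = (fun x => a%:E * (EFin \o h) x)%E)//.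
exact: integrableZl.
Qed.

Lemma cintegralZ (c : R[i]) f : cintegrable mu f ->
  cintegral mu setT (fun x => c * f x) = c * cintegral mu setT f.
Proof.
case: c => a b [f1 f2]; rewrite /cintegral.
apply/eqP; rewrite eq_complex /=; apply/andP; split; apply/eqP.
  rewrite -!RintegralZl// -RintegralB//; try exact: integrable_scale.
  apply: eq_Rintegral => x _.
  by rewrite /rpart /ipart; case: (f x) => [? ?].
rewrite -!RintegralZl// -RintegralD//; try exact: integrable_scale.
apply: eq_Rintegral => x _.
by rewrite /rpart /ipart; case: (f x) => [? ?].
Qed.

Lemma cintegralN f : cintegrable mu f ->
  cintegral mu setT (fun x => - f x) = - cintegral mu setT f.
Proof.
move=> fi; rewrite -[RHS]mulN1r -cintegralZ//.
by apply: eq_cintegral => x; rewrite mulN1r.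
Qed.

Lemma cintegralB f g : cintegrable mu f -> cintegrable mu g ->
  cintegral mu setT (fun x => f x - g x) = cintegral mu setT f - cintegral mu setT g.
Proof.
move=> fi gi; rewrite cintegralD ?cintegralN//.
rewrite (_ : (fun _ => _) = (fun x => -1 * g x)); first exact: cintegrableZ.
by apply/funext => x; rewrite mulN1r.
Qed.

Lemma cintegralR (f : T -> R) :
  cintegral mu setT (fun x => (f x)%:C) = (Rintegral mu setT f)%:C.
Proof.
rewrite /cintegral; apply/eqP; rewrite eq_complex /=; apply/andP; split; apply/eqP => //.
by rewrite /Rintegral /ipart /= integral0.
Qed.

(* The factor 2 comes from bounding real and imaginary parts separately. *)
Lemma modulus_cintegral f (g : T -> R) : cmeasurable f ->
  mu.-integrable setT (EFin \o g) -> (forall x, modulus (f x) <= g x) ->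
  modulus (cintegral mu setT f) <= 2 * Rintegral mu setT g.
Proof.
move=> mf ig fg; have [f1 f2] := cintegrable_le mf ig fg.
apply: (le_trans (modulus_le_ReIm _)); rewrite mulrC mulr_natr mulr2n lerD//=.
  apply: (le_trans (le_normr_Rintegral measurableT f1)).
  apply: le_Rintegral => //.
    rewrite (_ : _ \o _ = abse \o (EFin \o rpart f))//; exact: integrable_abse.
  by move=> x _; apply: le_trans (le_Re_modulus _) (fg x).
apply: (le_trans (le_normr_Rintegral measurableT f2)).
apply: le_Rintegral => //.
  rewrite (_ : _ \o _ = abse \o (EFin \o ipart f))//; exact: integrable_abse.
by move=> x _; apply: le_trans (le_Im_modulus _) (fg x).
Qed.

End ComplexIntegral.

(** * Sequential limits of complex numbers and dominated convergence *)

Section ComplexSequences.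
Context {R : realType}.
Implicit Types u v : nat -> R[i].

Definition ccvg u (l : R[i]) := (fun n => modulus (u n - l)) @ \oo --> (0 : R).

Lemma ccvg_le u l (e : nat -> R) : (forall n, modulus (u n - l) <= e n) ->
  e @ \oo --> (0 : R) -> ccvg u l.
Proof.
move=> ue e0; apply: squeeze_cvgr (cvg_cst 0) e0.
by near=> n; rewrite modulus_ge0 ue.
Unshelve. all: by end_near. Qed.

Lemma ccvg_near_le u l (e : nat -> R) : (\forall n \near \oo, modulus (u n - l) <= e n) ->
  e @ \oo --> (0 : R) -> ccvg u l.
Proof.
move=> ue e0; apply: squeeze_cvgr (cvg_cst 0) e0.
by near=> n; rewrite modulus_ge0; near: n.
Unshelve. all: by end_near. Qed.

Lemma ccvg_cst (c : R[i]) : ccvg (fun=> c) c.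
Proof. by rewrite /ccvg subrr modulus0; exact: cvg_cst. Qed.

Lemma ccvgR (u : nat -> R) (l : R) : u @ \oo --> l -> ccvg (fun n => (u n)%:C) l%:C.
Proof.
move=> ul; rewrite /ccvg.
rewrite (_ : (fun _ => _) = (fun n => `|u n - l|)); last first.
  by apply/funext => n; rewrite -modulusR rmorphB.
by apply/norm_cvg0P; apply/subr_cvg0.
Qed.

Lemma ccvgD u v l m : ccvg u l -> ccvg v m -> ccvg (fun n => u n + v n) (l + m).
Proof.
move=> ul vm; apply: (@ccvg_le _ _ (fun n => modulus (u n - l) + modulus (v n - m))).
  by move=> n; rewrite opprD addrACA modulusD.
by rewrite -(addr0 0); exact: cvgD ul vm.
Qed.

Lemma ccvgM u v l m : ccvg u l -> ccvg v m -> ccvg (fun n => u n * v n) (l * m).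
Proof.
move=> ul vm; apply: (@ccvg_le _ _ (fun n => modulus (u n - l) * modulus (v n - m)
   + (modulus l * modulus (v n - m) + modulus (u n - l) * modulus m))).
  move=> n; rewrite (_ : u n * v n - l * m = (u n - l) * (v n - m) + (l * (v n - m) + (u n - l) * m)); last by ring.
  apply: (le_trans (modulusD _ _)); rewrite modulusM lerD2l.
  by apply: (le_trans (modulusD _ _)); rewrite !modulusM.
have -> : (0 : R) = 0 * 0 + (modulus l * 0 + 0 * modulus m) by rewrite !mulr0 !mul0r !addr0.
by apply: cvgD; [exact: cvgM | apply: cvgD; apply: cvgM => //; exact: cvg_cst].
Qed.

Lemma ccvgZ c u l : ccvg u l -> ccvg (fun n => c * u n) (c * l).
Proof. exact: ccvgM (ccvg_cst c). Qed.

Lemma ccvgN u l : ccvg u l -> ccvg (fun n => - u n) (- l).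
Proof.
move=> ul; rewrite /ccvg (_ : (fun _ => _) = (fun n => modulus (u n - l)))//.
by apply/funext => n; rewrite -opprD modulusN.
Qed.

Lemma ccvg_Re u l : ccvg u l -> (fun n => complex.Re (u n)) @ \oo --> complex.Re l.
Proof.
move=> ul; apply/subr_cvg0; apply/norm_cvg0P.
apply: squeeze_cvgr (cvg_cst 0) ul; near=> n; rewrite normr_ge0 /=.
by apply: le_trans (le_Re_modulus _); case: (u n) l => [? ?] [? ?].
Unshelve. all: by end_near. Qed.

Lemma ccvg_Im u l : ccvg u l -> (fun n => complex.Im (u n)) @ \oo --> complex.Im l.
Proof.
move=> ul; apply/subr_cvg0; apply/norm_cvg0P.
apply: squeeze_cvgr (cvg_cst 0) ul; near=> n; rewrite normr_ge0 /=.
by apply: le_trans (le_Im_modulus _); case: (u n) l => [? ?] [? ?].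
Unshelve. all: by end_near. Qed.

Lemma ccvg_ReIm u l : (fun n => complex.Re (u n)) @ \oo --> complex.Re l ->
  (fun n => complex.Im (u n)) @ \oo --> complex.Im l -> ccvg u l.
Proof.
move=> ur ui; apply: (@ccvg_le _ _ (fun n => `|complex.Re (u n) - complex.Re l| + `|complex.Im (u n) - complex.Im l|)).
  by move=> n; apply: (le_trans (modulus_le_ReIm _)); case: (u n) l {ur ui} => [? ?] [? ?].
by rewrite -(addr0 0); apply: cvgD; apply/norm_cvg0P; apply/subr_cvg0.
Qed.

Lemma ccvg_unique u l m : ccvg u l -> ccvg u m -> l = m.
Proof.
move=> ul um; apply/eqP; rewrite eq_complex; apply/andP; split; apply/eqP.
  exact: (cvg_unique (@Rhausdorff R) (ccvg_Re ul) (ccvg_Re um)).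
exact: (cvg_unique (@Rhausdorff R) (ccvg_Im ul) (ccvg_Im um)).
Qed.

Lemma ccvg_expi (u : nat -> R) l : u @ \oo --> l -> ccvg (fun n => expi (u n)) (expi l).
Proof.
move=> ul; apply: ccvg_ReIm.
  exact: (continuous_cvg _ (@continuous_cos R l) ul).
exact: (continuous_cvg _ (@continuous_sin R l) ul).
Qed.

Lemma ccvg_cexp u l : ccvg u l -> ccvg (fun n => cexp (u n)) (cexp l).
Proof.
move=> ul; apply: ccvgM; last exact: ccvg_expi (ccvg_Im ul).
by apply: ccvgR; apply: (continuous_cvg _ (@continuous_expR R _) (ccvg_Re ul)).
Qed.

End ComplexSequences.

Section ComplexLimits.
Context {R : realType} {d : measure_display} {T : measurableType d}.

Lemma cintegral_dominated_convergence (mu : {measure set T -> \bar R})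
    (f_ : nat -> T -> R[i]) (f : T -> R[i]) (g : T -> R) :
  (forall n, cmeasurable (f_ n)) -> cmeasurable f ->
  (forall x, ccvg (fun n => f_ n x) (f x)) ->
  mu.-integrable setT (EFin \o g) -> (forall n x, modulus (f_ n x) <= g x) ->
  ccvg (fun n => cintegral mu setT (f_ n)) (cintegral mu setT f).
Proof.
move=> mf_ [mf1 mf2] fcvg ig fg.
(* [p] stands for the real or the imaginary part; one argument serves both. *)
suff H (p : R[i] -> R) : (forall n, measurable_fun setT (p \o f_ n)) ->
    measurable_fun setT (p \o f) -> (forall x, (fun n => p (f_ n x)) @ \oo --> p (f x)) ->
    (forall z, `|p z| <= modulus z) ->
    (fun n => Rintegral mu setT (p \o f_ n)) @ \oo --> Rintegral mu setT (p \o f).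
  apply: ccvg_ReIm.
    change ((fun n => Rintegral mu setT (@complex.Re R \o f_ n)) @ \oo --> Rintegral mu setT (@complex.Re R \o f)).
    apply: H => //; [by move=> n; case: (mf_ n) | | exact: le_Re_modulus].
    by move=> x; exact: ccvg_Re.
  change ((fun n => Rintegral mu setT (@complex.Im R \o f_ n)) @ \oo --> Rintegral mu setT (@complex.Im R \o f)).
  apply: H => //; [by move=> n; case: (mf_ n) | | exact: le_Im_modulus].
  by move=> x; exact: ccvg_Im.
move=> mpf_ mpf pcvg ple.
have mp n : measurable_fun setT (EFin \o (p \o f_ n)) by apply/measurable_EFinP.
have mp' : measurable_fun setT (EFin \o (p \o f)) by apply/measurable_EFinP.
have pe x : setT x -> (fun n => (EFin \o (p \o f_ n)) x) @ \oo --> (EFin \o (p \o f)) x.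
  by move=> _; apply: cvg_EFin; [exact: nearW | exact: pcvg].
have [i1 _ i3] := @dominated_convergence _ _ _ mu setT measurableT
  (fun n => EFin \o (p \o f_ n)) (EFin \o (p \o f)) (EFin \o g)
  mp mp'
  (aeW _ pe) ig
  (aeW _ (fun x n _ => le_trans (ple (f_ n x)) (fg n x))).
apply: fine_cvg; rewrite fineK//; exact: integrable_fin_num.
Qed.

End ComplexLimits.

(** * Image measures, densities, affine substitutions and Fubini *)

Section ImageMeasure.
Context {R : realType} {d d' : measure_display}.
Context {X : measurableType d} {Y : measurableType d'}.
Variables (mu : {measure set X -> \bar R}) (nu : {measure set Y -> \bar R}) (phi : X -> Y).
Hypothesis mphi : measurable_fun setT phi.
Hypothesis nuE : forall A, measurable A -> nu A = mu (phi @^-1` A).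

Lemma ge0_integral_image (f : Y -> \bar R) : measurable_fun setT f ->
  (forall y, (0 <= f y)%E) -> (\int[nu]_y f y = \int[mu]_x f (phi x))%E.
Proof.
move=> mf f0; rewrite -[RHS](ge0_integral_pushforward mphi mu measurableT mf).
  apply: (@eq_measure_integral _ _ _ _ (measure_function_pushforward__canonical__measure_function_Measure mu mphi) nu).
  by move=> A mA _; exact: nuE.
by move=> y _; exact: f0.
Qed.

(** Positive and negative parts transfer separately, and the integral is their difference by
    definition. *)
Lemma integral_image (f : Y -> \bar R) : measurable_fun setT f ->
  (\int[nu]_y f y = \int[mu]_x f (phi x))%E.
Proof.
move=> mf; rewrite integralE [RHS]integralE; congr (_ - _)%E.
  rewrite (ge0_integral_image (measurable_funepos mf))//.
  by apply: eq_integral => x _; rewrite !funeposE.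
rewrite (ge0_integral_image (measurable_funeneg mf))//.
by apply: eq_integral => x _; rewrite !funenegE.
Qed.

Lemma cintegral_image (f : Y -> R[i]) : cmeasurable f ->
  cintegral nu setT f = cintegral mu setT (fun x => f (phi x)).
Proof.
move=> [mf1 mf2]; rewrite /cintegral /Rintegral !integral_image//; exact/measurable_EFinP.
Qed.

Lemma integrable_image (f : Y -> \bar R) : nu.-integrable setT f ->
  mu.-integrable setT (f \o phi).
Proof.
move=> /integrableP[mf fi]; apply/integrableP; split; first exact: measurableT_comp.
rewrite -(ge0_integral_image (f := fun y => `|f y|%E))//.
exact: measurableT_comp.
Qed.

End ImageMeasure.

Section Density.
Context {R : realType} {d : measure_display} {T : measurableType d}.
Variables (mu nu : {measure set T -> \bar R}) (p : T -> R).
Hypothesis mp : measurable_fun setT p.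
Hypothesis p0 : forall x, 0 <= p x.
Hypothesis nuE : forall A, measurable A -> (nu A = \int[mu]_(x in A) (p x)%:E)%E.
Import HBNNSimple.

Lemma integral_density_indic A : measurable A ->
  (\int[nu]_x (\1_A x)%:E = \int[mu]_x (\1_A x * p x)%:E)%E.
Proof.
move=> mA; rewrite integral_indic// setIT nuE// integral_mkcond.
apply: eq_integral => x _; rewrite patchE indicE; case: ifP => /= _.
  by rewrite mul1r.
by rewrite mul0r.
Qed.

Lemma integral_density_nnsfun (f : {nnsfun T >-> R}) :
  (\int[nu]_x (f x)%:E = \int[mu]_x (f x * p x)%:E)%E.
Proof.
under [LHS]eq_integral do rewrite fimfunE -fsumEFin//.
rewrite [LHS]ge0_integral_fsum//; last 2 first.
  - by move=> r; exact/measurable_EFinP/measurableT_comp.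
  - by move=> n x _; rewrite EFinM nnfun_muleindic_ge0.
under [RHS]eq_integral.
  move=> x xD; rewrite fimfunE EFinM -fsumEFin// ge0_mule_fsuml; last first.
    by move=> r; rewrite EFinM nnfun_muleindic_ge0.
  over.
rewrite [RHS]ge0_integral_fsum//; last 2 first.
  - move=> r; apply: emeasurable_funM; last exact/measurable_EFinP.
    by apply/measurable_EFinP; apply/measurableT_comp.
  - by move=> n x _; apply: mule_ge0; rewrite ?lee_fin// -lee_fin EFinM nnfun_muleindic_ge0.
apply: eq_fsbigr => r _.
under [RHS]eq_integral do rewrite -EFinM -mulrA EFinM.
have mr : measurable (f @^-1` [set r]) by [].
(* The level sets at negative [r] are empty because [f] is nonnegative. *)
have [r0|r0] := leP 0 r.
  rewrite [RHS]ge0_integralZl//; last 2 first.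
  - by apply/measurable_EFinP; apply: measurable_funM.
  - by move=> x _; rewrite lee_fin mulr_ge0.
  by rewrite integralZl_indic_nnsfun// -integral_density_indic.
rewrite preimage_nnfun0//.
by rewrite !integral0_eq// => x _; rewrite indic0 /= ?mulr0 ?mul0r ?mule0.
Qed.

(** The formula climbs from indicators to simple functions and passes to the limit by monotone
    convergence on both sides. *)
Lemma ge0_integral_density (f : T -> \bar R) : measurable_fun setT f ->
  (forall x, 0 <= f x)%E -> (\int[nu]_x f x = \int[mu]_x (f x * (p x)%:E))%E.
Proof.
move=> mf f0.
pose f_ := nnsfun_approx measurableT mf.
transitivity (lim (\int[nu]_x (f_ n x)%:E @[n --> \oo])%E).
  rewrite -monotone_convergence//=.
  - apply: eq_integral => ? /[!inE] xD; apply/esym/cvg_lim => //=.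
    exact: cvg_nnsfun_approx.
  - by move=> n; exact/measurable_EFinP/measurable_funTS.
  - by move=> n ? _; rewrite lee_fin.
  - by move=> ? _ ? ? mn; rewrite lee_fin; exact/lefP/nd_nnsfun_approx.
transitivity (lim (\int[mu]_x (f_ n x * p x)%:E @[n --> \oo])%E).
  by apply: congr_lim; apply/funext => n /=; exact: integral_density_nnsfun.
rewrite -monotone_convergence//=.
- apply: eq_integral => x /[!inE] xD; apply/cvg_lim => //=.
  under eq_fun do rewrite EFinM.
  apply: cvgeZr => //.
  exact: cvg_nnsfun_approx.
- by move=> n; apply/measurable_EFinP; apply: measurable_funM => //; exact/measurable_funTS.
- by move=> n x _; rewrite lee_fin mulr_ge0.
- by move=> x _ ? ? mn; rewrite lee_fin ler_wpM2r//; exact/lefP/nd_nnsfun_approx.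
Qed.

Lemma Rintegral_density (f : T -> R) : measurable_fun setT f ->
  Rintegral nu setT f = Rintegral mu setT (fun x => f x * p x).
Proof.
move=> mf; have mf' : measurable_fun setT (EFin \o f) by exact/measurable_EFinP.
rewrite /Rintegral integralE [in RHS]integralE; congr (fine (_ - _)).
  rewrite ge0_integral_density//; last exact: measurable_funepos.
  by apply: eq_integral => x _; rewrite !funeposE EFinM maxe_pMl ?lee_fin// mul0e.
rewrite ge0_integral_density//; last exact: measurable_funeneg.
by apply: eq_integral => x _; rewrite !funenegE EFinM -mulNe maxe_pMl ?lee_fin// mul0e.
Qed.

Lemma cintegral_density (f : T -> R[i]) : cmeasurable f ->
  cintegral nu setT f = cintegral mu setT (fun x => f x * (p x)%:C).
Proof.
move=> [mf1 mf2]; rewrite /cintegral !Rintegral_density//.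
apply/eqP; rewrite eq_complex /=; apply/andP; split; apply/eqP; apply: eq_Rintegral => x _.
  by rewrite /rpart; case: (f x) => a b /=; rewrite mulr0 subr0.
by rewrite /ipart; case: (f x) => a b /=; rewrite mulr0 add0r.
Qed.

End Density.

Section AffineChange.
Context {R : realType}.
Notation leb := (@lebesgue_measure R).

(** Lebesgue measure is determined by its values on half-open intervals, and the preimage of such an
    interval is one whose length is divided by [b]. *)
Lemma lebesgue_measure_affine (a b : R) (b0 : 0 < b) (A : set R) : measurable A ->
  leb A = mscale (NngNum (ltW b0)) leb ((fun x => a + b * x) @^-1` A).
Proof.
move=> mA; set phi := fun x : measurableTypeR R => (a + b * x : measurableTypeR R).
have mphi : measurable_fun setT phi.
  by apply: measurable_funD => //; apply: measurable_funM.
apply: (@lebesgue_measure_unique _ (measure_function_pushforward__canonical__measure_function_Measure (mscale (NngNum (ltW b0)) leb) mphi)) => // X.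
move=> -[[x y] /= xy <-]; rewrite /= lebesgue_measure_itv /= /pushforward.
rewrite (_ : phi @^-1` _ = `](x - a) / b, (y - a) / b]%classic); last first.
  apply/seteqP; split => z /=; rewrite /phi !in_itv /= ltr_pdivrMr// ler_pdivlMr// ltrBlDl lerBrDl mulrC//.
rewrite /mscale/= lebesgue_measure_itv /= !lte_fin ltr_pM2r ?invr_gt0// ltrD2r.
case: ifP => _; last by rewrite mule0.
rewrite -!EFinB -EFinM; congr (_%:E); field.
by rewrite gt_eqF.
Qed.

Lemma measurable_affine (a b : R) : measurable_fun setT (fun x : R => a + b * x).
Proof. by apply: measurable_funD => //; apply: measurable_funM. Qed.

Lemma cmeasurable_affine (f : R -> R[i]) (a b : R) : cmeasurable f ->
  cmeasurable (fun x => f (a + b * x)).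
Proof.
move=> [mf1 mf2]; split; first exact: (measurableT_comp mf1 (measurable_affine a b)).
exact: (measurableT_comp mf2 (measurable_affine a b)).
Qed.

Lemma integrable_affine (f : R -> R) (a b : R) : 0 < b ->
  leb.-integrable setT (EFin \o f) -> leb.-integrable setT (EFin \o (fun x => f (a + b * x))).
Proof.
move=> b0 fi.
have := @integrable_image _ _ _ (measurableTypeR R) (measurableTypeR R) _ _ _ (measurable_affine a b) (@lebesgue_measure_affine a b b0) _ fi.
move=> /integrableP[mf]; rewrite ge0_integral_mscale//=; last exact: (measurableT_comp (@abse_measurable _ setT) mf).
move=> iy; apply/integrableP; split => //; rewrite ltNge leye_eq; apply/negP => /eqP H.
by move: iy; rewrite H gt0_muley ?lte_fin// ltxx.
Qed.

Lemma cintegrable_affine (f : R -> R[i]) (a b : R) : 0 < b ->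
  cintegrable leb f -> cintegrable leb (fun x => f (a + b * x)).
Proof. by move=> b0 [f1 f2]; split; [exact: (integrable_affine a b0 f1) | exact: (integrable_affine a b0 f2)]. Qed.

Lemma cintegral_affine (f : R -> R[i]) (a b : R) : 0 < b -> cintegrable leb f ->
  cintegral leb setT f = b%:C * cintegral leb setT (fun x => f (a + b * x)).
Proof.
move=> b0 fi.
rewrite (@cintegral_image _ _ _ (measurableTypeR R) (measurableTypeR R) _ _ _ (measurable_affine a b) (@lebesgue_measure_affine a b b0))//; last first.
  exact: cintegrable_measurable fi.
rewrite (cintegral_density (mu := leb) (nu := mscale (NngNum (ltW b0)) leb) (p := fun=> b))//; last 3 first.
- by move=> x; exact: ltW.
- by move=> A mA; rewrite integral_cst.
- by apply: cmeasurable_affine; exact: cintegrable_measurable fi.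
rewrite -cintegralZ; last exact: cintegrable_affine.
by apply: eq_cintegral => x; rewrite mulrC.
Qed.

(** The reflection complements [cintegral_affine], whose factor is positive. *)
Lemma cintegral_opp (f : R -> R[i]) : cmeasurable f ->
  cintegral leb setT f = cintegral leb setT (fun x => f (- x)).
Proof.
move=> mf; apply: (@cintegral_image _ _ _ (measurableTypeR R) (measurableTypeR R) leb leb (-%R : R -> R)) => //.
by move=> A mA; exact: (esym (lebesgue_measureN mA)).
Qed.

Lemma integrable_opp (f : R -> R) :
  leb.-integrable setT (EFin \o f) -> leb.-integrable setT (EFin \o (fun x => f (- x))).
Proof.
apply: (@integrable_image _ _ _ (measurableTypeR R) (measurableTypeR R) leb leb (-%R : R -> R)) => //.
by move=> A mA; exact: (esym (lebesgue_measureN mA)).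
Qed.

End AffineChange.

Section ComplexFubini.
Context {R : realType} {d1 d2 : measure_display}.
Context {T1 : measurableType d1} {T2 : measurableType d2}.
Variables (m1 : {sigma_finite_measure set T1 -> \bar R}).
Variables (m2 : {sigma_finite_measure set T2 -> \bar R}).

Lemma integrable_prod (g : T1 -> R) (h : T2 -> R) :
  (forall x, 0 <= g x) -> (forall y, 0 <= h y) ->
  m1.-integrable setT (EFin \o g) -> m2.-integrable setT (EFin \o h) ->
  (m1 \x m2)%E.-integrable setT (EFin \o (fun z => g z.1 * h z.2)).
Proof.
move=> g0 h0 ig ih.
have mg := (measurable_EFinP _ _).1 (measurable_int _ ig).
have mh := (measurable_EFinP _ _).1 (measurable_int _ ih).
have mgh : measurable_fun setT (fun z : T1 * T2 => g z.1 * h z.2).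
  by apply: measurable_funM; apply: measurableT_comp.
apply/integrableP; split; first exact/measurable_EFinP.
rewrite fubini_tonelli1//=; last first.
  by apply/measurable_EFinP; exact: measurableT_comp mgh.
rewrite /fubini_F /=.
under eq_integral => x _.
  under eq_integral => y _ do rewrite ger0_norm ?mulr_ge0// EFinM.
  rewrite ge0_integralZl//; last 3 first.
  - exact/measurable_EFinP.
  - by move=> y _; rewrite lee_fin.
  - by rewrite lee_fin.
  over.
rewrite ge0_integralZr//; last 3 first.
- exact/measurable_EFinP.
- by move=> y _; rewrite lee_fin.
- by apply: integral_ge0 => y _; rewrite lee_fin.
apply: lte_mul_pinfty.
- by apply: integral_ge0 => y _; rewrite lee_fin.
- exact: integrable_fin_num ig.
- by rewrite ltey_eq (integrable_fin_num measurableT ih).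
Qed.

(** A bound in product form gives integrability on the product space and of every section at once;
    Fubini then applies to real and imaginary parts. *)
Lemma cintegral_swap (f : T1 -> T2 -> R[i]) (g : T1 -> R) (h : T2 -> R) :
  cmeasurable (fun z : T1 * T2 => f z.1 z.2) ->
  (forall x y, modulus (f x y) <= g x * h y) ->
  (forall x, 0 <= g x) -> (forall y, 0 <= h y) ->
  m1.-integrable setT (EFin \o g) -> m2.-integrable setT (EFin \o h) ->
  cintegral m1 setT (fun x => cintegral m2 setT (fun y => f x y)) =
  cintegral m2 setT (fun y => cintegral m1 setT (fun x => f x y)).
Proof.
move=> mf fgh g0 h0 ig ih.
have [i1 i2] := cintegrable_le mf (integrable_prod g0 h0 ig ih) (fun z => fgh z.1 z.2).
have fin1 x : cintegrable m2 (f x).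
  apply: (cintegrable_le (g := fun y => g x * h y)) => //.
    by case: mf => mf1 mf2; split; [apply: (measurableT_comp mf1 (pair1_measurable x))|apply: (measurableT_comp mf2 (pair1_measurable x))].
  exact: integrable_scale.
have fin2 y : cintegrable m1 (f^~ y).
  apply: (cintegrable_le (g := fun x => h y * g x)) => //.
    by case: mf => mf1 mf2; split; [apply: (measurableT_comp mf1 (pair2_measurable y))|apply: (measurableT_comp mf2 (pair2_measurable y))].
  exact: integrable_scale.
  by move=> x; rewrite mulrC.
have H (p : T1 -> T2 -> R) : (m1 \x m2)%E.-integrable setT (EFin \o (fun z => p z.1 z.2)) ->
    (forall x, m2.-integrable setT (EFin \o (p x))) ->
    (forall y, m1.-integrable setT (EFin \o (p^~ y))) ->
    Rintegral m1 setT (fun x => Rintegral m2 setT (p x)) =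
    Rintegral m2 setT (fun y => Rintegral m1 setT (p^~ y)).
  move=> ip px py; have := Fubini ip; rewrite /Rintegral.
  have -> : (fun x => (fine (\int[m2]_y (p x y)%:E)%E)%:E) = (fun x => \int[m2]_y (p x y)%:E)%E.
    by apply/funext => x; rewrite fineK//; exact: integrable_fin_num (px x).
  have -> : (fun y => (fine (\int[m1]_x (p x y)%:E)%E)%:E) = (fun y => \int[m1]_x (p x y)%:E)%E.
    by apply/funext => y; rewrite fineK//; exact: integrable_fin_num (py y).
  by move=> ->.
rewrite /cintegral; congr (_ +i* _).
  by apply: H => // [x|y]; [case: (fin1 x)|case: (fin2 y)].
by apply: H => // [x|y]; [case: (fin1 x)|case: (fin2 y)].
Qed.

End ComplexFubini.

(** * Derivatives of complex-valued functions *)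

Section ComplexDerivative.
Context {R : realType}.
Implicit Types (f g : R -> R[i]) (l m : R[i]).

(** A quadratic bound on the Taylor remainder survives integration against a dominating function.
    This criterion is therefore the means of differentiating under the integral sign, and also of
    finding the derivative at a point where a function is flat. *)
Lemma is_derive_quadratic (f : R -> R) (u g C : R) :
  (forall h, `|h| <= 1 -> `|f (u + h) - f u - h * g| <= C * h ^+ 2) -> is_derive u 1 f g.
Proof.
move=> H.
have C0 : 0 <= C.
  have := H 1; rewrite normr1 lexx expr1n mulr1 => /(_ isT); exact: le_trans.
have cv : h^-1 *: ((f \o shift u) (h *: 1) - f u) @[h --> 0^'] --> g.
  apply/cvgrPdist_le => /= e e0; near=> h.
  have h0 : h != 0 by near: h; exact: nbhs_dnbhs_neq.
  rewrite [h *: 1]mulr1 [h + u]addrC [_ *: _]/(_ * _).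
  have -> : g - h^-1 * (f (u + h) - f u) = - h^-1 * (f (u + h) - f u - h * g) by field.
  rewrite normrM normrN normfV mulrC ler_pdivrMr ?normr_gt0//.
  apply: le_trans (H _ _) _.
    near: h; apply: dnbhs0_le; exact: ltr01.
  rewrite -real_normK ?num_real// expr2 mulrA ler_wpM2r//.
  (* [C + 1] in place of [C] keeps the quotient meaningful when [C] is 0. *)
  apply: (@le_trans _ _ (C * (e / (C + 1)))).
    rewrite ler_wpM2l//; near: h; apply: dnbhs0_le; apply: divr_gt0 => //.
    by rewrite ltr_wpDl.
  rewrite mulrCA ger_pMr// ler_pdivrMr ?mul1r ?lerDl// ltr_wpDl//.
by apply: DeriveDef; [apply/cvg_ex; exists g | apply: cvg_lim].
Unshelve. all: by end_near. Qed.

Definition is_cderive f (x : R) l :=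
  is_derive x 1 (rpart f) (complex.Re l) /\ is_derive x 1 (ipart f) (complex.Im l).

Lemma is_cderive_quadratic f (u C : R) l :
  (forall h, `|h| <= 1 -> modulus (f (u + h) - f u - h%:C * l) <= C * h ^+ 2) ->
  is_cderive f u l.
Proof.
move=> H; split; apply: (@is_derive_quadratic _ _ _ C) => h h1.
  apply: le_trans (H h h1); apply: le_trans (le_Re_modulus _).
  by rewrite /rpart; case: (f _) (f _) l {H} => ? ? [? ?] [? ?] /=; rewrite mul0r subr0.
apply: le_trans (H h h1); apply: le_trans (le_Im_modulus _).
by rewrite /ipart; case: (f _) (f _) l {H} => ? ? [? ?] [? ?] /=; rewrite mul0r addr0.
Qed.

Lemma is_derive_eq1 (f : R -> R) (x a b : R) : is_derive x 1 f a -> a = b -> is_derive x 1 f b.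
Proof. by move=> ? <-. Qed.

Lemma is_cderive_eq f x l m : is_cderive f x l -> l = m -> is_cderive f x m.
Proof. by move=> ? <-. Qed.

Lemma is_cderive_cst l x : is_cderive (fun=> l) x 0.
Proof. by split; exact: is_derive_cst. Qed.

Lemma is_cderiveD f g x l m : is_cderive f x l -> is_cderive g x m ->
  is_cderive (fun x => f x + g x) x (l + m).
Proof.
move=> [f1 f2] [g1 g2]; split.
  rewrite (_ : rpart _ = rpart f + rpart g); last first.
    by apply/funext => y; rewrite /rpart !fctE; case: (f y) (g y) => [? ?] [? ?].
  by apply: is_derive_eq1 (is_deriveD f1 g1) _; case: l m {f1 f2 g1 g2} => [? ?] [? ?].
rewrite (_ : ipart _ = ipart f + ipart g); last first.
  by apply/funext => y; rewrite /ipart !fctE; case: (f y) (g y) => [? ?] [? ?].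
by apply: is_derive_eq1 (is_deriveD f2 g2) _; case: l m {f1 f2 g1 g2} => [? ?] [? ?].
Qed.

Lemma is_cderiveM f g x l m : is_cderive f x l -> is_cderive g x m ->
  is_cderive (fun x => f x * g x) x (l * g x + f x * m).
Proof.
move=> [f1 f2] [g1 g2]; split.
  rewrite (_ : rpart _ = rpart f * rpart g - ipart f * ipart g); last first.
    by apply/funext => y; rewrite /rpart /ipart !fctE; case: (f y) (g y) => [? ?] [? ?].
  apply: is_derive_eq1 (is_deriveB (is_deriveM f1 g1) (is_deriveM f2 g2)) _; rewrite /rpart /ipart.
  by case: l m (f x) (g x) {f1 f2 g1 g2} => [? ?] [? ?] [? ?] [? ?] /=; rewrite /GRing.scale /=; ring.
rewrite (_ : ipart _ = rpart f * ipart g + ipart f * rpart g); last first.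
  by apply/funext => y; rewrite /rpart /ipart !fctE; case: (f y) (g y) => [? ?] [? ?].
apply: is_derive_eq1 (is_deriveD (is_deriveM f1 g2) (is_deriveM f2 g1)) _; rewrite /rpart /ipart.
by case: l m (f x) (g x) {f1 f2 g1 g2} => [? ?] [? ?] [? ?] [? ?] /=; rewrite /GRing.scale /=; ring.
Qed.

Lemma is_cderiveZ c f x l : is_cderive f x l -> is_cderive (fun x => c * f x) x (c * l).
Proof.
move=> df; apply: is_cderive_eq (is_cderiveM (is_cderive_cst c x) df) _.
by rewrite mul0r add0r.
Qed.

Lemma is_cderiveR (f : R -> R) (x a : R) : is_derive x 1 f a -> is_cderive (fun x => (f x)%:C) x a%:C.
Proof. by move=> df; split => //; exact: is_derive_cst. Qed.

Lemma is_cderive_expi (f : R -> R) (x a : R) : is_derive x 1 f a ->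
  is_cderive (fun x => expi (f x)) x (0 +i* a * expi (f x)).
Proof.
move=> df; split.
  apply: is_derive_eq1 (is_derive1_comp (is_derive_cos (f x)) df) _ => /=; ring.
apply: is_derive_eq1 (is_derive1_comp (is_derive_sin (f x)) df) _ => /=; ring.
Qed.

Lemma is_derive_mulr (a x : R) : is_derive x 1 (fun x => a * x) a.
Proof.
apply: is_derive_eq1 (is_deriveM (is_derive_cst a x 1) (is_derive_id x 1)) _.
by rewrite /GRing.scale /= mulr1 mulr0 addr0.
Qed.

Lemma is_cderive_cexp z (t : R) :
  is_cderive (fun t => cexp (t%:C * z)) t (z * cexp (t%:C * z)).
Proof.
case: z => a b.
have E (s : R) : cexp (s%:C * (a +i* b)) = (expR (a * s))%:C * expi (b * s).
  by rewrite /cexp /=; congr ((expR _)%:C * expi _); ring.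
rewrite (_ : (fun t => _) = (fun s => (expR (a * s))%:C * expi (b * s))); last exact/funext.
rewrite E.
have d1 := is_cderiveR (is_derive1_comp (is_derive_expR (a * t)) (is_derive_mulr a t)).
have d2 := is_cderive_expi (is_derive_mulr b t).
apply: is_cderive_eq (is_cderiveM d1 d2) _.
by apply/eqP; rewrite eq_complex /=; apply/andP; split; apply/eqP; ring.
Qed.

Lemma is_cderive_ext f g x l : f =1 g -> is_cderive f x l -> is_cderive g x l.
Proof. by move=> /funext ->. Qed.

Lemma is_cderive_affine f (a b x : R) l : is_cderive f (a + b * x) l ->
  is_cderive (fun x => f (a + b * x)) x (b%:C * l).
Proof.
have d : is_derive x 1 (fun x => a + b * x) b.
  apply: is_derive_eq1 (is_deriveD (is_derive_cst a x 1) (is_derive_mulr b x)) _.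
  by rewrite add0r.
move=> [f1 f2]; split.
  change (is_derive x 1 (rpart f \o (fun x : R => a + b * x)) (complex.Re (b%:C * l))).
  by apply: (is_derive_eq1 (@is_derive1_comp R (rpart f) (fun x => a + b * x) x _ _ f1 d)); case: l {f1 f2} => ? ? /=; ring.
change (is_derive x 1 (ipart f \o (fun x : R => a + b * x)) (complex.Im (b%:C * l))).
by apply: (is_derive_eq1 (@is_derive1_comp R (ipart f) (fun x => a + b * x) x _ _ f2 d)); case: l {f1 f2} => ? ? /=; ring.
Qed.

Lemma is_derive_continuous (f : R -> R) (x a : R) : is_derive x 1 f a -> {for x, continuous f}.
Proof.
by move=> df; apply: differentiable_continuous; apply/derivable1_diffP; exact: (@ex_derive _ _ _ _ _ _ _ df).
Qed.

Lemma MVT_le (f df : R -> R) (a b M : R) : a <= b ->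
  (forall x, a <= x <= b -> is_derive x 1 f (df x)) ->
  (forall x, a <= x <= b -> `|df x| <= M) -> `|f b - f a| <= M * (b - a).
Proof.
move=> ab d dM.
have [||c cab ->] := @MVT_segment R f df a b ab.
- by move=> x /itvP xab; apply: d; rewrite !xab.
- apply: derivable_within_continuous => x; rewrite in_itv /= => xab.
  exact: (@ex_derive _ _ _ _ _ _ _ (d x xab)).
- rewrite normrM [`|b - a|]ger0_norm ?subr_ge0// ler_wpM2r ?subr_ge0//.
  by apply: dM; rewrite in_itv in cab.
Qed.

(** A complex-valued function has no mean value equality; the real one is applied to both parts,
    hence the factor 2. *)
Lemma cMVT f (df : R -> R[i]) (a b M : R) : a <= b ->
  (forall x, a <= x <= b -> is_cderive f x (df x)) ->
  (forall x, a <= x <= b -> modulus (df x) <= M) -> modulus (f b - f a) <= 2 * M * (b - a).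
Proof.
move=> ab d dM.
have h1 : `|rpart f b - rpart f a| <= M * (b - a).
  apply: (MVT_le ab (df := rpart df)) => x xab; first by case: (d x xab).
  exact: le_trans (le_Re_modulus _) (dM _ xab).
have h2 : `|ipart f b - ipart f a| <= M * (b - a).
  apply: (MVT_le ab (df := ipart df)) => x xab; first by case: (d x xab).
  exact: le_trans (le_Im_modulus _) (dM _ xab).
apply: le_trans (modulus_le_ReIm _) _; rewrite -mulrA mulrC mulr_natr mulr2n.
apply: le_trans (lerD h1 h2).
by rewrite /rpart /ipart; case: (f a) (f b) => [? ?] [? ?].
Qed.

Lemma is_cderive0_cst f (x y : R) : (forall x, is_cderive f x 0) -> f x = f y.
Proof.
move=> d; wlog xy : x y / x <= y.
  by move=> H; case: (leP x y) => [/H//|/ltW/H].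
have := @cMVT f (fun=> 0) x y 0 xy (fun x _ => d x); rewrite modulus0.
move=> /(_ (fun _ _ => lexx 0)); rewrite mulr0 mul0r => H.
apply/esym/eqP; rewrite -subr_eq0; apply/eqP/modulus0_eq0.
by apply/eqP; rewrite eq_le H modulus_ge0.
Qed.

Lemma modulus_cexp_le1 (z : R[i]) : complex.Re z <= 0 -> modulus (cexp z) <= 1.
Proof. by move=> z0; rewrite modulus_cexp -expR0 ler_expR. Qed.

Lemma Re_scale (t : R) (z : R[i]) : complex.Re (t%:C * z) = t * complex.Re z.
Proof. by case: z => a b /=; rewrite mul0r subr0. Qed.

(** Mean value inequality on the segment from 0 to [z], which stays in the left half plane where the
    exponential has modulus at most 1. Repeating it on the remainder gives the next bound; the
    constants 2 and 4 are the factors of [cMVT]. *)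
Lemma modulus_cexpB1 (z : R[i]) : complex.Re z <= 0 -> modulus (cexp z - 1) <= 2 * modulus z.
Proof.
move=> z0; have := @cMVT _ _ 0 1 (modulus z) ler01 (fun t _ => is_cderive_cexp z t).
rewrite mul0r mul1r cexp0 subr0 mulr1; apply => t /andP[t0 t1].
rewrite modulusM -[leRHS]mulr1 ler_wpM2l ?modulus_ge0// modulus_cexp_le1//.
by rewrite Re_scale mulr_ge0_le0.
Qed.

Lemma modulus_cexpB1B (z : R[i]) : complex.Re z <= 0 -> modulus (cexp z - 1 - z) <= 4 * modulus z ^+ 2.
Proof.
move=> z0.
have d t : is_cderive (fun t => cexp (t%:C * z) - t%:C * z) t (z * (cexp (t%:C * z) - 1)).
  have dt := is_cderiveR (is_derive_id t 1).
  apply: (@is_cderive_ext (fun t => cexp (t%:C * z) + -1 * (t%:C * z))).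
    by move=> s; rewrite mulN1r.
  apply: is_cderive_eq (is_cderiveD (is_cderive_cexp z t)
    (is_cderiveZ (-1) (is_cderiveM dt (is_cderive_cst z t)))) _.
  by rewrite /=; ring.
have := @cMVT _ _ 0 1 (2 * modulus z ^+ 2) ler01 (fun t _ => d t).
rewrite mul0r mul1r cexp0 subr0 subr0 mulr1 mulrA -natrM -addrA [- z - 1]addrC addrA; apply => t /andP[t0 t1].
rewrite modulusM expr2 mulrCA ler_wpM2l ?modulus_ge0//.
apply: le_trans (modulus_cexpB1 _) _; first by rewrite Re_scale mulr_ge0_le0.
by rewrite ler_wpM2l// modulusM modulusR ger0_norm// ler_piMl ?modulus_ge0.
Qed.

End ComplexDerivative.

(** * Schwartz functions *)

Section Schwartz.
Context {R : realType}.
Implicit Types f g : R -> R[i].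

Definition rapidly_decreasing f :=
  forall m, exists M : R, forall x, `|x| ^+ m * modulus (f x) <= M.

Lemma modulusXM (m : nat) (x : R) (z : R[i]) :
  modulus ((x ^+ m)%:C * z) = `|x| ^+ m * modulus z.
Proof. by rewrite modulusM modulusR normrX. Qed.

Lemma rpart_cderiv n f : rpart (cderiv n f) = derive1n n (rpart f). Proof. by []. Qed.
Lemma ipart_cderiv n f : ipart (cderiv n f) = derive1n n (ipart f). Proof. by []. Qed.

Lemma cderiv0 f : cderiv 0 f = f.
Proof. by apply/funext => x; rewrite /cderiv /rpart /ipart /=; case: (f x). Qed.

Lemma cderivS n f : cderiv n (cderiv 1 f) = cderiv n.+1 f.
Proof.
by apply/funext => x; rewrite /cderiv -/(cderiv 1 f) rpart_cderiv ipart_cderiv !derive1Sn.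
Qed.

Lemma schwartz_cderiv f : schwartz f -> schwartz (cderiv 1 f).
Proof.
move=> [sf bf]; split.
  by move=> n x; rewrite rpart_cderiv ipart_cderiv -!derive1Sn; exact: (sf n.+1).
by move=> m n; rewrite cderivS; exact: bf.
Qed.

Lemma schwartz_is_cderive f x : schwartz f -> is_cderive f x (cderiv 1 f x).
Proof.
move=> [sf _]; have [d1 d2] := sf 0 x; rewrite /cderiv /= !derive1E.
by split; [exact: derivableP d1 | exact: derivableP d2].
Qed.

Lemma schwartz_rapid f : schwartz f -> rapidly_decreasing f.
Proof.
move=> [_ bf] m; have [M HM] := bf m 0%N; exists M => x.
by rewrite -modulusXM -[f x]/(f x) -{1}(cderiv0 f).
Qed.

Lemma is_derive_derive1 (f g : R -> R) : (forall x : R, is_derive x 1 f (g x)) -> f^`()%classic = g.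
Proof.
by move=> d; apply/funext => x; rewrite derive1E; exact: (@derive_val _ _ _ _ _ _ _ (d x)).
Qed.

(** In a class closed under derivation every iterated derivative has a representative, without a
    formula for the [n]-th one. *)
Lemma iter_coind (A : set (R -> R[i])) :
  (forall f, A f -> exists2 g, A g & forall x, is_cderive f x (g x)) ->
  forall n f, A f -> exists g, [/\ A g, derive1n n (rpart f) = rpart g & derive1n n (ipart f) = ipart g].
Proof.
move=> H; elim=> [|n IHn] f Af; first by exists f.
have [g [Ag e1 e2]] := IHn f Af; have [h Ah gh] := H g Ag.
exists h; split => //; rewrite derive1nS (e1, e2); apply: is_derive_derive1 => x.
  by case: (gh x).
by case: (gh x).
Qed.

(* The Schwartz space as a greatest fixed point. *)
Lemma schwartz_coind (A : set (R -> R[i])) :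
  (forall f, A f -> rapidly_decreasing f) ->
  (forall f, A f -> exists2 g, A g & forall x, is_cderive f x (g x)) ->
  A `<=` schwartz.
Proof.
move=> Ar Ad f Af; split.
  move=> n x; have [g [Ag -> ->]] := iter_coind Ad n Af.
  have [h _ /(_ x)[d1 d2]] := Ad g Ag.
  by split; [exact: (@ex_derive _ _ _ _ _ _ _ d1) | exact: (@ex_derive _ _ _ _ _ _ _ d2)].
move=> m n; have [g [Ag e1 e2]] := iter_coind Ad n Af.
have [M HM] := Ar g Ag m; exists M => x.
by rewrite /cderiv e1 e2 modulusXM; apply: le_trans (HM x); rewrite /rpart /ipart; case: (g x).
Qed.

Lemma lizorkin_dual_coind (A : set (R -> R[i])) :
  (forall f, A f -> f 0 = 0) ->
  (forall f, A f -> rapidly_decreasing f) ->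
  (forall f, A f -> exists2 g, A g & forall x, is_cderive f x (g x)) ->
  A `<=` lizorkin_dual.
Proof.
move=> A0 Ar Ad f Af; split; first exact: (schwartz_coind Ar Ad).
move=> n; have [g [Ag e1 e2]] := iter_coind Ad n Af.
by rewrite /cderiv e1 e2 -[RHS](A0 g Ag) /rpart /ipart; case: (g 0).
Qed.

Lemma rapidD f g : rapidly_decreasing f -> rapidly_decreasing g ->
  rapidly_decreasing (fun x => f x + g x).
Proof.
move=> rf rg m; have [M HM] := rf m; have [N HN] := rg m; exists (M + N) => x.
by apply: le_trans (lerD (HM x) (HN x)); rewrite -mulrDr ler_wpM2l ?exprn_ge0// modulusD.
Qed.

Lemma rapidX f : rapidly_decreasing f -> rapidly_decreasing (fun x => x%:C * f x).
Proof.
move=> rf m; have [M HM] := rf m.+1; exists M => x.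
by rewrite modulusM modulusR mulrA -exprSr.
Qed.

Lemma rapid_le f (g : R -> R[i]) : (forall x, modulus (g x) <= modulus (f x)) ->
  rapidly_decreasing f -> rapidly_decreasing g.
Proof.
move=> gf rf m; have [M HM] := rf m; exists M => x; apply: le_trans (HM x).
by rewrite ler_wpM2l ?exprn_ge0.
Qed.

Lemma rapidZ (c : R[i]) f : rapidly_decreasing f -> rapidly_decreasing (fun x => c * f x).
Proof.
move=> rf m; have [M HM] := rf m; exists (modulus c * M) => x.
by rewrite modulusM mulrCA ler_wpM2l ?modulus_ge0.
Qed.

(** Prepares affine substitutions: [|b x|] is at most [|a| + |a + b x|]. *)
Lemma rapid_shift f (c : R) m : 0 <= c -> rapidly_decreasing f ->
  exists M : R, forall x, (c + `|x|) ^+ m * modulus (f x) <= M.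
Proof.
move=> c0; elim: m f => [|m IHm] f rf; first exact: rf 0%N.
have [M HM] := IHm f rf; have [N HN] := IHm _ (rapidX rf); exists (c * M + N) => x.
have {HN} := HN x; rewrite modulusM modulusR => HN.
rewrite exprSr -mulrA mulrDl mulrDr.
by apply: lerD => //; rewrite mulrCA ler_wpM2l.
Qed.

Lemma rapid_affine f (a b : R) : b != 0 -> rapidly_decreasing f ->
  rapidly_decreasing (fun x => f (a + b * x)).
Proof.
move=> b0 rf m; have [M HM] := rapid_shift m (normr_ge0 a) rf.
exists ((`|b| ^- 1) ^+ m * M) => x; apply: le_trans (ler_wpM2l _ (HM (a + b * x))); last first.
  by rewrite exprn_ge0// expr1 invr_ge0.
rewrite mulrA ler_wpM2r ?modulus_ge0// -exprMn lerXn2r ?nnegrE//.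
rewrite expr1 mulrC ler_pdivlMr ?normr_gt0// mulrC -normrM.
by have := ler_normB (a + b * x) a; rewrite addrAC subrr add0r addrC.
Qed.

Lemma schwartzD f g : schwartz f -> schwartz g -> schwartz (fun x => f x + g x).
Proof.
move=> sf sg; apply: (@schwartz_coind [set h | exists f g, [/\ schwartz f, schwartz g & h = fun x => f x + g x]]); last by exists f, g.
  by move=> _ [u [v [su sv ->]]]; apply: rapidD; exact: schwartz_rapid.
move=> _ [u [v [su sv ->]]]; exists (fun x => cderiv 1 u x + cderiv 1 v x).
  by exists (cderiv 1 u), (cderiv 1 v); split => //; exact: schwartz_cderiv.
by move=> x; apply: is_cderiveD; exact: schwartz_is_cderive.
Qed.

Lemma schwartzZ (c : R[i]) f : schwartz f -> schwartz (fun x => c * f x).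
Proof.
move=> sf; apply: (@schwartz_coind [set h | exists2 f, schwartz f & h = fun x => c * f x]); last by exists f.
  by move=> _ [u su ->]; apply: rapidZ; exact: schwartz_rapid.
move=> _ [u su ->]; exists (fun x => c * cderiv 1 u x).
  by exists (cderiv 1 u) => //; exact: schwartz_cderiv.
by move=> x; apply: is_cderiveZ; exact: schwartz_is_cderive.
Qed.

Lemma schwartzX f : schwartz f -> schwartz (fun x => x%:C * f x).
Proof.
(* The derivative of [x f] is [x f' + f], so the invariant class has to contain the sums
   [x f + g]. *)
move=> sf; apply: (@schwartz_coind [set h | exists f g, [/\ schwartz f, schwartz g & h = fun x => x%:C * f x + g x]]); last first.
- exists f, (fun x => 0 * f x); split => //; first exact: schwartzZ.
  by apply/funext => x; rewrite mul0r addr0.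
move=> _ [u [v [su sv ->]]]; exists (fun x => x%:C * cderiv 1 u x + (u x + cderiv 1 v x)).
  exists (cderiv 1 u), (fun x => u x + cderiv 1 v x); split => //; first exact: schwartz_cderiv.
  by apply: schwartzD => //; exact: schwartz_cderiv.
move=> x; have dx := is_cderiveR (is_derive_id x 1).
apply: is_cderive_eq (is_cderiveD (is_cderiveM dx (schwartz_is_cderive x su)) (schwartz_is_cderive x sv)) _.
by rewrite mul1r /= addrCA addrA.
by move=> _ [u [v [su sv ->]]]; apply: rapidD; [apply: rapidX|]; exact: schwartz_rapid.
Qed.

Lemma schwartz_affine f (a b : R) : b != 0 -> schwartz f -> schwartz (fun x => f (a + b * x)).
Proof.
move=> b0 sf; apply: (@schwartz_coind [set h | exists2 f, schwartz f & h = fun x => f (a + b * x)]); last by exists f.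
  by move=> _ [u su ->]; apply: rapid_affine => //; exact: schwartz_rapid.
move=> _ [u su ->]; exists (fun x => b%:C * cderiv 1 u (a + b * x)).
  by exists (fun x => b%:C * cderiv 1 u x) => //; apply: schwartzZ; exact: schwartz_cderiv.
by move=> x; apply: is_cderive_affine; exact: schwartz_is_cderive.
Qed.

Lemma schwartz_continuous f : schwartz f -> continuous (rpart f) /\ continuous (ipart f).
Proof.
by move=> sf; split => x; have [d1 d2] := schwartz_is_cderive x sf; exact: is_derive_continuous.
Qed.

Lemma schwartz_measurable f : schwartz f -> cmeasurable f.
Proof. by move=> /schwartz_continuous[c1 c2]; split; exact: continuous_measurable_fun. Qed.

Lemma integrable_oneDsqrV : lebesgue_measure.-integrable setT (EFin \o (fun x : R => (1 + x ^+ 2)^-1)).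
Proof.
apply/integrableP; split.
  by apply/measurable_EFinP; apply: continuous_measurable_fun; exact: continuous_oneDsqrV.
have p0 (x : R) : 0 <= (1 + x ^+ 2)^-1 by rewrite invr_ge0 addr_ge0 ?sqr_ge0.
under eq_integral => x _ do rewrite /= ger0_norm//.
rewrite (@ge0_symfun_integralT R (fun x => (1 + x ^+ 2)^-1))//.
- by rewrite -set_itvcy integral0y_oneDsqr -EFinM ltry.
- exact: continuous_oneDsqrV.
- by move=> x /=; rewrite sqrrN.
Qed.

Lemma rapid_oneDsqrV f : rapidly_decreasing f -> exists2 M : R, 0 <= M &
  forall x, modulus (f x) <= M * (1 + x ^+ 2)^-1.
Proof.
move=> rf; have [M HM] := rf 0%N; have [N HN] := rf 2%N; exists (M + N).
  rewrite addr_ge0//; first by apply: le_trans (HM 0); rewrite mulr_ge0 ?exprn_ge0 ?modulus_ge0.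
  by apply: le_trans (HN 0); rewrite mulr_ge0 ?exprn_ge0 ?modulus_ge0.
move=> x; rewrite ler_pdivlMr ?ltr_wpDr ?sqr_ge0// mulrDr mulr1 lerD//.
  by have := HM x; rewrite expr0 mul1r.
by have := HN x; rewrite real_normK ?num_real// mulrC.
Qed.

Lemma rapid_integrable f : cmeasurable f -> rapidly_decreasing f -> cintegrable lebesgue_measure f.
Proof.
move=> mf /rapid_oneDsqrV[M M0 HM].
exact: (@cintegrable_le _ _ _ lebesgue_measure f (fun x => M * (1 + x ^+ 2)^-1) mf (integrable_scale M integrable_oneDsqrV) HM).
Qed.

Lemma schwartz_integrable f : schwartz f -> cintegrable lebesgue_measure f.
Proof.
by move=> sf; apply: rapid_integrable; [exact: schwartz_measurable|exact: schwartz_rapid].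
Qed.

Lemma schwartz_vanishing f : schwartz f -> vanishing_at_infinity f.
Proof.
move=> sf; have [c1 c2] := schwartz_continuous sf; split => //.
  have [M HM] := schwartz_rapid sf 1.
  apply: (@squeeze_cvgr _ _ _ _ (cst 0) (fun x => M * x^-1)).
  - near=> x; rewrite modulus_ge0/=.
    have x0 : 0 < x by near: x; exact: nbhs_pinfty_gt.
    by rewrite ler_pdivlMr// mulrC; have := HM x; rewrite expr1 gtr0_norm.
  - exact: cvg_cst.
  - rewrite -(mulr0 M); apply: cvgM; first exact: cvg_cst.
    by apply/(gtr0_cvgV0 (f := id)); [exact: nbhs_pinfty_gt | exact: cvg_id].
have [M HM] := schwartz_rapid sf 1.
apply: (@squeeze_cvgr _ _ _ _ (cst 0) (fun x => M * - x^-1)).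
- near=> x; rewrite modulus_ge0/=.
  have x0 : x < 0 by near: x; exact: nbhs_ninfty_lt.
  by rewrite -invrN ler_pdivlMr ?oppr_gt0// mulrC; have := HM x; rewrite expr1 ltr0_norm.
- exact: cvg_cst.
- rewrite -(mulr0 M) -oppr0; apply: cvgM; first exact: cvg_cst.
  by apply: cvgN; apply/(ltr0_cvgV0 (f := id)); [exact: nbhs_ninfty_lt | exact: cvg_id].
Unshelve. all: by end_near. Qed.

End Schwartz.

(** * Integrals over the half line *)

Section HalfLine.
Context {R : realType}.
Notation leb := (@lebesgue_measure R).

(** As a factor it turns half-line integrals into integrals over the whole line, where the
    substitution and Fubini lemmas apply. The value at 0 is 0. *)
Definition heaviside (x : R) : R := if 0 < x then 1 else 0.

Lemma measurable_heaviside : measurable_fun setT heaviside.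
Proof.
rewrite (_ : heaviside = \1_(`]0, +oo[%classic : set R)).
  exact: measurable_indic.
apply/funext => x; rewrite /heaviside indicE.
by rewrite mem_setE in_itv /= andbT; case: ifP.
Qed.

Lemma heaviside_ge0 x : 0 <= heaviside x. Proof. by rewrite /heaviside; case: ifP. Qed.
Lemma heaviside_le1 x : heaviside x <= 1. Proof. by rewrite /heaviside; case: ifP. Qed.

(** Fundamental theorem of calculus on [[0, n]], then dominated convergence in [n]; hence [F] enters
    only through its limit along the integers. *)
Lemma Rintegral_half_line (F G : R -> R) (l : R) :
  (forall x : R, is_derive x 1 F (G x)) -> continuous G ->
  leb.-integrable setT (EFin \o (fun x => heaviside x * G x)) ->
  (fun n : nat => F n%:R) @ \oo --> l ->
  Rintegral leb setT (fun x => heaviside x * G x) = l - F 0.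
Proof.
move=> dF cG iG Fl.
have mG : measurable_fun setT G by exact: continuous_measurable_fun.
pose A n : set R := `]0, n%:R]%classic.
have mA n : measurable (A n) by exact: measurable_itv.
have AE n x : (x \in A n) = (0 < x <= n%:R).
  by rewrite /A mem_setE in_itv.
have mA' n : measurable_fun setT (fun x => \1_(A n) x * G x).
  by apply: measurable_funM => //; exact: measurable_indic.
have mH : measurable_fun setT (fun x => heaviside x * G x).
  by apply: measurable_funM => //; exact: measurable_heaviside.
have cv : ccvg (fun n => cintegral leb setT (fun x => (\1_(A n) x * G x)%:C))
    (cintegral leb setT (fun x => (heaviside x * G x)%:C)).
  apply: (@cintegral_dominated_convergence _ _ _ leb _ _ (fun x => modulus (heaviside x * G x)%:C)).
  - by move=> n; exact: cmeasurableR (mA' n).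
  - exact: cmeasurableR mH.
  - move=> x; apply: ccvgR; apply: (@cvg_near_cst _ _ (heaviside x * G x)).
    near=> n; rewrite /= indicE AE /heaviside.
    have -> : x <= n%:R by near: n; exact: nbhs_infty_ger.
    by rewrite andbT; case: ifP.
  - apply: integrable_modulus; split => //.
    by apply: eq_integrable (integrable0 _ _) => // x _.
  - move=> n x; rewrite !modulusR !normrM ler_wpM2r// indicE AE /heaviside.
    case: (0 < x) => /=; last by rewrite normr0.
    by case: (x <= _); rewrite ?normr1 ?normr0.
have e n : cintegral leb setT (fun x => (\1_(A n) x * G x)%:C) = (F n%:R - F 0)%:C.
  rewrite cintegralR /Rintegral; congr (_%:C).
  rewrite (_ : \int[leb]_x _ = (F n%:R - F 0)%:E)%E//.
  transitivity (\int[leb]_(x in A n) (G x)%:E)%E.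
    rewrite [RHS]integral_mkcond; apply: eq_integral => x _.
    by rewrite /= indicE patchE; case: ifP => _; rewrite ?mul1r ?mul0r.
  have [->|n0] := eqVneq n 0%N.
    by rewrite subrr /A set_itv_ge ?integral_set0// bnd_simp ltxx.
  rewrite integral_itv_obnd_cbnd; last exact/measurable_EFinP/measurable_funTS.
  rewrite (@continuous_FTC2 _ G F 0 n%:R)//.
  - by rewrite ltr0n lt0n.
  - exact: continuous_subspaceT.
  - split.
    + by move=> x _; exact: (@ex_derive _ _ _ _ _ _ _ (dF x)).
    + by apply: cvg_at_right_filter; exact: is_derive_continuous (dF 0).
    + by apply: cvg_at_left_filter; exact: is_derive_continuous (dF n%:R).
  - by move=> x _; rewrite derive1E; exact: (@derive_val _ _ _ _ _ _ _ (dF x)).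
rewrite (eq_fun e) in cv.
have cv2 : ccvg (fun n : nat => (F n%:R - F 0)%:C) (l - F 0)%:C.
  by apply: ccvgR; apply: cvgB => //; exact: cvg_cst.
have := ccvg_unique cv cv2; rewrite cintegralR => /(congr1 (@complex.Re R)) /= ->.
by [].
Unshelve. all: by end_near. Qed.

Lemma cintegral_half_line (F G : R -> R[i]) (l : R[i]) :
  (forall x : R, is_cderive F x (G x)) ->
  (forall x, exists m, is_cderive G x m) ->
  cintegrable leb (fun x => (heaviside x)%:C * G x) ->
  ccvg (fun n : nat => F n%:R) l ->
  cintegral leb setT (fun x => (heaviside x)%:C * G x) = l - F 0.
Proof.
move=> dF dG [i1 i2] Fl.
have e1 : rpart (fun x => (heaviside x)%:C * G x) = (fun x => heaviside x * rpart G x).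
  by apply/funext => x; rewrite /rpart Re_scale.
have e2 : ipart (fun x => (heaviside x)%:C * G x) = (fun x => heaviside x * ipart G x).
  by apply/funext => x; rewrite /ipart; case: (G x) => a b /=; rewrite mul0r addr0.
have r1 : Rintegral leb setT (fun x => heaviside x * rpart G x) = complex.Re l - rpart F 0.
  apply: Rintegral_half_line.
  - by move=> x; case: (dF x).
  - by move=> x; have [m [d1 _]] := dG x; exact: is_derive_continuous d1.
  - by rewrite -e1.
  - exact: ccvg_Re Fl.
have r2 : Rintegral leb setT (fun x => heaviside x * ipart G x) = complex.Im l - ipart F 0.
  apply: Rintegral_half_line.
  - by move=> x; case: (dF x).
  - by move=> x; have [m [_ d1]] := dG x; exact: is_derive_continuous d1.
  - by rewrite -e2.
  - exact: ccvg_Im Fl.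
by rewrite /cintegral e1 e2 r1 r2 /rpart /ipart; case: l (F 0) {Fl r1 r2} => [? ?] [? ?].
Qed.

Lemma heavisideN x : x != 0 -> heaviside x + heaviside (- x) = 1.
Proof.
rewrite /heaviside oppr_gt0; case: ltgtP => //; by rewrite ?addr0 ?add0r.
Qed.

End HalfLine.

(** * Fourier inversion *)

Section Fourier.
Context {R : realType}.
Notation leb := (@lebesgue_measure R).
Implicit Types f g : R -> R[i].

Lemma cintegrable_expi {d} {T : measurableType d} (mu : {measure set T -> \bar R})
    (f : T -> R[i]) (g : T -> R) : measurable_fun setT g -> cintegrable mu f ->
  cintegrable mu (fun x => f x * expi (g x)).
Proof.
move=> mg fi; rewrite (_ : (fun _ => _) = (fun x => expi (g x) * f x)); last first.
  by apply/funext => x; rewrite mulrC.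
by apply: (cintegrableMl (M := 1)) => //; [exact: cmeasurable_expi | move=> x; rewrite modulus_expi].
Qed.

Lemma measurable_mulr (u : R) : measurable_fun setT (fun x : R => u * x).
Proof. exact: measurable_funM. Qed.

Lemma measurable_mull (u : R) : measurable_fun setT (fun x : R => x * u).
Proof. exact: measurable_funM. Qed.

Lemma modulus_expiB1B (t : R) : modulus (expi t - 1 - 0 +i* t) <= 4 * t ^+ 2.
Proof.
have := @modulus_cexpB1B R (0 +i* t); rewrite cexp_i => /(_ (lexx 0)).
by rewrite (modulusE (0 +i* t)) /= expr0n /= add0r sqrtr_sqr real_normK ?num_real.
Qed.

(** The second-order remainder of [e^{ihx}] is at most [4 (h x)^2], so the integrable second moment
    of [f] dominates and the quadratic criterion applies. *)
Lemma fourier_is_cderive f u : cintegrable leb f ->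
  cintegrable leb (fun x => x%:C * f x) -> cintegrable leb (fun x => x%:C * (x%:C * f x)) ->
  is_cderive (fourier f) u (fourier (fun x => 'i * (x%:C * f x)) u).
Proof.
move=> i0 i1 i2.
pose B x := 4 * modulus (x%:C * (x%:C * f x)).
have iB : leb.-integrable setT (EFin \o B) by apply: integrable_scale; exact: integrable_modulus.
apply: (@is_cderive_quadratic _ _ _ (2 * Rintegral leb setT B)) => h _.
have i1' : cintegrable leb (fun x => 'i * (x%:C * f x)) by exact: cintegrableZ.
have mu' := measurable_mulr.
rewrite /fourier -cintegralB; [|exact: cintegrable_expi|exact: cintegrable_expi].
rewrite -cintegralZ; last exact: cintegrable_expi.
rewrite -cintegralB; first last.
- by apply: cintegrableZ; exact: cintegrable_expi.
- by apply: cintegrableB; exact: cintegrable_expi.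
set F := fun x : R => _.
have FE x : F x = f x * expi (u * x) * (expi (h * x) - 1 - 0 +i* (h * x)).
  rewrite /F mulrDl expiD (_ : 0 +i* (h * x) = 'i * h%:C * x%:C); first by ring.
  by apply/eqP; rewrite eq_complex /=; apply/andP; split; apply/eqP; ring.
have -> : 2 * Rintegral leb setT B * h ^+ 2 = 2 * Rintegral leb setT (fun x => h ^+ 2 * B x).
  by rewrite RintegralZl// -mulrA [_ * h ^+ 2]mulrC.
apply: modulus_cintegral.
- apply: (@cintegrable_measurable _ _ _ leb).
  apply: cintegrableB; last by apply: cintegrableZ; exact: cintegrable_expi.
  by apply: cintegrableB; exact: cintegrable_expi.
- exact: integrable_scale.
- move=> x; rewrite FE !modulusM modulus_expi mulr1 /B !modulusM !modulusR.
  apply: le_trans (ler_wpM2l (modulus_ge0 _) (modulus_expiB1B _)) _.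
  rewrite exprMn -[x ^+ 2]real_normK ?num_real//.
  by rewrite [leLHS](_ : _ = h ^+ 2 * (4 * (`|x| * (`|x| * modulus (f x)))))//; ring.
Qed.

Lemma modulus_fourier f : cintegrable leb f -> exists M : R, forall u, modulus (fourier f u) <= M.
Proof.
move=> fi; exists (2 * Rintegral leb setT (fun x => modulus (f x))) => u.
apply: modulus_cintegral.
- apply: (@cintegrable_measurable _ _ _ leb); apply: cintegrable_expi => //; exact: measurable_mulr.
- exact: integrable_modulus.
- by move=> x; rewrite modulusM modulus_expi mulr1.
Qed.

Lemma rapid_ccvg f : rapidly_decreasing f -> ccvg (fun n : nat => f n%:R) 0.
Proof.
move=> /(_ 1) [M HM]; apply: (@ccvg_near_le _ _ _ (fun n : nat => M * n%:R^-1)).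
  near=> n; have n0 : 0 < n%:R :> R by rewrite ltr0n; near: n; exact: nbhs_infty_gt.
  rewrite subr0 ler_pdivlMr// mulrC; have := HM n%:R.
  by rewrite expr1 gtr0_norm.
rewrite -(mulr0 M); apply: cvgM; first exact: cvg_cst.
apply/(gtr0_cvgV0 (f := fun n : nat => n%:R : R)); last exact: cvgr_idn.
by near=> n; rewrite ltr0n; near: n; exact: nbhs_infty_gt.
Unshelve. all: by end_near. Qed.

Lemma cintegrable_heaviside f : cintegrable leb f -> cintegrable leb (fun x => (heaviside x)%:C * f x).
Proof.
apply: (cintegrableMl (M := 1)); first exact: cmeasurableR measurable_heaviside.
by move=> x; rewrite modulusR ger0_norm ?heaviside_ge0// heaviside_le1.
Qed.

Lemma ae_eq_cintegral (f g : R -> R[i]) : cintegrable leb f -> cintegrable leb g ->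
  (forall x, x != 0 -> f x = g x) -> cintegral leb setT f = cintegral leb setT g.
Proof.
move=> fi gi fg; have [mf1 mf2] := cintegrable_measurable fi.
have [mg1 mg2] := cintegrable_measurable gi.
have n0 : (leb).-negligible [set 0 : R] by apply/negligibleP => //; exact: lebesgue_measure_set1.
rewrite /cintegral /Rintegral; congr (fine _ +i* fine _).
  apply: ae_eq_integral => //; [exact/measurable_EFinP|exact/measurable_EFinP|].
  apply: negligibleS n0 => x /=; apply: contra_notP => /eqP x0 _.
  by rewrite /rpart fg.
apply: ae_eq_integral => //; [exact/measurable_EFinP|exact/measurable_EFinP|].
apply: negligibleS n0 => x /=; apply: contra_notP => /eqP x0 _.
by rewrite /ipart fg.
Qed.

(** The cut-offs at [x] and [- x] add up to 1 except at the origin, which is negligible. *)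
Lemma cintegral_split f : cintegrable leb f ->
  cintegral leb setT f = cintegral leb setT (fun x => (heaviside x)%:C * f x) +
    cintegral leb setT (fun x => (heaviside x)%:C * f (- x)).
Proof.
move=> fi; have fi' : cintegrable leb (fun x => f (- x)).
  by case: fi => f1 f2; split; [exact: (integrable_opp f1)|exact: (integrable_opp f2)].
have h1 := cintegrable_heaviside fi; have h2 := cintegrable_heaviside fi'.
rewrite [X in _ + X]cintegral_opp; last exact: cintegrable_measurable h2.
have h3 : cintegrable leb (fun x => (heaviside (- x))%:C * f x).
  case: h2 => f1 f2; split.
    by have := integrable_opp f1; apply: eq_integrable => // x _; rewrite /= /rpart opprK.
  by have := integrable_opp f2; apply: eq_integrable => // x _; rewrite /= /ipart opprK.
under [X in _ + X]eq_cintegral do rewrite opprK.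
rewrite -cintegralD//; apply: ae_eq_cintegral => //; first exact: cintegrableD.
by move=> x x0; rewrite -mulrDl -rmorphD heavisideN// mul1r.
Qed.

(** Takes the place of integration by parts on the line: the boundary terms at 0 of the two half
    lines cancel and those at infinity vanish. *)
Lemma cintegral_derive0 (F G : R -> R[i]) :
  (forall x : R, is_cderive F x (G x)) -> (forall x, exists m, is_cderive G x m) ->
  cintegrable leb G -> rapidly_decreasing F -> cintegral leb setT G = 0.
Proof.
move=> dF dG iG rF; rewrite cintegral_split//.
rewrite (cintegral_half_line dF dG (cintegrable_heaviside iG) (rapid_ccvg rF)).
have iG' : cintegrable leb (fun x => G (- x)).
  by case: iG => f1 f2; split; [exact: (integrable_opp f1)|exact: (integrable_opp f2)].
have opp (H : R -> R[i]) x l : is_cderive H (- x) l -> is_cderive (fun x => -1 * H (- x)) x l.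
  move=> dH; have dH' : is_cderive H (0 + -1 * x) l by rewrite add0r mulN1r.
  apply: (@is_cderive_ext _ (fun x => -1 * H (0 + -1 * x))).
    by move=> y; rewrite add0r (mulN1r y).
  apply: is_cderive_eq (is_cderiveZ (-1) (is_cderive_affine dH')) _.
  by rewrite rmorphN rmorph1 !mulN1r opprK.
rewrite (@cintegral_half_line _ (fun x => -1 * F (- x)) (fun x => G (- x)) 0).
- by rewrite oppr0 mulN1r; ring.
- by move=> x; exact: opp.
- move=> x; have [m dm] := dG (- x); exists (-1 * m).
  apply: is_cderive_ext (is_cderiveZ (-1) (opp _ _ _ dm)) => y.
  by rewrite mulrA mulrNN mul1r mul1r.
- exact: cintegrable_heaviside.
- rewrite -(mulr0 (-1)); apply: ccvgZ; apply: (@rapid_ccvg (fun x => F (- x))).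
  have := @rapid_affine _ F 0 (-1) _ rF; rewrite oppr_eq0 oner_eq0 => /(_ isT).
  by congr rapidly_decreasing; apply/funext => y; rewrite add0r mulN1r.
Qed.

Lemma schwartz_expi f u : schwartz f ->
  forall x, is_cderive (fun x => f x * expi (u * x)) x
    (cderiv 1 f x * expi (u * x) + u%:C * ('i * (f x * expi (u * x)))).
Proof.
move=> sf x; have d2 := is_cderive_expi (is_derive_mulr u x).
apply: is_cderive_eq (is_cderiveM (schwartz_is_cderive x sf) d2) _.
rewrite (_ : 0 +i* u = u%:C * 'i); last by apply/eqP; rewrite eq_complex /=; apply/andP; split; apply/eqP; ring.
ring.
Qed.

Lemma schwartz_expi_integrable f u : schwartz f -> cintegrable leb (fun x => f x * expi (u * x)).
Proof. by move=> sf; apply: cintegrable_expi; [exact: measurable_mulr | exact: schwartz_integrable]. Qed.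

(** The derivative of [f(x) e^{iux}] has integral 0. *)
Lemma fourier_cderiv f u : schwartz f ->
  fourier (cderiv 1 f) u = - (u%:C * ('i * fourier f u)).
Proof.
move=> sf; have sf' := schwartz_cderiv sf.
have i1 := schwartz_expi_integrable u sf'; have i2 := schwartz_expi_integrable u sf.
have i2' := cintegrableZ 'i i2; have i3 := cintegrableZ u%:C i2'.
have := @cintegral_derive0 _ _ (schwartz_expi u sf) _ (cintegrableD i1 i3) _.
rewrite cintegralD// !cintegralZ// => H; apply/eqP; rewrite -addr_eq0; apply/eqP; apply: H.
- move=> x; eexists; apply: is_cderiveD; first exact: schwartz_expi.
  by do 2 apply: is_cderiveZ; exact: schwartz_expi.
- apply: rapid_le (schwartz_rapid sf) => x.
  by rewrite modulusM modulus_expi mulr1.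
Qed.

Lemma fourierZ c f u : cintegrable leb f -> fourier (fun x => c * f x) u = c * fourier f u.
Proof.
move=> fi; rewrite /fourier -cintegralZ.
  by apply: eq_cintegral => x; rewrite mulrA.
by apply: cintegrable_expi => //; exact: measurable_mulr.
Qed.

(** Transforms of Schwartz functions form a class closed under derivation, a derivative being the
    transform of [i x f]. Decay comes by induction: one more power of [u] is paid for by
    differentiating [f]. *)
Lemma schwartz_fourier f : schwartz f -> schwartz (fourier f).
Proof.
move=> sf; apply: (@schwartz_coind _ [set h | exists2 f, schwartz f & h = fourier f]); last by exists f.
  move=> _ [{sf}g sg ->] m; elim: m g sg => [|m IHm] g sg.
    have [M HM] := modulus_fourier (schwartz_integrable sg); exists M => u.
    by rewrite expr0 mul1r.
  have [M HM] := IHm _ (schwartz_cderiv sg); exists M => u; apply: le_trans (HM u).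
  rewrite fourier_cderiv// modulusN !modulusM modulusR exprSr -mulrA.
  suff -> : modulus ('i : R[i]) = 1 by rewrite mul1r.
  by rewrite modulusE /= expr0n expr1n add0r sqrtr1.
move=> _ [{sf}g sg ->]; exists (fourier (fun x => 'i * (x%:C * g x))).
  by exists (fun x => 'i * (x%:C * g x)) => //; apply: schwartzZ; exact: schwartzX.
move=> u; apply: fourier_is_cderive; apply: schwartz_integrable => //; first exact: schwartzX.
by do 2 apply: schwartzX.
Qed.

(** Unnormalised: its integral is 2, and its transform [2 / (1 + s^2)] has integral [2 * pi]. *)
Definition laplace_density (x : R) : R := expR (- `|x|).

Lemma expR_oneDsqrV (x : R) : 0 <= x -> expR (- x) <= 4 * (1 + x ^+ 2)^-1.
Proof.
move=> x0; have h := expR_ge1Dx (x / 2).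
have h2 : (1 + x ^+ 2) / 4 <= expR x.
  (* [expR x] is the square of [expR (x / 2)], hence at least [(1 + x / 2)^2], which dominates
     [(1 + x^2) / 4]. *)
  rewrite [in expR x](_ : x = x / 2 + x / 2); last by field.
  rewrite expRD -expr2; apply: (@le_trans _ _ ((1 + x / 2) ^+ 2)); first nra.
  by rewrite lerXn2r ?nnegrE ?expR_ge0// addr_ge0// divr_ge0.
by rewrite expRN -(invrK 4) -invfM lef_pV2 ?posrE ?expR_gt0 1?mulrC// mulr_gt0 ?invr_gt0// ltr_wpDr// sqr_ge0.
Qed.

Lemma measurable_laplace_density : measurable_fun setT laplace_density.
Proof.
apply: measurableT_comp; first exact: measurable_expR.
by apply: measurableT_comp => //; exact: measurable_normr.
Qed.

Lemma integrable_laplace_density : leb.-integrable setT (EFin \o laplace_density).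
Proof.
apply: le_integrable (integrable_scale 4 integrable_oneDsqrV) => //.
  by apply/measurable_EFinP; exact: measurable_laplace_density.
move=> x _ /=; rewrite lee_fin ger0_norm ?expR_ge0// ger0_norm; last first.
  by rewrite mulr_ge0// invr_ge0 addr_ge0 ?sqr_ge0.
by rewrite -[in leRHS]real_normK ?num_real//; exact: expR_oneDsqrV.
Qed.

Lemma cintegrable_laplace_density : cintegrable leb (fun x => (laplace_density x)%:C).
Proof.
apply: (@cintegrable_le _ _ _ leb _ _ _ integrable_laplace_density).
  exact: cmeasurableR measurable_laplace_density.
by move=> x; rewrite modulusR ger0_norm ?expR_ge0.
Qed.

Lemma cintegral_half_line_cexp (z : R[i]) : complex.Re z = -1 ->
  cintegral leb setT (fun x => (heaviside x)%:C * cexp (x%:C * z)) = - z^-1.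
Proof.
move=> z1; have z0 : z != 0 by apply/eqP => z0; move: z1; rewrite z0 /= => /eqP; rewrite eq_sym oppr_eq0 oner_eq0.
have dz x := is_cderiveZ (z^-1) (is_cderive_cexp z x).
rewrite (@cintegral_half_line _ (fun x => z^-1 * cexp (x%:C * z)) _ 0).
- by rewrite mul0r cexp0 mulr1 sub0r.
- by move=> x; apply: is_cderive_eq (dz x) _; rewrite mulrA mulVf// mul1r.
- by move=> x; eexists; exact: is_cderive_cexp.
- apply: (@cintegrable_le _ _ _ leb _ _ _ integrable_laplace_density).
    apply: cmeasurableM; first exact: cmeasurableR measurable_heaviside.
    apply: cmeasurable_cexp; apply: cmeasurableM; last exact: cmeasurable_cst.
    exact: cmeasurableR.
  move=> x; rewrite modulusM modulusR modulus_cexp Re_scale z1 mulrN1 /heaviside /laplace_density.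
  by case: ltP => x0; rewrite ?normr1 ?normr0 ?mul0r ?expR_ge0// mul1r gtr0_norm.
(* [expR (- n)] is at most [4 / (1 + n^2)], hence at most [8 / (n + 1)] because
   [n + 1 <= 2 (1 + n^2)]; the harmonic sequence has a known limit. *)
- apply: (@ccvg_le _ _ _ (fun n : nat => modulus z^-1 * (8 * n.+1%:R^-1))).
    move=> n; rewrite subr0 modulusM ler_wpM2l ?modulus_ge0// modulus_cexp Re_scale z1 mulrN1.
    apply: le_trans (expR_oneDsqrV _) _ => //.
    rewrite ler_pdivrMr ?ltr_wpDr ?sqr_ge0// mulrAC ler_pdivlMr ?ltr0n// -natr1.
    by have := sqr_ge0 (n%:R - 1 : R); nra.
  rewrite -(mulr0 (modulus z^-1)); apply: cvgM; first exact: cvg_cst.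
  by rewrite -(mulr0 8); apply: cvgM; [exact: cvg_cst|exact: cvg_harmonic].
Qed.

Lemma fourier_laplace_density (s : R) :
  fourier (fun x => (laplace_density x)%:C) s = (2 * (1 + s ^+ 2)^-1)%:C.
Proof.
rewrite /fourier cintegral_split; last first.
  by apply: cintegrable_expi cintegrable_laplace_density; exact: measurable_mulr.
have e1 : (fun x => (heaviside x)%:C * ((laplace_density x)%:C * expi (s * x))) =
    (fun x => (heaviside x)%:C * cexp (x%:C * (-1 +i* s))).
  apply/funext => x; rewrite /heaviside; case: ltP => x0; last by rewrite !mul0r.
  rewrite /cexp /laplace_density gtr0_norm//=; congr (_ * ((expR _)%:C * expi _)); ring.
have e2 : (fun x => (heaviside x)%:C * ((laplace_density (- x))%:C * expi (s * - x))) =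
    (fun x => (heaviside x)%:C * cexp (x%:C * (-1 +i* - s))).
  apply/funext => x; rewrite /heaviside; case: ltP => x0; last by rewrite !mul0r.
  rewrite /cexp /laplace_density normrN gtr0_norm//=; congr (_ * ((expR _)%:C * expi _)); ring.
rewrite e1 e2 !cintegral_half_line_cexp//.
have s0 : 1 + s ^+ 2 != 0 by rewrite gt_eqF// ltr_wpDr ?sqr_ge0.
apply/eqP; rewrite eq_complex /=; apply/andP; split; apply/eqP; rewrite ?sqrrN ?expr1n; field; rewrite ?s0//.
Qed.

Lemma Rintegral_oneDsqrV : Rintegral leb setT (fun x : R => 2 * (1 + x ^+ 2)^-1) = 2 * pi.
Proof.
rewrite RintegralZl//; last exact: integrable_oneDsqrV.
congr (_ * _); rewrite /Rintegral (@ge0_symfun_integralT R (fun x => (1 + x ^+ 2)^-1))//.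
- by rewrite -set_itvcy integral0y_oneDsqr -EFinM /=; field.
- by move=> x; rewrite invr_ge0 addr_ge0 ?sqr_ge0.
- exact: continuous_oneDsqrV.
- by move=> x /=; rewrite sqrrN.
Qed.

Lemma cmeasurable_comp {d d'} {T : measurableType d} {T' : measurableType d'}
    (f : T' -> R[i]) (g : T -> T') : cmeasurable f -> measurable_fun setT g ->
  cmeasurable (fun x => f (g x)).
Proof. by move=> [f1 f2] mg; split; [exact: (measurableT_comp f1 mg)|exact: (measurableT_comp f2 mg)]. Qed.

Lemma schwartz_seq_continuous f (u : nat -> R) (l : R) : schwartz f ->
  u @ \oo --> l -> ccvg (fun n => f (u n)) (f l).
Proof.
move=> sf ul; have [c1 c2] := schwartz_continuous sf.
apply: ccvg_ReIm; [exact: (continuous_cvg _ (c1 l) ul)|exact: (continuous_cvg _ (c2 l) ul)].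
Qed.

Lemma cintegrableMr {d} {T : measurableType d} (mu : {measure set T -> \bar R})
    (f g : T -> R[i]) (M : R) : cmeasurable g -> (forall x, modulus (g x) <= M) ->
  cintegrable mu f -> cintegrable mu (fun x => f x * g x).
Proof.
move=> mg gM fi; rewrite (_ : (fun _ => _) = (fun x => g x * f x)); last first.
  by apply/funext => x; rewrite mulrC.
exact: cintegrableMl mg gM fi.
Qed.

(* Damping by [expR (- `|e * u|)], whose transform is a Cauchy density. *)
Lemma cauchy_approximation f (x : R) (e : R) : 0 < e -> schwartz f ->
  cintegral leb setT (fun u => fourier f u * (expi (- (u * x)) * (laplace_density (e * u))%:C)) =
  cintegral leb setT (fun s => f (x + e * s) * (2 * (1 + s ^+ 2)^-1)%:C).
Proof.
move=> e0 sf; have ei : 0 < e^-1 by rewrite invr_gt0.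
have mE : measurable_fun setT (fun u => laplace_density (e * u)).
  by apply: measurableT_comp; [exact: measurable_laplace_density|exact: measurable_mulr].
have iE : cintegrable leb (fun u => (laplace_density (e * u))%:C).
  have := cintegrable_affine 0 e0 cintegrable_laplace_density.
  by under eq_fun do rewrite add0r.
pose H u y := f y * ((laplace_density (e * u))%:C * expi (u * (y - x))).
have mH : cmeasurable (fun z : R * R => H z.1 z.2).
  apply: cmeasurableM; first by apply: cmeasurable_comp (schwartz_measurable sf) _.
  apply: cmeasurableM; first by apply: cmeasurableR; apply: (measurableT_comp mE).
  apply: cmeasurable_expi; apply: measurable_funM => //.
  by apply: measurable_funB.
transitivity (cintegral leb setT (fun u => cintegral leb setT (fun y => H u y))).
  apply: eq_cintegral => u; rewrite mulrC /fourier -cintegralZ; last exact: schwartz_expi_integrable.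
  apply: eq_cintegral => y; rewrite /H mulrBr expiD; ring.
rewrite (@cintegral_swap _ _ _ _ _ leb leb H (fun u => laplace_density (e * u)) (fun y => modulus (f y)))//; first last.
- by apply: integrable_modulus; exact: schwartz_integrable.
- have := integrable_affine 0 e0 integrable_laplace_density.
  by apply: eq_integrable => // u _; rewrite /= add0r.
- by move=> y; exact: modulus_ge0.
- by move=> u; exact: expR_ge0.
- by move=> u y; rewrite /H !modulusM modulus_expi mulr1 modulusR ger0_norm ?expR_ge0// mulrC.
(* The inner integral is the transform of the Laplace density, rescaled by [e] and evaluated at
   [(y - x) / e]. *)
have K y : cintegral leb setT (fun u => H u y) = f y * (e^-1 * (2 * (1 + (e^-1 * (y - x)) ^+ 2)^-1))%:C.
  rewrite /H cintegralZ; last by apply: cintegrable_expi iE; exact: measurable_mull.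
  congr (_ * _); rewrite (cintegral_affine 0 ei); last first.
    by apply: cintegrable_expi iE; exact: measurable_mull.
  transitivity ((e^-1)%:C * fourier (fun x => (laplace_density x)%:C) (e^-1 * (y - x))); last first.
    by rewrite fourier_laplace_density -rmorphM.
  congr (_ * _); apply: eq_cintegral => v.
  rewrite add0r mulrA divff ?gt_eqF// mul1r; congr (_ * expi _); ring.
rewrite (eq_cintegral leb K).
set G := fun y : R => _.
have iG : cintegrable leb G.
  apply: (cintegrableMr (M := e^-1 * 2)) (schwartz_integrable sf) => //.
    apply: cmeasurableR; apply: measurable_funM => //; apply: measurable_funM => //.
    have mV : measurable_fun setT (fun s : R => (1 + s ^+ 2)^-1).
      by apply: continuous_measurable_fun; exact: continuous_oneDsqrV.
    apply: (measurableT_comp mV); apply: measurable_funM => //; exact: measurable_funB.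
  move=> y; rewrite modulusR ger0_norm; last first.
    by rewrite !mulr_ge0 ?(ltW ei)// invr_ge0 addr_ge0 ?sqr_ge0.
  rewrite ler_wpM2l ?(ltW ei)// ler_piMr// invf_le1 ?lerDl ?sqr_ge0//.
  by rewrite ltr_wpDr ?sqr_ge0.
rewrite (cintegral_affine x e0 iG) -cintegralZ; last exact: cintegrable_affine.
apply: eq_cintegral => s; rewrite /G.
have -> : e^-1 * (x + e * s - x) = s by field; rewrite gt_eqF.
by rewrite mulrCA -rmorphM; congr (_ * _%:C); field; rewrite !gt_eqF// ltr_wpDr ?sqr_ge0.
Qed.

(** The damping tends to 1 in [cauchy_approximation]. The left side is dominated by the modulus of
    the transform; on the right the Cauchy density concentrates at [x], [f] being continuous and
    bounded, and its mass [2 * pi] is the constant. *)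
Lemma fourier_inversion f (x : R) : schwartz f ->
  cintegral leb setT (fun u => fourier f u * expi (- (u * x))) = (2 * pi)%:C * f x.
Proof.
move=> sf; have sF := schwartz_fourier sf.
have mx : measurable_fun setT (fun u : R => - (u * x)).
  by apply: measurableT_comp => //; exact: measurable_mull.
pose e (n : nat) : R := n.+1%:R^-1.
have e0 n : 0 < e n by rewrite /e invr_gt0 ltr0n.
have ecvg : e @ \oo --> (0 : R) by exact: cvg_harmonic.
have eMcvg (s : R) : (fun n => e n * s) @ \oo --> (0 : R).
  by rewrite -(mul0r s); apply: cvgM => //; exact: cvg_cst.
have mV : measurable_fun setT (fun s : R => 2 * (1 + s ^+ 2)^-1).
  by apply: measurable_funM => //; apply: continuous_measurable_fun; exact: continuous_oneDsqrV.
have c1 : ccvg (fun n => cintegral leb setT (fun u => fourier f u * (expi (- (u * x)) * (laplace_density (e n * u))%:C)))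
    (cintegral leb setT (fun u => fourier f u * expi (- (u * x)))).
  apply: (@cintegral_dominated_convergence _ _ _ leb _ _ (fun u => modulus (fourier f u))).
  - move=> n; apply: cmeasurableM; first exact: schwartz_measurable.
    apply: cmeasurableM; first exact: cmeasurable_expi.
    apply: cmeasurableR; apply: (measurableT_comp measurable_laplace_density); exact: measurable_mulr.
  - by apply: cmeasurableM; [exact: schwartz_measurable|exact: cmeasurable_expi].
  - move=> u; apply: ccvgZ; rewrite -[X in ccvg _ X]mulr1; apply: ccvgZ; apply: ccvgR.
    rewrite -expR0 -oppr0 -(normr0 R); apply: (continuous_cvg _ (@continuous_expR R _)).
    by apply: cvgN; apply: cvg_norm.
  - by apply: integrable_modulus; exact: schwartz_integrable.
  - move=> n u; rewrite !modulusM modulus_expi mul1r modulusR ger0_norm ?expR_ge0//.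
    by rewrite ler_piMr ?modulus_ge0// -expR0 ler_expR oppr_le0.
have [M HM] := schwartz_rapid sf 0.
have {}HM y : modulus (f y) <= M by have := HM y; rewrite expr0 mul1r.
have c2 : ccvg (fun n => cintegral leb setT (fun s => f (x + e n * s) * (2 * (1 + s ^+ 2)^-1)%:C))
    (cintegral leb setT (fun s => f x * (2 * (1 + s ^+ 2)^-1)%:C)).
  apply: (@cintegral_dominated_convergence _ _ _ leb _ _ (fun s => M * (2 * (1 + s ^+ 2)^-1))).
  - move=> n; apply: cmeasurableM; last exact: cmeasurableR.
    by apply: cmeasurable_affine; exact: schwartz_measurable.
  - by apply: cmeasurableM; [exact: cmeasurable_cst|exact: cmeasurableR].
  - move=> s; apply: ccvgM; last exact: ccvg_cst.
    apply: schwartz_seq_continuous => //.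
    by rewrite -[X in _ --> X]addr0; apply: cvgD => //; exact: cvg_cst.
  - by do 2 apply: integrable_scale; exact: integrable_oneDsqrV.
  - move=> n s; rewrite modulusM modulusR ger0_norm ?mulr_ge0 ?invr_ge0 ?addr_ge0 ?sqr_ge0//.
    by rewrite ler_wpM2r// mulr_ge0// invr_ge0 addr_ge0 ?sqr_ge0.
rewrite (eq_fun (fun n => cauchy_approximation x (e0 n) sf)) in c1.
rewrite (ccvg_unique c1 c2) cintegralZ ?cintegralR ?Rintegral_oneDsqrV 1?mulrC//.
apply: (@cintegrable_le _ _ _ leb _ _ _ (integrable_scale 2 integrable_oneDsqrV)).
  exact: cmeasurableR.
by move=> s; rewrite modulusR ger0_norm// mulr_ge0// invr_ge0 addr_ge0 ?sqr_ge0.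
Qed.

(** The reflected argument is written [0 + -1 * x] so that the closure of the Schwartz space under
    affine substitutions applies literally. *)
Definition ifourier f (x : R) : R[i] := ((2 * pi)^-1)%:C * fourier f (0 + -1 * x).

Lemma pi2_neq0 : (2 * pi : R) != 0.
Proof. by rewrite mulf_neq0// gt_eqF// pi_gt0. Qed.

Lemma ifourierE f x : ifourier f x = ((2 * pi)^-1)%:C * cintegral leb setT (fun u => f u * expi (- (u * x))).
Proof.
rewrite /ifourier /fourier; congr (_ * _); apply: eq_cintegral => u; congr (_ * expi _); ring.
Qed.

Lemma schwartz_ifourier f : schwartz f -> schwartz (ifourier f).
Proof.
move=> sf; apply: schwartzZ; apply: schwartz_affine; first by rewrite oppr_eq0 oner_eq0.
exact: schwartz_fourier.
Qed.

Lemma fourierK f : schwartz f -> ifourier (fourier f) = f.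
Proof.
move=> sf; apply/funext => x; rewrite ifourierE fourier_inversion// mulrA -rmorphM.
by rewrite mulVf ?pi2_neq0// mul1r.
Qed.

(** The substitution of [- x] for [x] in the outer integral gives the inversion integral of [f]
    again. *)
Lemma ifourierK f : schwartz f -> fourier (ifourier f) = f.
Proof.
move=> sf; apply/funext => v; rewrite /ifourier fourierZ; last first.
  apply: schwartz_integrable; apply: schwartz_affine; first by rewrite oppr_eq0 oner_eq0.
  exact: schwartz_fourier.
rewrite /fourier -/(fourier f) cintegral_opp; last first.
  apply: cmeasurableM; last by apply: cmeasurable_expi; exact: measurable_mulr.
  exact: (cmeasurable_affine 0 (-1) (schwartz_measurable (schwartz_fourier sf))).
transitivity (((2 * pi)^-1)%:C * cintegral leb setT (fun u => fourier f u * expi (- (u * v)))).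
  congr (_ * _); apply: eq_cintegral => x; congr (fourier f _ * expi _); ring.
rewrite fourier_inversion// mulrA -rmorphM.
by rewrite mulVf ?pi2_neq0// mul1r.
Qed.

End Fourier.

(** * Homogeneous multipliers *)

Section LizorkinDual.
Context {R : realType}.
Implicit Types f g : R -> R[i].

Lemma lizorkin_dual_schwartz f : lizorkin_dual f -> schwartz f.
Proof. by case. Qed.

Lemma lizorkin_dual_cderiv f : lizorkin_dual f -> lizorkin_dual (cderiv 1 f).
Proof.
move=> [sf f0]; split; first exact: schwartz_cderiv.
by move=> j; rewrite cderivS.
Qed.

Lemma lizorkin_dual0 f : lizorkin_dual f -> f 0 = 0.
Proof. by move=> [_ /(_ 0%N)]; rewrite cderiv0. Qed.

Lemma lizorkin_dualD f g : lizorkin_dual f -> lizorkin_dual g -> lizorkin_dual (fun x => f x + g x).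
Proof.
move=> sf sg; apply: (@lizorkin_dual_coind _ [set h | exists f g, [/\ lizorkin_dual f, lizorkin_dual g & h = fun x => f x + g x]]); last by exists f, g.
- by move=> _ [u [v [Lu Lv ->]]]; rewrite !lizorkin_dual0// addr0.
- by move=> _ [u [v [[su _] [sv _] ->]]]; apply: rapidD; exact: schwartz_rapid.
move=> _ [u [v [su sv ->]]]; exists (fun x => cderiv 1 u x + cderiv 1 v x).
  by exists (cderiv 1 u), (cderiv 1 v); split => //; exact: lizorkin_dual_cderiv.
by move=> x; apply: is_cderiveD; apply: schwartz_is_cderive; exact: lizorkin_dual_schwartz.
Qed.

Lemma lizorkin_dualZ (c : R[i]) f : lizorkin_dual f -> lizorkin_dual (fun x => c * f x).
Proof.
move=> sf; apply: (@lizorkin_dual_coind _ [set h | exists2 f, lizorkin_dual f & h = fun x => c * f x]); last by exists f.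
- by move=> _ [u /lizorkin_dual0 u0 ->]; rewrite u0 mulr0.
- by move=> _ [u [su _] ->]; apply: rapidZ; exact: schwartz_rapid.
move=> _ [u su ->]; exists (fun x => c * cderiv 1 u x).
  by exists (cderiv 1 u) => //; exact: lizorkin_dual_cderiv.
by move=> x; apply: is_cderiveZ; apply: schwartz_is_cderive; exact: lizorkin_dual_schwartz.
Qed.

Lemma lizorkin_dualX f : lizorkin_dual f -> lizorkin_dual (fun x => x%:C * f x).
Proof.
move=> sf; apply: (@lizorkin_dual_coind _ [set h | exists f g, [/\ lizorkin_dual f, lizorkin_dual g & h = fun x => x%:C * f x + g x]]).
- by move=> _ [u [v [_ /lizorkin_dual0 v0 ->]]]; rewrite mul0r add0r.
- by move=> _ [u [v [[su _] [sv _] ->]]]; apply: rapidD; [apply: rapidX|]; exact: schwartz_rapid.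
- move=> _ [u [v [su sv ->]]]; exists (fun x => x%:C * cderiv 1 u x + (u x + cderiv 1 v x)).
    exists (cderiv 1 u), (fun x => u x + cderiv 1 v x); split => //; first exact: lizorkin_dual_cderiv.
    by apply: lizorkin_dualD => //; exact: lizorkin_dual_cderiv.
  move=> x; have dx := is_cderiveR (is_derive_id x 1).
  apply: is_cderive_eq (is_cderiveD (is_cderiveM dx (schwartz_is_cderive x (lizorkin_dual_schwartz su)))
    (schwartz_is_cderive x (lizorkin_dual_schwartz sv))) _.
  by rewrite mul1r /= addrCA addrA.
exists f, (fun x => 0 * f x); split => //; first exact: lizorkin_dualZ.
by apply/funext => x; rewrite mul0r addr0.
Qed.

(** Taylor's formula with all coefficients zero, by induction: the bound of order [k] for the
    derivative integrates to order [k + 1]. *)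
Lemma lizorkin_dual_flat f (k : nat) : lizorkin_dual f ->
  exists2 C : R, 0 <= C & forall u, modulus (f u) <= C * `|u| ^+ k.
Proof.
elim: k f => [|k IHk] f Lf.
  have [M HM] := schwartz_rapid (lizorkin_dual_schwartz Lf) 0%N.
  exists M => [|u]; first by apply: le_trans (HM 0); rewrite expr0 mul1r modulus_ge0.
  by rewrite expr0 mulr1; have := HM u; rewrite expr0 mul1r.
have [C C0 HC] := IHk _ (lizorkin_dual_cderiv Lf); exists (2 * C); first exact: mulr_ge0.
have dF x : is_cderive f x (cderiv 1 f x) by apply: schwartz_is_cderive; exact: lizorkin_dual_schwartz.
have le (u v : R) : `|v| <= `|u| -> modulus (cderiv 1 f v) <= C * `|u| ^+ k.
  by move=> vu; apply: le_trans (HC v) _; rewrite ler_wpM2l// lerXn2r ?nnegrE.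
move=> u; have [u0|u0] := leP 0 u.
  rewrite -[f u]subr0 -(lizorkin_dual0 Lf).
  have -> : 2 * C * `|u| ^+ k.+1 = 2 * (C * `|u| ^+ k) * (u - 0).
    by rewrite exprSr subr0 [in RHS](ger0_norm u0) (ger0_norm u0); ring.
  apply: (cMVT u0 (fun x _ => dF x)) => x /andP[x0 xu].
  by apply: le; rewrite !ger0_norm.
rewrite -modulusN -[- f u]add0r -(lizorkin_dual0 Lf).
have -> : 2 * C * `|u| ^+ k.+1 = 2 * (C * `|u| ^+ k) * (0 - u).
  by rewrite exprSr sub0r [in RHS](ltr0_norm u0) (ltr0_norm u0); ring.
apply: (cMVT (ltW u0) (fun x _ => dF x)) => x /andP[x0 xu].
by apply: le; rewrite (ltr0_norm u0) ler0_norm// lerN2.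
Qed.

(* [homog a b p] is the function homogeneous of degree [p] with values [a] at
   [1] and [b] at [-1]; it vanishes at [0]. *)
Definition homog (a b : R[i]) (p x : R) : R[i] :=
  if 0 < x then a * (x `^ p)%:C else if x < 0 then b * ((- x) `^ p)%:C else 0.

Lemma homog0 a b p : homog a b p 0 = 0.
Proof. by rewrite /homog ltxx. Qed.

Lemma powR_add (x p q : R) : 0 < x -> x `^ (p + q) = x `^ p * x `^ q.
Proof. by move=> x0; apply: powRD; rewrite (gt_eqF x0) implybT. Qed.

Lemma homogM a b p c d q x : homog a b p x * homog c d q x = homog (a * c) (b * d) (p + q) x.
Proof.
rewrite /homog; case: ltgtP => x0.
- by rewrite powR_add// rmorphM; ring.
- by rewrite powR_add ?oppr_gt0// rmorphM; ring.
- by rewrite mul0r.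
Qed.

Lemma homog1 x : x != 0 -> homog 1 1 0 x = 1.
Proof. by rewrite /homog; case: ltgtP => //= x0 _; rewrite powRr0 mulr1. Qed.

Lemma modulus_homog_le a b p x : modulus (homog a b p x) <= (modulus a + modulus b) * `|x| `^ p.
Proof.
rewrite /homog; case: ltgtP => x0.
- by rewrite modulusM modulusR ger0_norm ?powR_ge0// gtr0_norm// ler_wpM2r ?powR_ge0// lerDl modulus_ge0.
- by rewrite modulusM modulusR ger0_norm ?powR_ge0// ltr0_norm// ler_wpM2r ?powR_ge0// lerDr modulus_ge0.
- by rewrite modulus0 mulr_ge0 ?addr_ge0 ?modulus_ge0 ?powR_ge0.
Qed.

Lemma powR_natM (x p : R) (k : nat) : 0 < x -> x `^ p * x ^+ k = x `^ (p + k%:R).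
Proof. by move=> x0; rewrite powR_add// powR_mulrn// ltW. Qed.

Lemma powR_le1 (x p : R) : 0 < x <= 1 -> 0 <= p -> x `^ p <= 1.
Proof.
move=> /andP[x0 x1] p0; rewrite -(powRr0 x); by apply: ger_powR => //; rewrite x0 x1.
Qed.

Lemma homog_flat a b p f (k : nat) : lizorkin_dual f ->
  exists2 C : R, 0 <= C & forall u, `|u| <= 1 -> modulus (homog a b p u * f u) <= C * `|u| ^+ k.
Proof.
move=> Lf; have [C C0 HC] := lizorkin_dual_flat (k + (Num.truncn `|p|).+1) Lf.
exists ((modulus a + modulus b) * C) => [|u u1]; first by rewrite mulr_ge0 ?addr_ge0 ?modulus_ge0.
have [->|u0] := eqVneq u 0.
  by rewrite homog0 mul0r modulus0 mulr_ge0 ?exprn_ge0// mulr_ge0 ?addr_ge0 ?modulus_ge0.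
rewrite modulusM; apply: le_trans (ler_pM (modulus_ge0 _) (modulus_ge0 _) (modulus_homog_le a b p u) (HC u)) _.
rewrite mulrACA ler_wpM2l ?mulr_ge0 ?addr_ge0 ?modulus_ge0//.
rewrite exprD mulrCA ler_piMr ?exprn_ge0// powR_natM ?normr_gt0// powR_le1 ?normr_gt0 ?u0//.
have : `|p| < (Num.truncn `|p|).+1%:R by apply: truncnS_gt.
by have := ler_norm (- p); rewrite normrN; lra.
Qed.

Lemma is_cderive_near f g (x : R) l : (\near x, f x = g x) -> is_cderive f x l -> is_cderive g x l.
Proof.
move=> fg [d1 d2]; split.
  apply: near_eq_is_derive d1; near=> y; rewrite /rpart; congr complex.Re; near: y; exact: fg.
apply: near_eq_is_derive d2; near=> y; rewrite /ipart; congr complex.Im; near: y; exact: fg.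
Unshelve. all: by end_near. Qed.

(** On the negative axis differentiating [(- x)^p] contributes a sign, which turns [b] into
    [- b]. *)
Lemma is_cderive_homog a b p x : x != 0 ->
  is_cderive (homog a b p) x (p%:C * homog a (- b) (p - 1) x).
Proof.
rewrite [in _ * homog _ _ _ x]/homog; case: ltgtP => //= x0 _.
  have d := is_cderiveZ a (is_cderiveR (is_derive1_powR p x0)).
  apply: (is_cderive_near (f := fun y => a * (y `^ p)%:C)).
    near=> y; rewrite /homog; suff -> : 0 < y by [].
    by near: y; exact: lt_nbhsr.
  by apply: is_cderive_eq d _; rewrite rmorphM; ring.
have x0' : 0 < - x by rewrite oppr_gt0.
have dN : is_derive x 1 (fun y : R => - y) (-1) by exact: is_deriveNid.
have d := is_cderiveZ b (is_cderiveR (is_derive1_comp (is_derive1_powR p x0') dN)).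
apply: (is_cderive_near (f := fun y => b * ((- y) `^ p)%:C)).
  near=> y; rewrite /homog.
  have y0 : y < 0 by near: y; exact: lt_nbhsl.
  by rewrite y0 lt_gtF.
by apply: is_cderive_eq d _; rewrite mulrN1 rmorphN rmorphM; ring.
Unshelve. all: by end_near. Qed.

Lemma homog_mulx a b p x : homog a b p x = homog a (- b) (p - 1) x * x%:C.
Proof.
rewrite /homog; case: ltgtP => x0; last by rewrite mul0r.
  rewrite -mulrA -rmorphM; congr (_ * _%:C).
  by rewrite -[X in _ * X]expr1 powR_natM// subrK.
rewrite -mulrA mulNr -mulrN -rmorphM -rmorphN; congr (_ * _%:C).
by rewrite -mulrN -[X in _ * X]expr1 powR_natM ?oppr_gt0// subrK.
Qed.

Lemma homog_rapid a b p f : lizorkin_dual f -> rapidly_decreasing (fun x => homog a b p x * f x).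
Proof.
move=> Lf m; have [C C0 HC] := homog_flat a b p 0 Lf.
pose N := (Num.truncn `|p|).+1.
have [M HM] := schwartz_rapid (lizorkin_dual_schwartz Lf) (m + N).
have M0 : 0 <= M.
  by apply: le_trans (HM 0); rewrite mulr_ge0 ?exprn_ge0 ?modulus_ge0.
exists (C + (modulus a + modulus b) * M) => x.
have ab0 : 0 <= modulus a + modulus b by rewrite addr_ge0 ?modulus_ge0.
have [x1|x1] := leP `|x| 1.
  apply: (@le_trans _ _ C); last by rewrite lerDl mulr_ge0.
  apply: le_trans (_ : 1 * (C * `|x| ^+ 0) <= _); last by rewrite mul1r expr0 mulr1.
  by apply: ler_pM; rewrite ?exprn_ge0 ?modulus_ge0// ?exprn_ile1// HC.
apply: (@le_trans _ _ ((modulus a + modulus b) * M)); last by rewrite lerDr.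
rewrite modulusM mulrCA.
apply: le_trans (ler_wpM2r _ (modulus_homog_le a b p x)) _.
  by rewrite mulr_ge0 ?exprn_ge0 ?modulus_ge0.
rewrite -mulrA ler_wpM2l//; apply: le_trans (HM x).
rewrite exprD mulrCA -mulrA ler_wpM2l ?exprn_ge0// ler_wpM2r ?modulus_ge0//.
rewrite -powR_mulrn//; apply: ler_powR; first exact: ltW.
by apply: le_trans (ler_norm _) _; apply: ltW; rewrite /N truncnS_gt.
Qed.

(** The degree ranges over all reals so that the class is closed under derivation: the derivative of
    [homog a b p * f] is [homog a (- b) (p - 1)] times [x f' + p f], and that factor is again flat
    at 0. *)
Lemma lizorkin_dual_homog a b p f : lizorkin_dual f -> lizorkin_dual (fun x => homog a b p x * f x).
Proof.
move=> Lf.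
apply: (@lizorkin_dual_coind _ [set h | exists a b p f, lizorkin_dual f /\ h = fun x => homog a b p x * f x]); last by exists a, b, p, f.
- by move=> _ [c [d [q [g [Lg ->]]]]]; rewrite homog0 mul0r.
- by move=> _ [c [d [q [g [Lg ->]]]]]; exact: homog_rapid.
move=> _ [c [d [q [g [Lg ->]]]]].
have Lg' := lizorkin_dual_cderiv Lg.
exists (fun x => homog c (- d) (q - 1) x * (x%:C * cderiv 1 g x + q%:C * g x)).
  exists c, (- d), (q - 1), (fun x => x%:C * cderiv 1 g x + q%:C * g x); split => //.
  by apply: lizorkin_dualD; [exact: lizorkin_dualX|exact: lizorkin_dualZ].
move=> x; have [->|x0] := eqVneq x 0.
  (* The power itself may be singular at the origin; flatness of order 2 makes the product
     differentiable there with derivative 0. *)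
  rewrite homog0 mul0r; have [C C0 HC] := homog_flat c d q 2 Lg.
  apply: (@is_cderive_quadratic _ _ _ C) => h h1.
  by rewrite mulr0 subr0 add0r homog0 mul0r subr0 -[h ^+ 2]real_normK ?num_real// HC.
apply: is_cderive_eq (is_cderiveM (is_cderive_homog c d q x0) (schwartz_is_cderive x (lizorkin_dual_schwartz Lg))) _.
by rewrite [in X in _ + X = _]homog_mulx; ring.
Qed.

End LizorkinDual.

(** * Power weights on the half line and Euler's identity *)

Section Powers.
Context {R : realType}.
Notation leb := (@lebesgue_measure R).

(** Monotone convergence along sets that exhaust the support; explicit antiderivatives will bound
    the truncated integrals. *)
Lemma ge0_integrable_exhaust (f : R -> R) (A : nat -> set R) (M : R) :
  measurable_fun setT f -> (forall x, 0 <= f x) -> (forall n, measurable (A n)) ->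
  (forall n m, (n <= m)%N -> A n `<=` A m) -> (forall x, f x != 0 -> exists n, A n x) ->
  (forall n, (\int[leb]_(x in A n) (f x)%:E <= M%:E)%E) -> leb.-integrable setT (EFin \o f).
Proof.
move=> mf f0 mA Am Af AM; apply/integrableP; split; first exact/measurable_EFinP.
pose g n x := (f x * \1_(A n) x)%:E.
have mg n : measurable_fun setT (g n).
  by apply/measurable_EFinP; apply: measurable_funM => //; exact: measurable_indic.
have g0 n x : setT x -> (0 <= g n x)%E by move=> _; rewrite lee_fin mulr_ge0.
have gm x : setT x -> {homo g^~ x : n m / (n <= m)%N >-> (n <= m)%E}.
  move=> _ n m nm; rewrite lee_fin ler_wpM2l// !indicE ler_nat.
  by have [/set_mem/(Am _ _ nm)/mem_set -> //|//] := boolP (x \in A n).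
have gf x : limn (g ^~ x) = (EFin \o f) x.
  apply/cvg_lim => //; have [fx|/Af[N AN]] := eqVneq (f x) 0.
    by rewrite /g /= fx; under eq_fun do rewrite mul0r; exact: cvg_cst.
  apply: cvg_near_cst; near=> n; rewrite /g indicE mem_set ?mulr1//.
  by apply: (Am N) => //; near: n; exact: nbhs_infty_ge.
have ge n : (\int[leb]_x g n x = \int[leb]_(x in A n) (f x)%:E)%E.
  rewrite [RHS]integral_mkcond; apply: eq_integral => x _.
  by rewrite /g patchE indicE; case: ifP => _; rewrite ?mulr1 ?mulr0.
have := monotone_convergence leb measurableT mg g0 gm.
have -> : (fun x => limn (g ^~ x)) = EFin \o f by apply/funext.
move=> mc; under eq_integral do rewrite /= ger0_norm//.
rewrite [ltLHS]mc; apply: le_lt_trans (ltry M); apply: lime_le.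
  apply: ereal_nondecreasing_is_cvgn => n m nm; apply: ge0_le_integral => //.
  - by move=> x _; exact: g0.
  - exact: mg.
  - exact: mg.
  - by move=> x _; exact: gm.
by apply: nearW => n; rewrite ge.
Unshelve. all: by end_near. Qed.

Lemma integral_powR (p a b : R) : p != -1 -> 0 < a -> a < b ->
  (\int[leb]_(x in `[a, b]) (x `^ p)%:E = ((b `^ (p + 1) - a `^ (p + 1)) / (p + 1))%:E)%E.
Proof.
move=> p1 a0 ab.
have p10 : p + 1 != 0 by rewrite addr_eq0.
have dp (x : R) : 0 < x -> is_derive x 1 (fun x => x `^ (p + 1) / (p + 1)) (x `^ p).
  move=> x0; have d := is_derive1_powR (p + 1) x0.
  have := is_deriveM d (is_derive_cst (p + 1)^-1 x 1).
  move=> /is_derive_eq1; apply; rewrite scaler0 add0r addrK /GRing.scale /= mulrA mulVf// mul1r.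
  by [].
rewrite (@continuous_FTC2 _ (fun x => x `^ p) (fun x => x `^ (p + 1) / (p + 1)))//.
- by rewrite -EFinB -mulrBl.
- apply: derivable_within_continuous => x; rewrite in_itv /= => /andP[ax _].
  have x0 : 0 < x by exact: lt_le_trans a0 ax.
  exact: (@ex_derive _ _ _ _ _ _ _ (is_derive1_powR p x0)).
- split.
  + move=> x; rewrite in_itv /= => /andP[ax _].
    exact: (@ex_derive _ _ _ _ _ _ _ (dp x (lt_trans a0 ax))).
  + by apply: cvg_at_right_filter; exact: is_derive_continuous (dp a a0).
  + by apply: cvg_at_left_filter; exact: is_derive_continuous (dp b (lt_trans a0 ab)).
- move=> x; rewrite in_itv /= => /andP[ax _].
  by rewrite derive1E; exact: (@derive_val _ _ _ _ _ _ _ (dp x (lt_trans a0 ax))).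
Qed.

(** The truncated power, zero on the closed negative half line; the cut-off discards the default
    values of the real power at nonpositive bases. *)
Definition pospow (p x : R) : R := heaviside x * x `^ p.

Lemma pospow_ge0 p x : 0 <= pospow p x.
Proof. by rewrite mulr_ge0 ?heaviside_ge0 ?powR_ge0. Qed.

Lemma measurable_pospow p : measurable_fun setT (pospow p).
Proof. by apply: measurable_funM; [exact: measurable_heaviside|exact: measurable_powR]. Qed.

Lemma pospow_gt0 p x : 0 < x -> pospow p x = x `^ p.
Proof. by rewrite /pospow /heaviside => ->; rewrite mul1r. Qed.

Lemma pospow_le0 p x : x <= 0 -> pospow p x = 0.
Proof. by rewrite /pospow /heaviside leNgt => /negbTE ->; rewrite mul0r. Qed.

Lemma pospowX p (n : nat) x : pospow p x * x ^+ n = pospow (p + n%:R) x.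
Proof.
have [x0|x0] := leP x 0; first by rewrite !pospow_le0// mul0r.
by rewrite !pospow_gt0// powR_natM.
Qed.

(* Integrable at [0] when [-1 < p] and at infinity when [q < -1]. *)
Definition twopow (p q x : R) : R := if x <= 1 then pospow p x else pospow q x.

Lemma twopow_ge0 p q x : 0 <= twopow p q x.
Proof. by rewrite /twopow; case: ifP; rewrite pospow_ge0. Qed.

Lemma integrable_twopow p q : -1 < p -> q < -1 -> leb.-integrable setT (EFin \o twopow p q).
Proof.
move=> p1 q1.
have i1 : leb.-integrable setT (EFin \o (fun x => if x <= 1 then pospow p x else 0)).
  (* The bound is the integral of [x^p] over []0, 1]]; for the other piece, [- (q + 1)^-1] is the
     integral of [x^q] over [[1, +oo[]. *)
  apply: (@ge0_integrable_exhaust _ (fun n => `[n.+1%:R^-1, 1]%classic) (p + 1)^-1).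
  - apply: measurable_fun_if => //=; first by apply: measurable_fun_ler => //; exact: measurable_cst.
    by apply: measurable_funTS; exact: measurable_pospow.
  - by move=> x; case: ifP => // _; exact: pospow_ge0.
  - by move=> n; exact: measurable_itv.
  - move=> n m nm x /=; rewrite !in_itv /= => /andP[nx ->]; rewrite andbT; apply: le_trans nx.
    by rewrite lef_pV2 ?posrE ?ltr0n// ler_nat.
  - move=> x; case: ifP => [x1|_]; last by rewrite eqxx.
    have [x0|x0] := leP x 0; first by rewrite pospow_le0// eqxx.
    move=> _; exists (Num.truncn x^-1); rewrite /= in_itv /= x1 andbT.
    rewrite invf_ple ?posrE ?ltr0n//; apply: ltW; exact: truncnS_gt.
  (* The first interval is the single point 1, while [integral_powR] is about nondegenerate
     intervals. *)
  - move=> n; case: n => [|n].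
      by rewrite invr1 set_itv1 integral_set1 lee_fin invr_ge0; lra.
    have n0 : 0 < n.+2%:R^-1 :> R by rewrite invr_gt0 ltr0n.
    rewrite (_ : (\int[leb]_(x in _) _ = \int[leb]_(x in `[n.+2%:R^-1%R, 1%R]) (x `^ p)%:E)%E); last first.
      apply: eq_integral => x; rewrite inE /= in_itv /= => /andP[nx x1]; rewrite x1 pospow_gt0//.
      exact: lt_le_trans n0 nx.
    rewrite integral_powR//; last 2 first.
    + by rewrite gt_eqF.
    + by rewrite invf_lt1 ?ltr0n// ltr1n.
    rewrite lee_fin powR1 ler_pdivrMr; last by lra.
    by rewrite mulVf; [rewrite lerBlDr lerDl powR_ge0|rewrite gt_eqF//; lra].
have i2 : leb.-integrable setT (EFin \o (fun x => if x <= 1 then 0 else pospow q x)).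
  apply: (@ge0_integrable_exhaust _ (fun n => `[1, n.+1%:R]%classic) (- (q + 1)^-1)).
  - apply: measurable_fun_if => //=; first by apply: measurable_fun_ler => //; exact: measurable_cst.
    by apply: measurable_funTS; exact: measurable_pospow.
  - by move=> x; case: ifP => // _; exact: pospow_ge0.
  - by move=> n; exact: measurable_itv.
  - move=> n m nm x /=; rewrite !in_itv /= => /andP[-> nx] /=; apply: (le_trans nx).
    by rewrite ler_nat.
  - move=> x; case: ifP => [_|/negbT]; first by rewrite eqxx.
    rewrite -ltNge => x1 _; exists (Num.truncn x); rewrite /= in_itv /= (ltW x1) /=.
    by apply: ltW; exact: truncnS_gt.
  - move=> n; case: n => [|n].
      by rewrite set_itv1 integral_set1 lee_fin oppr_ge0 invr_le0; lra.
    apply: (@le_trans _ _ (\int[leb]_(x in `[1%R, n.+2%:R%R]) (x `^ q)%:E)%E).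
      apply: ge0_le_integral => //.
      + by move=> x _; rewrite lee_fin; case: ifP => // _; exact: pospow_ge0.
      + apply/measurable_EFinP/measurable_funTS.
        apply: measurable_fun_if => //=; first by apply: measurable_fun_ler => //; exact: measurable_cst.
        by apply: measurable_funTS; exact: measurable_pospow.
      + by apply/measurable_EFinP/measurable_funTS; exact: measurable_powR.
      + move=> x; rewrite /= in_itv /= => /andP[x1 _]; rewrite lee_fin; case: ifP => _; first exact: powR_ge0.
        by rewrite pospow_gt0// (lt_le_trans ltr01).
    rewrite integral_powR//; last 2 first.
    + by rewrite lt_eqF.
    + by rewrite ltr1n.
    rewrite lee_fin powR1 ler_ndivrMr; last by lra.
    rewrite mulNr mulVf; last by rewrite lt_eqF//; lra.
    by rewrite lerBrDr addNr powR_ge0.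
have := integrableD measurableT i1 i2; apply: eq_integrable => // x _ /=.
by rewrite /twopow -EFinD; case: ifP => _; rewrite ?addr0 ?add0r.
Qed.

(** [expR x] is the [n]-th power of [expR (x / n)], which is at least [x / n]. *)
Lemma expR_geXn (x : R) (n : nat) : 0 <= x -> x ^+ n <= n%:R ^+ n * expR x.
Proof.
move=> x0; case: n => [|n]; first by rewrite !expr0 mul1r -expR0 ler_expR.
have n0 : 0 < n.+1%:R :> R by rewrite ltr0n.
have -> : expR x = expR (x / n.+1%:R) ^+ n.+1 by rewrite -expRM_natl -mulr_natl mulrC divfK ?gt_eqF.
rewrite -exprMn lerXn2r ?nnegrE// ?mulr_ge0 ?expR_ge0//.
rewrite mulrC -ler_pdivrMr//; apply: le_trans (expR_ge1Dx _).
by rewrite lerDr.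
Qed.

Lemma pospow_exp_le (p e : R) : 0 < e ->
  exists2 C : R, 0 <= C & forall y, pospow p y * expR (- (e * y)) <= C * twopow p (-2) y.
Proof.
(* With [N] above [|p| + 2], the exponential beats [y^N] and leaves at most a constant times
   [y^(-2)] for [y > 1]. *)
move=> e0; pose N := (Num.truncn (`|p| + 2)).+1.
exists (1 + N%:R ^+ N * e ^- N) => [|y].
  by rewrite addr_ge0// mulr_ge0 ?exprn_ge0// invr_ge0 exprn_ge0 ?(ltW e0).
have C0 : 0 <= N%:R ^+ N * e ^- N :> R by rewrite mulr_ge0 ?exprn_ge0// invr_ge0 exprn_ge0 ?(ltW e0).
have [y0|y0] := leP y 0.
  by rewrite pospow_le0// mul0r mulr_ge0 ?twopow_ge0// addr_ge0.
rewrite /twopow; case: ifP => [y1|/negbT].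
  rewrite mulrC mulrDl mul1r -[leLHS]addr0 lerD//; last by rewrite mulr_ge0 ?pospow_ge0.
  by rewrite ler_piMl ?pospow_ge0// -expR0 ler_expR oppr_le0 mulr_ge0 ?(ltW e0) ?(ltW y0).
rewrite -ltNge => y1; rewrite mulrDl mul1r -[leLHS]add0r lerD ?pospow_ge0//.
rewrite !pospow_gt0// expRN ler_pdivrMr ?expR_gt0//.
have h := expR_geXn N (mulr_ge0 (ltW e0) (ltW y0)).
have yN : y ^+ N <= N%:R ^+ N * e ^- N * expR (e * y).
  by rewrite mulrAC ler_pdivlMr ?exprn_gt0// mulrC -exprMn.
rewrite mulrAC; apply: le_trans (ler_wpM2r (powR_ge0 y (-2)) yN).
rewrite mulrC powR_natM//; apply: ler_powR; first exact: ltW.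
have : `|p| + 2 < N%:R by exact: truncnS_gt.
by have := ler_norm p; lra.
Qed.

Lemma integrable_pospow_exp (p e : R) : -1 < p -> 0 < e ->
  leb.-integrable setT (EFin \o (fun y => pospow p y * expR (- (e * y)))).
Proof.
move=> p1 e0; have [C C0 HC] := pospow_exp_le p e0.
have m2 : -2 < -1 :> R by lra.
apply: le_integrable (integrable_scale C (integrable_twopow p1 m2)) => //.
  apply/measurable_EFinP; apply: measurable_funM; first exact: measurable_pospow.
  apply: measurableT_comp; first exact: measurable_expR.
  by apply: measurableT_comp => //; exact: measurable_mulr.
move=> y _ /=; rewrite lee_fin ger0_norm; last by apply: mulr_ge0; [exact: pospow_ge0|exact: expR_ge0].
by rewrite ger0_norm//; apply: mulr_ge0 => //; exact: twopow_ge0.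
Qed.

(** For [z = 1] this is the Mellin transform of [phi] at [p + 1]; in general [phi] is sampled along
    the ray through [z]. *)
Definition power_integral (p : R) (phi : R[i] -> R[i]) (z : R[i]) : R[i] :=
  cintegral leb setT (fun y => (pospow p y)%:C * phi (y%:C * z)).

Definition power_integrable (p : R) (phi : R[i] -> R[i]) (z : R[i]) : Prop :=
  cintegrable leb (fun y => (pospow p y)%:C * phi (y%:C * z)).

Lemma power_integral_scale p phi z (r : R) : 0 < r -> power_integrable p phi z ->
  power_integrable p phi (r%:C * z) /\
  power_integral p phi (r%:C * z) = (r `^ (- p - 1))%:C * power_integral p phi z.
Proof.
move=> r0 iz.
have E (y : R) : (pospow p (0 + r * y))%:C * phi ((0 + r * y)%:C * z) =
    (r `^ p)%:C * ((pospow p y)%:C * phi (y%:C * (r%:C * z))).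
  rewrite add0r; have -> : pospow p (r * y) = r `^ p * pospow p y.
    rewrite /pospow /heaviside pmulr_rgt0//; case: ltP => y0; last by rewrite !mul0r mulr0.
    by rewrite !mul1r powRM ?(ltW r0) ?(ltW y0).
  have -> : (r * y)%:C * z = y%:C * (r%:C * z) by rewrite rmorphM; ring.
  by rewrite [in LHS]rmorphM -mulrA.
have rp : (r `^ p)%:C != 0 :> R[i].
  by rewrite eq_complex /= eqxx andbT gt_eqF// powR_gt0.
have i2 := cintegrable_affine 0 r0 iz.
have i3 : power_integrable p phi (r%:C * z).
  have := cintegrableZ ((r `^ p)%:C^-1) i2; congr (cintegrable _ _).
  by apply/funext => y; rewrite E mulrA mulVf// mul1r.
split => //; rewrite /power_integral (cintegral_affine 0 r0 iz) (eq_cintegral leb E) cintegralZ//.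
rewrite !mulrA -!rmorphM; rewrite -[LHS]mul1r; congr (_ * _).
have -> : r `^ (- p - 1) = (r * r `^ p)^-1.
  have -> : - p - 1 = - (1 + p) by ring.
  by rewrite powRN powR_add// powRr1// ltW.
by rewrite -mulrA mulVf ?rmorph1// mulf_neq0 ?gt_eqF// powR_gt0.
Qed.

(** Difference quotients along the steps [1 / (n + 1)], the form in which derivatives meet
    sequential limits. *)
Lemma is_derive_cvg_seq (f : R -> R) (x a : R) : is_derive x 1 f a ->
  (fun n : nat => n.+1%:R * (f (x + n.+1%:R^-1) - f x)) @ \oo --> a.
Proof.
move=> d; have := @ex_derive _ _ _ _ _ _ _ d; rewrite /derivable => cv.
have : h^-1 *: ((f \o shift x) (h *: (1 : R)) - f x) @[h --> 0^'] --> a.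
  by have dv := @derive_val _ _ _ _ _ _ _ d; rewrite -[X in _ --> X]dv; exact: cv.
move=> /cvgr_dnbhsP /(_ (fun n : nat => n.+1%:R^-1)) h.
have {}h : (n.+1%:R^-1)^-1 *: ((f \o shift x) (n.+1%:R^-1 *: (1 : R)) - f x) @[n --> \oo] --> a.
  by apply: h; split; [move=> n; rewrite invr_eq0 pnatr_eq0|exact: cvg_harmonic].
apply: cvg_trans h; apply: near_eq_cvg; near=> n.
by rewrite invrK /GRing.scale /= mulr1 [_ + x]addrC.
Unshelve. all: by end_near. Qed.

Lemma cvg_powR_derive1 (s : R) :
  (fun n : nat => n.+1%:R * ((1 + n.+1%:R^-1) `^ s - 1)) @ \oo --> s.
Proof.
have := is_derive_cvg_seq (is_derive1_powR s (ltr01 : 0 < (1 : R))).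
by rewrite powR1 mulr1.
Qed.

(* [F0] and [D] are the values at one point of a function homogeneous of degree
   [s] and of its radial derivative. *)
Lemma euler_homogeneous (F0 D : R[i]) (s C : R) :
  (forall h : R, 0 < h <= 1 -> modulus (((1 + h) `^ s)%:C * F0 - F0 - h%:C * D) <= C * h ^+ 2) ->
  D = s%:C * F0.
Proof.
move=> H.
have c1 : ccvg (fun n : nat => (n.+1%:R * ((1 + n.+1%:R^-1) `^ s - 1))%:C * F0) (s%:C * F0).
  by apply: ccvgM (ccvg_cst _); apply: ccvgR; exact: cvg_powR_derive1.
suff c2 : ccvg (fun n : nat => (n.+1%:R * ((1 + n.+1%:R^-1) `^ s - 1))%:C * F0) D.
  exact: ccvg_unique c2 c1.
apply: (@ccvg_le _ _ _ (fun n : nat => C * n.+1%:R^-1)) => [n|]; last first.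
  by rewrite -(mulr0 C); apply: cvgM; [exact: cvg_cst|exact: cvg_harmonic].
have n0 : 0 < n.+1%:R^-1 :> R by rewrite invr_gt0 ltr0n.
have := H n.+1%:R^-1; rewrite n0 invf_le1 ?ltr0n// ler1n => /(_ isT).
set h : R := n.+1%:R^-1 in n0 *; have -> : n.+1%:R = h^-1 :> R by rewrite invrK.
move=> le; have -> : (h^-1 * ((1 + h) `^ s - 1))%:C * F0 - D =
    (h^-1)%:C * (((1 + h) `^ s)%:C * F0 - F0 - h%:C * D).
  rewrite [in RHS]mulrBr [(h^-1)%:C * (h%:C * D)]mulrA -[(h^-1)%:C * h%:C]rmorphM mulVf ?gt_eqF//.
  by rewrite rmorphM rmorphB; ring.
rewrite modulusM modulusR gtr0_norm ?invr_gt0// ler_pdivrMl//.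
by rewrite [leRHS]mulrCA -expr2.
Qed.

(* Differentiating the scaling relation of [power_integral_scale] at scale 1
   replaces an integration by parts on the half line. *)
Lemma power_integral_euler (p : R) (phi delta : R[i] -> R[i]) (z : R[i]) :
  (forall (w : R[i]) (h : R), phi ((1 + h)%:C * w) - phi w - h%:C * delta w =
     cexp (- w) * (cexp (- (h%:C * w)) - 1 - - (h%:C * w))) ->
  -3 < p -> 0 < complex.Re z -> power_integrable p phi z -> power_integrable p delta z ->
  power_integral p delta z = (- p - 1)%:C * power_integral p phi z.
Proof.
move=> H p3 z0 i1 i2.
(* By [H] the remainder is a damping factor times the second-order remainder of the exponential; its
   bound brings in [y^2], and [y^(p + 2)] is integrable at 0 because [-3 < p]. *)
pose B y := (4 * modulus z ^+ 2) * (pospow (p + 2) y * expR (- (complex.Re z * y))).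
have iB : leb.-integrable setT (EFin \o B).
  by apply: integrable_scale; apply: integrable_pospow_exp => //; lra.
apply: (@euler_homogeneous _ _ _ (2 * Rintegral leb setT B)) => h /andP[h0 h1].
have h10 : 0 < 1 + h by rewrite addr_gt0.
have [i3 <-] := power_integral_scale h10 i1.
rewrite /power_integral -cintegralZ// -cintegralB// -cintegralB//; first last.
- exact: cintegrableZ.
- exact: cintegrableB.
have -> : 2 * Rintegral leb setT B * h ^+ 2 = 2 * Rintegral leb setT (fun x => h ^+ 2 * B x).
  by rewrite RintegralZl// -mulrA [_ * h ^+ 2]mulrC.
apply: modulus_cintegral.
- apply: (@cintegrable_measurable _ _ _ leb); apply: cintegrableB; last exact: cintegrableZ.
  exact: cintegrableB.
- exact: integrable_scale.
move=> y.
have -> : (pospow p y)%:C * phi (y%:C * ((1 + h)%:C * z)) - (pospow p y)%:C * phi (y%:C * z) -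
    h%:C * ((pospow p y)%:C * delta (y%:C * z)) =
  (pospow p y)%:C * (phi ((1 + h)%:C * (y%:C * z)) - phi (y%:C * z) - h%:C * delta (y%:C * z)).
  by rewrite [y%:C * (_ * z)]mulrCA; ring.
rewrite H (modulusM (pospow p y)%:C) (modulusM (cexp _)) modulusR (ger0_norm (pospow_ge0 _ _)) /B.
have [y0|y0] := leP y 0; first by rewrite !pospow_le0// !mul0r !mulr0.
rewrite modulus_cexp -(pospowX p 2).
have -> : complex.Re (- (y%:C * z)) = - (complex.Re z * y).
  by case: z {z0 i1 i2 i3 B iB} => a b /=; ring.
have le : complex.Re (- (h%:C * (y%:C * z))) <= 0.
  have -> : complex.Re (- (h%:C * (y%:C * z))) = - (h * y * complex.Re z).
    by case: z {z0 i1 i2 i3 B iB} => a b /=; ring.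
  by rewrite oppr_le0 !mulr_ge0 ?(ltW h0) ?(ltW y0) ?(ltW z0).
have := modulus_cexpB1B le.
rewrite [modulus (- (h%:C * _))]modulusN !modulusM !modulusR (gtr0_norm h0) (gtr0_norm y0).
set E := expR _; set X := modulus _ => HX.
have -> : h ^+ 2 * (4 * modulus z ^+ 2 * (pospow p y * y ^+ 2 * E)) =
    pospow p y * (E * (4 * (h * (y * modulus z)) ^+ 2)) by ring.
by rewrite ler_wpM2l ?pospow_ge0// ler_wpM2l ?expR_ge0.
Qed.

End Powers.

(** * Gamma integrals along rays *)

Section GammaIntegrals.
Context {R : realType}.
Notation leb := (@lebesgue_measure R).
Implicit Types (z w : R[i]) (p : R).

(** [exp_tail] with index [k] is [e^{-w}] minus the terms of degree below [k] of its Taylor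
    expansion, which makes lower powers of [y] integrable at 0. The primed functions are radial
    derivatives [w d/dw]: [exp_tail0'] of both [exp_tail0] and [exp_tail1], and [exp_tail2'] of
    [exp_tail2]. *)
Definition exp_tail0 w : R[i] := cexp (- w).
Definition exp_tail1 w : R[i] := cexp (- w) - 1.
Definition exp_tail2 w : R[i] := cexp (- w) - 1 + w.
Definition exp_tail0' w : R[i] := - w * cexp (- w).
Definition exp_tail2' w : R[i] := - w * (cexp (- w) - 1).

Lemma cmeasurable_power (phi : R[i] -> R[i]) p z :
  cmeasurable (fun y : R => phi (y%:C * z)) ->
  cmeasurable (fun y : R => (pospow p y)%:C * phi (y%:C * z)).
Proof. by move=> mphi; apply: cmeasurableM => //; apply: cmeasurableR; exact: measurable_pospow. Qed.

Lemma cmeasurable_linear z : cmeasurable (fun y : R => y%:C * z).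
Proof. by apply: cmeasurableM; [exact: cmeasurableR|exact: cmeasurable_cst]. Qed.

Lemma cmeasurable_exp_linear z : cmeasurable (fun y : R => cexp (- (y%:C * z))).
Proof. by apply: cmeasurable_cexp; apply: cmeasurableN; exact: cmeasurable_linear. Qed.

Lemma Re_opp_scale (y : R) z : complex.Re (- (y%:C * z)) = - (complex.Re z * y).
Proof. by case: z => a b /=; ring. Qed.

Lemma power_integrable0 p z : -1 < p -> 0 < complex.Re z -> power_integrable p exp_tail0 z.
Proof.
move=> p1 z0; apply: (@cintegrable_le _ _ _ leb _ _ _ (integrable_pospow_exp p1 z0)).
  by apply: cmeasurable_power; exact: cmeasurable_exp_linear.
by move=> y; rewrite modulusM modulusR ger0_norm ?pospow_ge0// modulus_cexp Re_opp_scale.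
Qed.

Lemma pospow_mulC p (y : R) z : (pospow p y)%:C * (- (y%:C * z)) = (- z) * (pospow (p + 1) y)%:C.
Proof.
have -> : pospow (p + 1) y = pospow p y * y by rewrite -[X in _ = _ * X]expr1 pospowX.
by rewrite [(_ * y)%:C]rmorphM; ring.
Qed.

Lemma power_integrable0' p z : -2 < p -> 0 < complex.Re z -> power_integrable p exp_tail0' z.
Proof.
move=> p1 z0; have p2 : -1 < p + 1 by lra.
have := cintegrableZ (- z) (power_integrable0 p2 z0); congr (cintegrable _ _).
by apply/funext => y; rewrite mulrA -pospow_mulC -mulrA.
Qed.

Lemma power_integral0' p z : -2 < p -> 0 < complex.Re z ->
  power_integral p exp_tail0' z = - z * power_integral (p + 1) exp_tail0 z.
Proof.
move=> p1 z0; have p2 : -1 < p + 1 by lra.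
rewrite /power_integral -cintegralZ; last exact: power_integrable0.
by apply: eq_cintegral => y; rewrite [RHS]mulrA -pospow_mulC -mulrA.
Qed.

(** The functional equation of Gamma on a ray, obtained from Euler's identity. *)
Lemma power_integral0S p z : -1 < p -> 0 < complex.Re z ->
  z * power_integral (p + 1) exp_tail0 z = (p + 1)%:C * power_integral p exp_tail0 z.
Proof.
move=> p1 z0; have p2 : -2 < p by lra.
have := @power_integral_euler _ p exp_tail0 exp_tail0' z _ _ z0 (power_integrable0 p1 z0) (power_integrable0' p2 z0).
rewrite (power_integral0' p2 z0) => H.
rewrite -[LHS]opprK -mulNr H.
- by rewrite -mulNr -rmorphN; congr (_%:C * _); ring.
- move=> w h; rewrite /exp_tail0 /exp_tail0'.
  have -> : - ((1 + h)%:C * w) = - w + - (h%:C * w) by rewrite rmorphD rmorph1; ring.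
  by rewrite cexpD; ring.
- by lra.
Qed.

Lemma exp_tail0_real (y : R) : exp_tail0 (y%:C * 1) = (expR (- y))%:C.
Proof. by rewrite /exp_tail0 mulr1 /cexp /= oppr0 expi0 mulr1. Qed.

Lemma Gamma_integralE (a : R) : (Gamma_integral a)%:C = power_integral (a - 1) exp_tail0 1.
Proof.
transitivity (cintegral leb setT (fun y => (pospow (a - 1) y * expR (- y))%:C)).
  rewrite cintegralR /Gamma_integral Rintegral_mkcond; congr (_%:C).
  apply: eq_Rintegral => y _; rewrite patchE mem_setE in_itv /= andbT.
  by case: ltP => y0; [rewrite pospow_gt0|rewrite pospow_le0// mul0r].
by apply: eq_cintegral => y; rewrite exp_tail0_real -rmorphM.
Qed.

Lemma Gamma_integral_gt0 (a : R) : 0 < a -> 0 < Gamma_integral a.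
Proof.
move=> a0; have p1 : -1 < a - 1 by lra.
pose f y := pospow (a - 1) y * expR (- (1 * y)).
have fi : leb.-integrable setT (EFin \o f) by exact: integrable_pospow_exp.
have -> : Gamma_integral a = Rintegral leb setT f.
  rewrite /Gamma_integral Rintegral_mkcond; apply: eq_Rintegral => y _; rewrite patchE mem_setE in_itv /= andbT /f mul1r.
  by case: ltP => y0; [rewrite pospow_gt0|rewrite pospow_le0// mul0r].
(* A lower bound of the integrand on [[1, 2]]: the power is monotone in one direction or the other,
   so its minimum is at an endpoint. *)
pose c : R := Num.min 1 (2 `^ (a - 1)) * expR (- 2).
have c0 : 0 < c by rewrite mulr_gt0 ?expR_gt0// lt_min ltr01 powR_gt0.
pose A : set R := `[1%R, 2%R]%classic.
have mA : measurable A by exact: measurable_itv.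
have Afin : (leb A = 1%:E)%E.
  by rewrite /A lebesgue_measure_itv /= lte_fin ltr1n -EFinB; congr (_%:E); ring.
have Aint : (\int[leb]_x (\1_A x)%:E = 1%:E)%E by rewrite integral_indic// setIT; exact: Afin.
have iA : leb.-integrable setT (EFin \o (fun x => c * \1_A x)).
  apply: integrable_scale; apply/integrableP; split; first by apply/measurable_EFinP; exact: measurable_indic.
  under eq_integral do rewrite /= ger0_norm//.
  by apply: (le_lt_trans _ (ltry 1)); rewrite le_eqVlt; apply/orP; left; apply/eqP; exact: Aint.
have -> : 0 < Rintegral leb setT f = true; last by [].
apply: lt_le_trans (_ : Rintegral leb setT (fun x => c * \1_A x) <= _).
  rewrite /Rintegral.
  have -> : (\int[leb]_x (c * \1_A x)%:E = c%:E)%E.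
    under eq_integral do rewrite EFinM.
    by rewrite ge0_integralZl//; [rewrite Aint mule1|apply/measurable_EFinP; exact: measurable_indic|rewrite lee_fin ltW].
  by [].
apply: le_Rintegral => // x _; rewrite indicE /A mem_setE in_itv /=.
have [/andP[x1 x2]|_] := boolP (1 <= x <= 2); last first.
  by rewrite mulr0 mulr_ge0 ?pospow_ge0 ?expR_ge0.
rewrite mulr1 /f mul1r pospow_gt0; last by rewrite (lt_le_trans ltr01).
apply: ler_pM; rewrite ?expR_ge0 ?le_min ?ler01 ?powR_ge0 ?ler_expR ?lerN2//.
rewrite ge_min; have [a1|a1] := leP 0 (a - 1).
  by apply/orP; left; have := ler_powR x1 a1; rewrite powRr0.
apply/orP; right; rewrite -[a - 1]opprK !(powRN _ (- (a - 1))).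
rewrite lef_pV2 ?posrE ?powR_gt0//; last by rewrite (lt_le_trans ltr01).
apply: ge0_ler_powR; rewrite ?nnegrE//; [by rewrite oppr_ge0 ltW|by rewrite (le_trans ler01)].
Qed.

(** The point [1 - i v]. With this sign [e^{- y (1 - i v)}] is [e^{-y} e^{ivy}], so integrals along
    rays are Fourier transforms in [v] of gamma densities and can be differentiated as such. *)
Definition ray (v : R) : R[i] := 1 +i* (- v).

(* The principal branch of [ray v] to the power [a]. *)
Definition raypow (a v : R) : R[i] := ((1 + v ^+ 2) `^ (a / 2))%:C * expi (- (a * atan v)).

Lemma one_sqr_gt0 (v : R) : 0 < 1 + v ^+ 2.
Proof. by rewrite ltr_wpDr ?sqr_ge0. Qed.

Lemma raypowD a b v : raypow (a + b) v = raypow a v * raypow b v.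
Proof.
rewrite /raypow mulrDl powR_add ?one_sqr_gt0// rmorphM mulrDl opprD expiD; ring.
Qed.

Lemma raypow0 v : raypow 0 v = 1.
Proof. by rewrite /raypow mul0r powRr0 mul0r oppr0 expi0 mulr1. Qed.

Lemma raypow_0 a : raypow a 0 = 1.
Proof. by rewrite /raypow expr0n addr0 powR1 atan0 mulr0 oppr0 expi0 mulr1. Qed.

Lemma is_cderive_raypow a v :
  is_cderive (raypow a) v ((a * v / (1 + v ^+ 2) +i* (- (a / (1 + v ^+ 2)))) * raypow a v).
Proof.
have v0 := one_sqr_gt0 v; have v0' : 1 + v ^+ 2 != 0 by rewrite gt_eqF.
have dv : is_derive v 1 (fun v : R => 1 + v ^+ 2) (2 * v).
  apply: (@is_derive_quadratic _ _ _ _ 1) => h _.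
  rewrite (_ : _ - _ = h ^+ 2); last by ring.
  by rewrite ger0_norm ?sqr_ge0 ?mul1r.
have d1 := is_cderiveR (@is_derive1_comp R (fun x => x `^ (a / 2)) (fun v => 1 + v ^+ 2) v _ _ (is_derive1_powR (a / 2) v0) dv).
have d2 : is_derive v 1 (fun v : R => - (a * atan v)) (- (a / (1 + v ^+ 2))).
  apply: is_derive_eq1 (is_deriveN (is_deriveM (is_derive_cst a v 1) (is_derive1_atan v))) _.
  by rewrite scaler0 addr0.
apply: is_cderive_eq (is_cderiveM d1 (is_cderive_expi d2)) _.
have e : (1 + v ^+ 2) `^ (a / 2 - 1) = (1 + v ^+ 2) `^ (a / 2) / (1 + v ^+ 2).
  by rewrite powR_add// powR_inv1// ltW.
rewrite /= e /raypow; set P := (1 + v ^+ 2) `^ (a / 2); set E := expi _.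
by apply/eqP; rewrite eq_complex /=; apply/andP; split; apply/eqP; field.
Qed.

(** The left factor in the derivative of [raypow a] is [- i a / (1 - i v)] in Cartesian form, the
    logarithmic derivative of [(1 - i v)^a]. *)
Lemma ray_log a v : ray v * (a * v / (1 + v ^+ 2) +i* (- (a / (1 + v ^+ 2)))) = - ('i * a%:C).
Proof.
have v0 : 1 + v ^+ 2 != 0 by rewrite gt_eqF// one_sqr_gt0.
by apply/eqP; rewrite eq_complex /=; apply/andP; split; apply/eqP; field.
Qed.

Lemma is_cderive_ray v : is_cderive ray v (- 'i).
Proof.
split; rewrite /rpart /ipart /ray /=; first by rewrite oppr0; exact: is_derive_cst.
exact: is_deriveNid.
Qed.

(** [ray v * raypow (-1) v] has derivative 0 and equals 1 at [v = 0]. *)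
Lemma raypow1 v : raypow 1 v = ray v.
Proof.
have h : ray v * raypow (-1) v = 1.
  rewrite -[RHS](_ : ray 0 * raypow (-1) 0 = 1); last first.
    by rewrite raypow_0 mulr1 /ray oppr0.
  apply: (@is_cderive0_cst _ (fun v => ray v * raypow (-1) v)) => x.
  apply: is_cderive_eq (is_cderiveM (is_cderive_ray x) (is_cderive_raypow (-1) x)) _.
  by rewrite mulrA ray_log rmorphN rmorph1; ring.
by rewrite -[LHS]mul1r -h -mulrA -raypowD addrC subrr raypow0 mulr1.
Qed.

Lemma ray_neq0 v : ray v != 0.
Proof. by rewrite eq_complex /= oner_eq0. Qed.

Lemma ray_Re v : 0 < complex.Re (ray v).
Proof. exact: ltr01. Qed.

Lemma fourier_gamma_density p v :
  fourier (fun y => (pospow p y * expR (- y))%:C) v = power_integral p exp_tail0 (ray v).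
Proof.
apply: eq_cintegral => y; rewrite /exp_tail0 rmorphM -mulrA /cexp /=.
congr (_ * ((expR _)%:C * expi _)); ring.
Qed.

Lemma cintegrable_gamma_density p : -1 < p ->
  cintegrable leb (fun y : R => (pospow p y * expR (- y))%:C).
Proof.
move=> p1; have := power_integrable0 p1 (ltr01 : 0 < complex.Re (1 : R[i])).
congr (cintegrable _ _); apply/funext => y.
by rewrite exp_tail0_real -rmorphM.
Qed.

Lemma is_cderive_power_integral0 p v : -1 < p ->
  is_cderive (fun v => power_integral p exp_tail0 (ray v)) v
    ('i * power_integral (p + 1) exp_tail0 (ray v)).
Proof.
move=> p1.
have E q (y : R) : y%:C * (pospow q y * expR (- y))%:C = (pospow (q + 1) y * expR (- y))%:C.
  by rewrite -(pospowX q 1) expr1 -rmorphM; congr (_%:C); ring.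
have p2 : -1 < p + 1 by lra.
have p3 : -1 < p + 1 + 1 by lra.
have i1 := cintegrable_gamma_density p1.
have i2 : cintegrable leb (fun y : R => y%:C * (pospow p y * expR (- y))%:C).
  by have := cintegrable_gamma_density p2; congr (cintegrable _ _); apply/funext => y; rewrite E.
have i3 : cintegrable leb (fun y : R => y%:C * (y%:C * (pospow p y * expR (- y))%:C)).
  by have := cintegrable_gamma_density p3; congr (cintegrable _ _); apply/funext => y; rewrite !E.
have := fourier_is_cderive v i1 i2 i3.
have -> : fourier (fun y => (pospow p y * expR (- y))%:C) = (fun v => power_integral p exp_tail0 (ray v)).
  by apply/funext => x; exact: fourier_gamma_density.
move=> /is_cderive_eq; apply; rewrite (fourierZ _ _ i2); congr (_ * _).
rewrite -fourier_gamma_density; apply: eq_cintegral => y; by rewrite E.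
Qed.

(* Both sides solve the same first order linear equation in [v]. *)
Lemma power_integral0_ray (a v : R) : 0 < a ->
  power_integral (a - 1) exp_tail0 (ray v) = (Gamma_integral a)%:C * raypow (- a) v.
Proof.
move=> a0; have p1 : -1 < a - 1 by lra.
have h : power_integral (a - 1) exp_tail0 (ray v) * raypow a v = (Gamma_integral a)%:C.
  have -> : (Gamma_integral a)%:C = power_integral (a - 1) exp_tail0 (ray 0) * raypow a 0.
    by rewrite raypow_0 mulr1 Gamma_integralE /ray oppr0.
  apply: (@is_cderive0_cst _ (fun v => power_integral (a - 1) exp_tail0 (ray v) * raypow a v)) => x.
  apply: is_cderive_eq (is_cderiveM (is_cderive_power_integral0 x p1) (is_cderive_raypow a x)) _.
  have := @power_integral0S (a - 1) (ray x) p1 ltr01; rewrite subrK => e.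
  apply: (mulfI (ray_neq0 x)); rewrite mulr0 mulrDr.
  have -> : ray x * ('i * power_integral a exp_tail0 (ray x) * raypow a x) =
    'i * raypow a x * (ray x * power_integral a exp_tail0 (ray x)) by ring.
  rewrite e; set Q := (_ +i* _); set I := power_integral _ _ _.
  have -> : ray x * (I * (Q * raypow a x)) = I * raypow a x * (ray x * Q) by ring.
  by rewrite ray_log; ring.
by rewrite -h -mulrA -raypowD subrr raypow0 mulr1.
Qed.

Lemma modulus_exp_tail1 w : 0 <= complex.Re w -> modulus (exp_tail1 w) <= 2 /\
  modulus (exp_tail1 w) <= 2 * modulus w.
Proof.
move=> w0; have w0' : complex.Re (- w) <= 0 by case: w w0 => a b /=; rewrite oppr_le0.
split; last by rewrite -(modulusN w); exact: modulus_cexpB1.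
apply: le_trans (modulusB _ _) _; rewrite (modulusR 1) normr1.
by have := modulus_cexp_le1 w0'; lra.
Qed.

Lemma modulus_exp_tail2 w : 0 <= complex.Re w -> modulus (exp_tail2 w) <= 2 + modulus w /\
  modulus (exp_tail2 w) <= 4 * modulus w ^+ 2.
Proof.
move=> w0; have w0' : complex.Re (- w) <= 0 by case: w w0 => a b /=; rewrite oppr_le0.
split.
  by apply: le_trans (modulusD _ _) _; rewrite lerD2r; case: (modulus_exp_tail1 w0).
by rewrite -(modulusN w) /exp_tail2 -[X in _ + X]opprK; exact: modulus_cexpB1B.
Qed.

(** At [w = - i u y] this is the jump integrand: [e^{iuy} - 1] for [alpha < 1], and
    [e^{iuy} - 1 - i u y] otherwise. *)
Definition stable_tail (alpha : R) : R[i] -> R[i] := if alpha < 1 then exp_tail1 else exp_tail2.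

(** The weight [y^(- alpha - 1)] times the growth of the tail below and above 1: [y] and a constant
    for [alpha < 1], [y^2] and [y] otherwise. *)
Definition stable_dominator (alpha : R) : R -> R :=
  if alpha < 1 then twopow (- alpha) (- alpha - 1) else twopow (1 - alpha) (- alpha).

Lemma integrable_stable_dominator (alpha : R) : 0 < alpha < 2 -> alpha != 1 ->
  leb.-integrable setT (EFin \o stable_dominator alpha).
Proof.
move=> /andP[a0 a2] a1; rewrite /stable_dominator; case: ltP => a1'.
  by apply: integrable_twopow; lra.
have {a1'}a1 : 1 < alpha by rewrite lt_neqAle eq_sym a1.
by apply: integrable_twopow; lra.
Qed.

(** The constant covers the bounds [2 y M], [2], [4 (y M)^2] and [2 + y M] of the different regimes
    at once. As it depends on [z] only through [M], it serves a whole sequence approaching the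
    imaginary axis. *)
Lemma stable_tail_le (alpha M y : R) z : 0 <= complex.Re z -> modulus z <= M ->
  modulus ((pospow (- alpha - 1) y)%:C * stable_tail alpha (y%:C * z)) <=
  4 * (1 + M) ^+ 2 * stable_dominator alpha y.
Proof.
move=> z0 zM; have M0 : 0 <= M := le_trans (modulus_ge0 z) zM.
have C0 : 0 <= 4 * (1 + M) ^+ 2 by rewrite mulr_ge0 ?sqr_ge0.
have D0 : 0 <= stable_dominator alpha y.
  by rewrite /stable_dominator; case: ifP => _; exact: twopow_ge0.
rewrite modulusM modulusR (ger0_norm (pospow_ge0 _ _)).
have [y0|y0] := leP y 0; first by rewrite pospow_le0// mul0r mulr_ge0.
have w0 : 0 <= complex.Re (y%:C * z) by rewrite Re_scale mulr_ge0 ?(ltW y0).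
have my : modulus (y%:C * z) <= y * M by rewrite modulusM modulusR gtr0_norm// ler_pM2l.
have my0 := modulus_ge0 (y%:C * z).
have p0 := pospow_ge0 (- alpha - 1) y.
have e1 : pospow (- alpha) y = pospow (- alpha - 1) y * y.
  by rewrite -[X in _ * X]expr1 pospowX subrK.
have e2 : pospow (1 - alpha) y = pospow (- alpha - 1) y * y ^+ 2.
  by rewrite pospowX; congr pospow; ring.
rewrite /stable_tail /stable_dominator; case: ifP => _; rewrite /twopow.
  have [h1 h2] := modulus_exp_tail1 w0; case: ifP => [y1|_].
    rewrite e1 mulrCA ler_wpM2l//; apply: le_trans h2 _; nra.
  rewrite mulrC ler_wpM2r//; apply: le_trans h1 _; nra.
have [h1 h2] := modulus_exp_tail2 w0; case: ifP => [y1|/negbT].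
  rewrite e2 mulrCA ler_wpM2l//; apply: le_trans h2 _.
  apply: (@le_trans _ _ (4 * (y * M) ^+ 2)); first by rewrite ler_wpM2l// lerXn2r ?nnegrE// mulr_ge0 ?(ltW y0).
  have hM : M ^+ 2 <= (1 + M) ^+ 2 by nra.
  by have := ler_wpM2l (sqr_ge0 y) hM; rewrite exprMn; nra.
rewrite -ltNge => y1; rewrite e1 mulrCA ler_wpM2l//; apply: le_trans h1 _.
have : y * M <= y * (4 * (1 + M) ^+ 2 - 2) by rewrite ler_wpM2l ?(ltW y0)//; nra.
nra.
Qed.

Lemma cmeasurable_stable_tail (alpha : R) z :
  cmeasurable (fun y : R => stable_tail alpha (y%:C * z)).
Proof.
have m1 : cmeasurable (fun y : R => exp_tail1 (y%:C * z)).
  by apply: cmeasurableB; [exact: cmeasurable_exp_linear|exact: cmeasurable_cst].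
rewrite /stable_tail; case: ifP => _ //.
by apply: cmeasurableD => //; exact: cmeasurable_linear.
Qed.

Lemma power_integrable_stable (alpha : R) z : 0 < alpha < 2 -> alpha != 1 ->
  0 <= complex.Re z -> power_integrable (- alpha - 1) (stable_tail alpha) z.
Proof.
move=> a02 a1 z0.
apply: (@cintegrable_le _ _ _ leb _ _ _ (integrable_scale _ (integrable_stable_dominator a02 a1))).
  by apply: cmeasurable_power; exact: cmeasurable_stable_tail.
by move=> y; exact: stable_tail_le (lexx _).
Qed.

Lemma power_integral_mul (p : R) (phi psi : R[i] -> R[i]) z :
  (forall w, psi w = - w * phi w) -> power_integrable (p + 1) phi z ->
  power_integrable p psi z /\ power_integral p psi z = - z * power_integral (p + 1) phi z.
Proof.
move=> H i1.
have E (y : R) : (pospow p y)%:C * psi (y%:C * z) = - z * ((pospow (p + 1) y)%:C * phi (y%:C * z)).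
  by rewrite H [RHS]mulrA -pospow_mulC -mulrA.
split; first by have := cintegrableZ (- z) i1; congr (cintegrable _ _); apply/funext => y; rewrite E.
by rewrite /power_integral -cintegralZ//; apply: eq_cintegral => y; rewrite E.
Qed.

Lemma exp_split w (h : R) : cexp (- ((1 + h)%:C * w)) = cexp (- w) * cexp (- (h%:C * w)).
Proof. by rewrite -cexpD; congr cexp; rewrite rmorphD rmorph1; ring. Qed.

(** Euler's identity, with factor [alpha], trades the tail for [- w e^{-w}]; the extra power of [y]
    makes that a convergent Gamma integral at [1 - alpha]. *)
Lemma stable_tail1_ray (alpha v : R) : 0 < alpha < 1 ->
  power_integral (- alpha - 1) exp_tail1 (ray v) =
  (- (Gamma_integral (1 - alpha) / alpha))%:C * raypow alpha v.
Proof.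
move=> /andP[a0 a1]; have p1 : -1 < - alpha by lra.
have a02 : 0 < alpha < 2 by lra.
have an1 : alpha != 1 by rewrite lt_eqF.
have i1 : power_integrable (- alpha - 1) exp_tail1 (ray v).
  by have := @power_integrable_stable alpha (ray v) a02 an1 ler01; rewrite /stable_tail a1.
have i0 : power_integrable (- alpha - 1 + 1) exp_tail0 (ray v).
  by rewrite subrK; exact: power_integrable0.
have [i2 e2] := power_integral_mul (phi := exp_tail0) (psi := exp_tail0') (fun w => erefl _) i0.
have p3 : -3 < - alpha - 1 by lra.
have H (w : R[i]) (h : R) : exp_tail1 ((1 + h)%:C * w) - exp_tail1 w - h%:C * exp_tail0' w =
    cexp (- w) * (cexp (- (h%:C * w)) - 1 - - (h%:C * w)).
  by rewrite /exp_tail1 /exp_tail0' exp_split; ring.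
have := power_integral_euler H p3 (ray_Re v) i1 i2; rewrite e2 subrK.
have a1' : 0 < 1 - alpha by lra.
have := power_integral0_ray v a1'.
have -> : 1 - alpha - 1 = - alpha by ring.
move=> ->; have -> : - (- alpha - 1) - 1 = alpha by ring.
have ac0 : alpha%:C != 0 :> R[i] by rewrite eq_complex /= eqxx andbT gt_eqF.
move=> e; apply: (mulfI ac0); rewrite -e -raypow1 opprB.
have -> : raypow alpha v = raypow 1 v * raypow (alpha - 1) v by rewrite -raypowD; congr raypow; ring.
have c : alpha%:C * (- (Gamma_integral (1 - alpha) / alpha))%:C = - (Gamma_integral (1 - alpha))%:C.
  by rewrite -rmorphM -rmorphN; congr (_%:C); field; rewrite gt_eqF.
by rewrite [RHS]mulrA c; ring.
Qed.

(** The same identity lowers the index to [alpha - 1], which lies in []0, 1[]. *)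
Lemma stable_tail2_ray (alpha v : R) : 1 < alpha < 2 ->
  power_integral (- alpha - 1) exp_tail2 (ray v) =
  (Gamma_integral (2 - alpha) / (alpha * (alpha - 1)))%:C * raypow alpha v.
Proof.
move=> /andP[a1 a2].
have a02 : 0 < alpha < 2 by lra.
have an1 : alpha != 1 by rewrite gt_eqF.
have i1 : power_integrable (- alpha - 1) exp_tail2 (ray v).
  by have := @power_integrable_stable alpha (ray v) a02 an1 ler01; rewrite /stable_tail ltNge (ltW a1).
have b02 : 0 < alpha - 1 < 2 by lra.
have b01 : 0 < alpha - 1 < 1 by lra.
have bn1 : alpha - 1 != 1 by rewrite lt_eqF//; lra.
have i0 : power_integrable (- alpha - 1 + 1) exp_tail1 (ray v).
  have := @power_integrable_stable (alpha - 1) (ray v) b02 bn1 ler01; rewrite /stable_tail.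
  have -> : alpha - 1 < 1 by lra.
  by have -> : - (alpha - 1) - 1 = - alpha - 1 + 1 by ring.
have [i2 e2] := power_integral_mul (phi := exp_tail1) (psi := exp_tail2') (fun w => erefl _) i0.
have p3 : -3 < - alpha - 1 by lra.
have H (w : R[i]) (h : R) : exp_tail2 ((1 + h)%:C * w) - exp_tail2 w - h%:C * exp_tail2' w =
    cexp (- w) * (cexp (- (h%:C * w)) - 1 - - (h%:C * w)).
  by rewrite /exp_tail2 /exp_tail2' exp_split rmorphD rmorph1; ring.
have := power_integral_euler H p3 (ray_Re v) i1 i2; rewrite e2.
have := stable_tail1_ray v b01.
have -> : - (alpha - 1) - 1 = - alpha - 1 + 1 by ring.
have -> : 1 - (alpha - 1) = 2 - alpha by ring.
move=> ->; have -> : - (- alpha - 1) - 1 = alpha by ring.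
have ac0 : alpha%:C != 0 :> R[i] by rewrite eq_complex /= eqxx andbT gt_eqF// (lt_trans ltr01).
move=> e; apply: (mulfI ac0); rewrite -e -raypow1.
have -> : raypow alpha v = raypow 1 v * raypow (alpha - 1) v by rewrite -raypowD; congr raypow; ring.
have c : alpha%:C * (Gamma_integral (2 - alpha) / (alpha * (alpha - 1)))%:C =
    (Gamma_integral (2 - alpha) / (alpha - 1))%:C.
  rewrite -rmorphM; congr (_%:C); field.
  by apply/andP; split; rewrite gt_eqF//; lra.
by rewrite [RHS]mulrA c rmorphN; ring.
Qed.

Lemma Gamma_gt0E (a : R) : 0 < a -> Gamma a = Gamma_integral a.
Proof. by move=> a0; rewrite /Gamma a0 big_ord0 divr1 addr0. Qed.

Lemma Gamma_neg01 (alpha : R) : 0 < alpha < 1 ->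
  Gamma (- alpha) = - (Gamma_integral (1 - alpha) / alpha).
Proof.
move=> /andP[a0 a1]; rewrite /Gamma ltNge oppr_le0 (ltW a0) /= normrN (gtr0_norm a0).
have -> : Num.truncn alpha = 0%N by apply: truncn_def; rewrite (ltW a0).
by rewrite big_ord_recl big_ord0 mulr1 addr0 addrC invrN mulrN.
Qed.

Lemma Gamma_neg12 (alpha : R) : 1 < alpha < 2 ->
  Gamma (- alpha) = Gamma_integral (2 - alpha) / (alpha * (alpha - 1)).
Proof.
move=> /andP[a1 a2]; have a0 : 0 < alpha by lra.
rewrite /Gamma ltNge oppr_le0 (ltW a0) /= normrN (gtr0_norm a0).
have -> : Num.truncn alpha = 1%N by apply: truncn_def; rewrite (ltW a1).
rewrite !big_ord_recl big_ord0 mulr1 /= addr0 addrC; congr (_ / _).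
by rewrite /bump /=; ring.
Qed.

Lemma Gamma_neg_neq0 (alpha : R) : 0 < alpha < 2 -> alpha != 1 -> Gamma (- alpha) != 0.
Proof.
move=> /andP[a0 a2] an1; have [a1|a1] := ltP alpha 1.
  rewrite Gamma_neg01 ?a0// oppr_eq0 gt_eqF// divr_gt0// Gamma_integral_gt0//; lra.
have {an1}a1 : 1 < alpha by rewrite lt_neqAle eq_sym an1.
rewrite Gamma_neg12 ?a1// gt_eqF// divr_gt0//; first by apply: Gamma_integral_gt0; lra.
by apply: mulr_gt0; lra.
Qed.

(** Subtracting Taylor terms realises analytic continuation: both cases are the formula
    [Gamma (- alpha) z^alpha] for the divergent integral of [y^(- alpha - 1) e^{-yz}]. *)
Lemma stable_tail_ray (alpha v : R) : 0 < alpha < 2 -> alpha != 1 ->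
  power_integral (- alpha - 1) (stable_tail alpha) (ray v) = (Gamma (- alpha))%:C * raypow alpha v.
Proof.
move=> /andP[a0 a2] an1; rewrite /stable_tail; case: ltP => a1.
  by rewrite Gamma_neg01 ?a0// stable_tail1_ray ?a0.
have {an1}a1 : 1 < alpha by rewrite lt_neqAle eq_sym an1.
by rewrite Gamma_neg12 ?a1// stable_tail2_ray ?a1.
Qed.

End GammaIntegrals.

(** * Boundary values on the imaginary axis *)

Section BoundaryValues.
Context {R : realType}.
Notation leb := (@lebesgue_measure R).

Notation eps n := (n.+1%:R^-1 : R).

Lemma eps_gt0 n : 0 < eps n.
Proof. by rewrite invr_gt0 ltr0n. Qed.

Lemma raypow_abs (a u e : R) : 0 < e ->
  e `^ a * (1 + (u / e) ^+ 2) `^ (a / 2) = (e ^+ 2 + u ^+ 2) `^ (a / 2).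
Proof.
move=> e0; have -> : e `^ a = (e ^+ 2) `^ (a / 2).
  by rewrite -powR_mulrn ?(ltW e0)// -powRrM; congr (_ `^ _); field.
rewrite -powRM ?sqr_ge0 ?(ltW (one_sqr_gt0 _))//; congr (_ `^ _); field.
by rewrite gt_eqF.
Qed.

Lemma sqr_powR_half (u a : R) : (u ^+ 2) `^ (a / 2) = `|u| `^ a.
Proof.
by rewrite -real_normK ?num_real// -powR_mulrn// -powRrM; congr (_ `^ _); field.
Qed.

Lemma cvg_scaled_atan (u : R) : 0 < u -> (fun n : nat => atan (u / eps n)) @ \oo --> (pi / 2 : R).
Proof.
move=> u0.
have h : (fun n : nat => u / eps n) @ \oo --> +oo.
  apply/cvgryPge => A; near=> n; rewrite invrK.
  have : A / u <= n%:R by near: n; exact: nbhs_infty_ger.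
  rewrite ler_pdivrMr// => /le_trans; apply.
  by rewrite mulrC ler_pM2l// ler_nat.
exact: cvg_comp h (@cvgy_atan R).
Unshelve. all: by end_near. Qed.

(** The terms are [(eps - i u)^a]; the argument of the base tends to [- pi / 2] or [pi / 2]
    according to the sign of [u], which gives the two phases. *)
Lemma raypow_boundary (a u : R) : u != 0 ->
  ccvg (fun n => ((eps n) `^ a)%:C * raypow a (u / eps n))
    (homog (expi (- (a * (pi / 2)))) (expi (a * (pi / 2))) a u).
Proof.
move=> u0.
have c1 : (fun n => (eps n) `^ a * (1 + (u / eps n) ^+ 2) `^ (a / 2)) @ \oo --> `|u| `^ a.
  rewrite -sqr_powR_half.
  have -> : (fun n => (eps n) `^ a * (1 + (u / eps n) ^+ 2) `^ (a / 2)) =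
      (fun n => ((eps n) ^+ 2 + u ^+ 2) `^ (a / 2)).
    by apply/funext => n; rewrite raypow_abs// eps_gt0.
  have u20 : 0 < u ^+ 2 by rewrite exprn_even_gt0.
  have cc : (fun n => eps n ^+ 2 + u ^+ 2) @ \oo --> u ^+ 2.
    rewrite -[X in _ --> X]add0r; apply: cvgD; last exact: cvg_cst.
    rewrite -(mulr0 0); have -> : (fun n => eps n ^+ 2) = (fun n => eps n * eps n) by apply/funext => n; rewrite expr2.
    by apply: cvgM; exact: cvg_harmonic.
  exact: (continuous_cvg _ (is_derive_continuous (is_derive1_powR (a / 2) u20)) cc).
have c2 : ccvg (fun n => expi (- (a * atan (u / eps n)))) (expi (- (a * (Num.sg u * (pi / 2))))).
  apply: ccvg_expi; apply: cvgN; apply: cvgM; first exact: cvg_cst.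
  have [u1|u1] := ltP 0 u; first by rewrite gtr0_sg// mul1r; exact: cvg_scaled_atan.
  have {}u1 : u < 0 by rewrite lt_neqAle u0.
  rewrite ltr0_sg// mulN1r.
  have -> : (fun n => atan (u / eps n)) = (fun n => - atan (- u / eps n)).
    by apply/funext => n; rewrite mulNr atanN opprK.
  by apply: cvgN; apply: cvg_scaled_atan; rewrite oppr_gt0.
have := ccvgM (ccvgR c1) c2.
have -> : (fun n => (eps n `^ a * (1 + (u / eps n) ^+ 2) `^ (a / 2))%:C * expi (- (a * atan (u / eps n)))) =
  (fun n => (eps n `^ a)%:C * raypow a (u / eps n)).
  by apply/funext => n; rewrite /raypow rmorphM mulrA.
congr ccvg; rewrite /homog; case: ltgtP u0 => u1 // _.
  by rewrite gtr0_sg// mul1r gtr0_norm// mulrC.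
by rewrite ltr0_sg// ltr0_norm// mulrC; congr (expi _ * _); ring.
Qed.

Lemma ray_scale (u e : R) : e != 0 -> e%:C * ray (u / e) = e +i* (- u).
Proof.
move=> e0; apply/eqP; rewrite eq_complex /=; apply/andP; split; apply/eqP; field; by [].
Qed.

Lemma ccvg_ray (u : R) : ccvg (fun n => eps n +i* (- u)) (0 +i* (- u)).
Proof. by apply: ccvg_ReIm => /=; [exact: cvg_harmonic|exact: cvg_cst]. Qed.

Lemma modulus_ray_le (u : R) n : modulus (eps n +i* (- u)) <= 1 + `|u|.
Proof.
apply: le_trans (modulus_le_ReIm _) _; rewrite /= normrN lerD2r ger0_norm ?(ltW (eps_gt0 n))//.
by rewrite invf_le1 ?ltr0n// ler1n.
Qed.

Lemma ccvg_stable_tail (alpha : R) (u : nat -> R[i]) (l : R[i]) :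
  ccvg u l -> ccvg (fun n => stable_tail alpha (u n)) (stable_tail alpha l).
Proof.
move=> ul; have c1 : ccvg (fun n => exp_tail1 (u n)) (exp_tail1 l).
  by apply: ccvgD (ccvg_cst _); apply: ccvg_cexp; exact: ccvgN.
by rewrite /stable_tail; case: ifP => _ //; exact: ccvgD.
Qed.

Lemma stable_tail0 (alpha : R) : stable_tail alpha 0 = 0.
Proof.
by rewrite /stable_tail /exp_tail1 /exp_tail2; case: ifP => _; rewrite oppr0 cexp0 subrr ?addr0.
Qed.

(** Both sides are limits of the integrals at [eps n - i u], whose moduli stay below [1 + |u|], so
    that one dominating function works for all [n]. At [u = 0] the integrand vanishes. *)
Lemma stable_tail_boundary (alpha u : R) : 0 < alpha < 2 -> alpha != 1 ->
  power_integral (- alpha - 1) (stable_tail alpha) (0 +i* (- u)) =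
  (Gamma (- alpha))%:C * homog (expi (- (alpha * (pi / 2)))) (expi (alpha * (pi / 2))) alpha u.
Proof.
move=> a02 a1; have [->|u0] := eqVneq u 0.
  rewrite homog0 mulr0 oppr0 /power_integral.
  rewrite (@eq_cintegral _ _ _ leb _ (fun=> 0)); last by move=> y; rewrite mulr0 stable_tail0 mulr0.
  by rewrite (cintegralR leb (fun=> 0)) /Rintegral integral0.
apply: (@ccvg_unique _ (fun n => power_integral (- alpha - 1) (stable_tail alpha) (eps n +i* (- u)))).
  apply: (@cintegral_dominated_convergence _ _ _ leb _ _ _ _ _ _
    (integrable_scale (4 * (1 + (1 + `|u|)) ^+ 2) (integrable_stable_dominator a02 a1))).
  - by move=> n; apply: cmeasurable_power; exact: cmeasurable_stable_tail.
  - by apply: cmeasurable_power; exact: cmeasurable_stable_tail.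
  - by move=> y; apply: ccvgZ; apply: ccvg_stable_tail; apply: ccvgZ; exact: ccvg_ray.
  - move=> n y; apply: stable_tail_le; last exact: modulus_ray_le.
    by rewrite /= ltW// eps_gt0.
have e n : power_integral (- alpha - 1) (stable_tail alpha) (eps n +i* (- u)) =
    (Gamma (- alpha))%:C * ((eps n `^ alpha)%:C * raypow alpha (u / eps n)).
  rewrite -ray_scale ?gt_eqF ?eps_gt0//.
  have i1 := power_integrable_stable (z := ray (u / eps n)) a02 a1 ler01.
  have [_ ->] := power_integral_scale (eps_gt0 n) i1.
  rewrite stable_tail_ray//; have -> : - (- alpha - 1) - 1 = alpha by ring.
  by rewrite mulrCA.
by rewrite (funext e); apply: ccvgZ; exact: raypow_boundary.
Qed.

Lemma homogN (a b : R[i]) (p x : R) : homog a b p (- x) = homog b a p x.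
Proof. by rewrite /homog oppr_gt0 oppr_lt0 opprK; case: ltgtP. Qed.

Lemma homogD (a b c d : R[i]) (p x : R) : homog a b p x + homog c d p x = homog (a + c) (b + d) p x.
Proof. by rewrite /homog; case: ltgtP => _; rewrite ?addr0// mulrDl. Qed.

Lemma homogZ (c a b : R[i]) (p x : R) : c * homog a b p x = homog (c * a) (c * b) p x.
Proof. by rewrite /homog; case: ltgtP => _; rewrite ?mulr0// mulrA. Qed.

End BoundaryValues.

(** * The stable Levy exponent *)

Section StableExponent.
Context {R : realType}.
Notation leb := (@lebesgue_measure R).
Variables (alpha cm cp : R).
Hypothesis a02 : 0 < alpha < 2.
Hypothesis a1 : alpha != 1.
Hypothesis cm0 : 0 <= cm.
Hypothesis cp0 : 0 <= cp.

Lemma stable_densityE h : stable_density alpha cm cp h =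
  cp * pospow (- alpha - 1) h + cm * pospow (- alpha - 1) (- h).
Proof.
rewrite /stable_density; case: ltgtP => h0.
- by rewrite addr0 pospow_le0 ?(ltW h0)// mulr0 add0r pospow_gt0 ?oppr_gt0// ltr0_norm.
- by rewrite add0r pospow_gt0// pospow_le0 ?oppr_le0 ?(ltW h0)// mulr0 addr0 gtr0_norm.
- by rewrite h0 oppr0 !pospow_le0// !mulr0 !addr0 mul0r.
Qed.

Lemma stable_density_ge0 h : 0 <= stable_density alpha cm cp h.
Proof. by rewrite stable_densityE addr_ge0// mulr_ge0// pospow_ge0. Qed.

Lemma measurable_stable_density : measurable_fun setT (stable_density alpha cm cp).
Proof.
rewrite (_ : stable_density alpha cm cp = fun h => cp * pospow (- alpha - 1) h + cm * pospow (- alpha - 1) (- h)); last first.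
  by apply/funext => h; exact: stable_densityE.
apply: measurable_funD; apply: measurable_funM => //; first exact: measurable_pospow.
by apply: (measurableT_comp (@measurable_pospow _ _)).
Qed.

(* Values at [1] and [-1] of the Levy exponent. *)
Definition stable_coef : R[i] :=
  (Gamma (- alpha))%:C * (cp%:C * expi (- (alpha * (pi / 2))) + cm%:C * expi (alpha * (pi / 2))).
Definition stable_coef' : R[i] :=
  (Gamma (- alpha))%:C * (cp%:C * expi (alpha * (pi / 2)) + cm%:C * expi (- (alpha * (pi / 2)))).

Lemma opp_imag (y u : R) : (- y)%:C * (0 +i* (- u)) = y%:C * (0 +i* (- (- u))) :> R[i].
Proof. by apply/eqP; rewrite eq_complex /=; apply/andP; split; apply/eqP; ring. Qed.

(** Reflecting the negative jumps replaces [u] by [- u], so [cm] meets the same boundary value with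
    the phases exchanged. *)
Lemma stable_tail_density (u : R) :
  cintegrable leb (fun y => stable_tail alpha (y%:C * (0 +i* (- u))) * (stable_density alpha cm cp y)%:C) /\
  cintegral leb setT (fun y => stable_tail alpha (y%:C * (0 +i* (- u))) * (stable_density alpha cm cp y)%:C) =
  homog stable_coef stable_coef' alpha u.
Proof.
set z : R[i] := 0 +i* (- u).
have i1 : power_integrable (- alpha - 1) (stable_tail alpha) z by apply: power_integrable_stable.
have i2 : power_integrable (- alpha - 1) (stable_tail alpha) (0 +i* (- (- u))) by apply: power_integrable_stable.
pose g y := (pospow (- alpha - 1) (- y))%:C * stable_tail alpha (y%:C * z).
have gE (y : R) : g (- y) = (pospow (- alpha - 1) y)%:C * stable_tail alpha (y%:C * (0 +i* (- (- u)))).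
  by rewrite /g opprK opp_imag.
have ig : cintegrable leb g.
  have [j1 j2] := i2; split.
    by have := integrable_opp j1; apply: eq_integrable => // y _; rewrite /= /rpart -gE opprK.
  by have := integrable_opp j2; apply: eq_integrable => // y _; rewrite /= /ipart -gE opprK.
have Ig : cintegral leb setT g = power_integral (- alpha - 1) (stable_tail alpha) (0 +i* (- (- u))).
  rewrite cintegral_opp; last exact: cintegrable_measurable ig.
  by apply: eq_cintegral => y; rewrite gE.
have E (y : R) : stable_tail alpha (y%:C * z) * (stable_density alpha cm cp y)%:C =
    cp%:C * ((pospow (- alpha - 1) y)%:C * stable_tail alpha (y%:C * z)) + cm%:C * g y.
  rewrite stable_densityE /g; move: (pospow _ y) (pospow _ (- y)) => A B.
  by rewrite rmorphD !rmorphM; ring.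
split.
  have := cintegrableD (cintegrableZ cp%:C i1) (cintegrableZ cm%:C ig).
  by congr (cintegrable _ _); apply/funext => y; rewrite E.
rewrite (eq_cintegral leb E) cintegralD; [|exact: cintegrableZ|exact: cintegrableZ].
rewrite (cintegralZ cp%:C i1) (cintegralZ cm%:C ig) Ig.
rewrite (stable_tail_boundary (- u) a02 a1) homogN.
transitivity (cp%:C * power_integral (- alpha - 1) (stable_tail alpha) z +
  cm%:C * ((Gamma (- alpha))%:C * homog (expi (alpha * (pi / 2))) (expi (- (alpha * (pi / 2)))) alpha u)).
  by [].
rewrite (stable_tail_boundary u a02 a1) !homogZ homogD.
by congr homog; rewrite /stable_coef /stable_coef'; ring.
Qed.

End StableExponent.

(** * The stable form of the Levy-Khintchine exponent *)

Section LevyExponent.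
Context {R : realType}.
Notation leb := (@lebesgue_measure R).
Variables (alpha cm cp : R).
Hypothesis a02 : 0 < alpha < 2.
Hypothesis a1 : alpha != 1.
Hypothesis cm0 : 0 <= cm.
Hypothesis cp0 : 0 <= cp.
Variable nu : {measure set R -> \bar R}.
Hypothesis nuE : forall A : set R, measurable A ->
  nu A = (\int[lebesgue_measure]_(h in A) (stable_density alpha cm cp h)%:E)%E.

(* Difference between the truncation of [levy_khintchine] and that of [stable_tail]. *)
Definition compensator (y : R) : R :=
  if alpha < 1 then if `|y| <= 1 then - y else 0 else if `|y| <= 1 then 0 else y.

Lemma measurable_compensator : measurable_fun setT compensator.
Proof.
have m1 : measurable_fun setT (fun y : R => `|y| <= 1).
  by apply: measurable_fun_ler => //; exact: measurable_normr.
by rewrite /compensator; case: (alpha < 1); apply: measurable_fun_if => //=; exact: measurable_funTS.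
Qed.

Lemma compensator_le y : `|compensator y| * pospow (- alpha - 1) y <= stable_dominator alpha y.
Proof.
have D0 : 0 <= stable_dominator alpha y.
  by rewrite /stable_dominator; case: ifP => _; exact: twopow_ge0.
have [y0|y0] := leP y 0; first by rewrite pospow_le0// mulr0.
have e1 : pospow (- alpha - 1) y * y = pospow (- alpha) y.
  by rewrite -[X in _ * X]expr1 pospowX subrK.
move: D0; rewrite /compensator /stable_dominator (gtr0_norm y0); case: ifP => _; rewrite /twopow; case: ifP => _ D0.
- by rewrite normrN gtr0_norm// mulrC e1.
- by rewrite normr0 mul0r.
- by rewrite normr0 mul0r.
- by rewrite gtr0_norm// mulrC e1.
Qed.

(** Where the compensator is nonzero the first moment of the jumps is finite: small jumps for
    [alpha < 1], large ones for [alpha > 1]. *)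
Lemma integrable_compensator :
  leb.-integrable setT (EFin \o (fun y => compensator y * stable_density alpha cm cp y)).
Proof.
have i1 := integrable_stable_dominator a02 a1.
have i2 := integrable_opp i1.
have := integrableD measurableT (integrable_scale cp i1) (integrable_scale cm i2).
apply: le_integrable => //.
  apply/measurable_EFinP; apply: measurable_funM; first exact: measurable_compensator.
  exact: measurable_stable_density.
move=> y _ /=; rewrite -?EFinD lee_fin normrM.
rewrite (ger0_norm (stable_density_ge0 _ cm0 cp0 _)).
apply: le_trans (ler_norm _).
rewrite stable_densityE mulrDr mulrCA [X in _ + X]mulrCA lerD// ler_wpM2l//.
  exact: compensator_le.
have -> : `|compensator y| = `|compensator (- y)|.
  by rewrite /compensator normrN; case: ifP => _; case: ifP => _; rewrite ?opprK ?normrN.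
exact: compensator_le.
Qed.

Lemma cmeasurable_levy_integrand (u : R) :
  cmeasurable (fun y : R => expi (u * y) - 1 - (if `|y| <= 1 then 0 +i* (u * y) else 0)).
Proof.
apply: cmeasurableB.
  by apply: cmeasurableB; [apply: cmeasurable_expi; exact: measurable_mulr|exact: cmeasurable_cst].
have m : measurable_fun setT (fun y : R => if `|y| <= 1 then u * y else 0).
  have m1 : measurable_fun setT (fun y : R => `|y| <= 1).
    by apply: measurable_fun_ler => //; exact: measurable_normr.
  by apply: measurable_fun_if => //=; apply: measurable_funTS => //; exact: measurable_mulr.
rewrite (_ : (fun y : R => if `|y| <= 1 then 0 +i* (u * y) else 0) =
  (fun y => 'i * (if `|y| <= 1 then u * y else 0)%:C)).
  by apply: cmeasurableM; [exact: cmeasurable_cst|exact: cmeasurableR].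
apply/funext => y; case: ifP => _; last by rewrite mulr0.
by apply/eqP; rewrite eq_complex /=; apply/andP; split; apply/eqP; ring.
Qed.

Lemma levy_integrandE (u y : R) :
  expi (u * y) - 1 - (if `|y| <= 1 then 0 +i* (u * y) else 0) =
  stable_tail alpha (y%:C * (0 +i* (- u))) + (0 +i* u) * (compensator y)%:C.
Proof.
have e : cexp (- (y%:C * (0 +i* (- u)))) = expi (u * y).
  by rewrite /cexp /= mulr0 mul0r subr0 oppr0 expR0 mul1r; congr expi; ring.
rewrite /stable_tail /compensator; case: (alpha < 1); rewrite /exp_tail2 /exp_tail1 e; case: (`|y| <= 1).
- by rewrite rmorphN; congr (_ + _); apply/eqP; rewrite eq_complex /=; apply/andP; split; apply/eqP; ring.
- by rewrite mulr0 subr0 addr0.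
- rewrite mulr0 addr0; congr (_ + _).
  by apply/eqP; rewrite eq_complex /=; apply/andP; split; apply/eqP; ring.
- rewrite subr0 -addrA -[LHS]addr0; congr (_ + _).
  by apply/eqP; rewrite eq_complex /=; apply/andP; split; apply/eqP; ring.
Qed.

(** Changing the truncation of the jumps only adds a multiple of [i u], which the drift absorbs. *)
Lemma levy_khintchine_stable (b s2 : R) : exists c : R, forall u : R,
  levy_khintchine b s2 nu u =
  homog (stable_coef alpha cm cp) (stable_coef' alpha cm cp) alpha u +
  ((- (s2 * u ^+ 2 / 2)) +i* (c * u)).
Proof.
pose b0 := Rintegral leb setT (fun y => compensator y * stable_density alpha cm cp y).
exists (b + b0) => u; rewrite /levy_khintchine.
(* The identity carries [nu] to the measurable space [measurableTypeR R], on which its density is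
   taken. *)
have id_meas : measurable_fun setT (id : R -> measurableTypeR R).
  by move=> _ A mA; rewrite setTI; exact: mA.
pose nu' := measure_function_pushforward__canonical__measure_function_Measure nu id_meas.
have -> : cintegral nu setT (fun y : R => expi (u * y) - 1 - (if `|y| <= 1 then 0 +i* (u * y) else 0)) =
    cintegral nu' setT (fun y : R => expi (u * y) - 1 - (if `|y| <= 1 then 0 +i* (u * y) else 0)).
  apply/esym/(@cintegral_image _ _ _ _ _ nu nu' _ id_meas) => //.
  exact: cmeasurable_levy_integrand.
rewrite (@cintegral_density _ _ _ leb nu' _ (@measurable_stable_density _ alpha cm cp) (stable_density_ge0 alpha cm0 cp0) nuE _ (cmeasurable_levy_integrand u)).
have [i1 I1] := stable_tail_density cm cp a02 a1 u.
have i2 : cintegrable leb (fun y => (compensator y * stable_density alpha cm cp y)%:C).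
  apply: (@cintegrable_le _ _ _ leb _ _ _ (integrable_abse integrable_compensator)).
    apply: cmeasurableR; apply: measurable_funM; first exact: measurable_compensator.
    exact: measurable_stable_density.
  by move=> y; rewrite modulusR.
have E (y : R) : (expi (u * y) - 1 - (if `|y| <= 1 then 0 +i* (u * y) else 0)) * (stable_density alpha cm cp y)%:C =
    stable_tail alpha (y%:C * (0 +i* (- u))) * (stable_density alpha cm cp y)%:C +
    (0 +i* u) * (compensator y * stable_density alpha cm cp y)%:C.
  by rewrite levy_integrandE [(compensator y * _)%:C]rmorphM; ring.
rewrite (eq_cintegral leb E) (cintegralD i1 (cintegrableZ _ i2)) I1 (cintegralZ _ i2) cintegralR -/b0.
rewrite [LHS]addrCA; congr (_ + _).
by apply/eqP; rewrite eq_complex /=; apply/andP; split; apply/eqP; ring.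
Qed.

End LevyExponent.

Section StableProcess.
Context {R : realType} {d : measure_display} {T : measurableType d}.
Variable P : probability T R.

Lemma cintegral_same_law (Y Z : T -> R) (f : R -> R[i]) :
  measurable_fun setT Y -> measurable_fun setT Z -> cmeasurable f -> same_law P Y Z ->
  cintegral P setT (fun w => f (Y w)) = cintegral P setT (fun w => f (Z w)).
Proof.
move=> mY mZ mf YZ.
pose nu := measure_function_pushforward__canonical__measure_function_Measure P mZ.
transitivity (cintegral nu setT f); last exact: cintegral_image.
apply/esym/(cintegral_image mY) => // A mA; exact/esym/YZ.
Qed.

Lemma is_cderive_ccvg (f : R -> R[i]) (x : R) (l : R[i]) : is_cderive f x l ->
  ccvg (fun n : nat => n.+1%:R%:C * (f (x + n.+1%:R^-1) - f x)) l.
Proof.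
move=> [d1 d2]; apply: ccvg_ReIm.
  have := is_derive_cvg_seq d1; apply: cvg_trans; apply: near_eq_cvg; near=> n.
  by rewrite /rpart Re_scale; case: (f _) (f _) => [? ?] [? ?].
have := is_derive_cvg_seq d2; apply: cvg_trans; apply: near_eq_cvg; near=> n.
by rewrite /ipart; case: (f _) (f _) => [? ?] [? ?] /=; rewrite mul0r addr0.
Unshelve. all: by end_near. Qed.

(** The derivative at [t = 0] recovers the exponent, so no branch of the logarithm has to be
    chosen. *)
Lemma cexp_scale_inj (z w : R[i]) : (forall t : R, 0 <= t -> cexp (t%:C * z) = cexp (t%:C * w)) -> z = w.
Proof.
move=> H.
have c1 := is_cderive_ccvg (is_cderive_cexp z 0).
have c2 := is_cderive_ccvg (is_cderive_cexp w 0).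
rewrite mul0r cexp0 mulr1 in c1; rewrite mul0r cexp0 mulr1 in c2.
apply: ccvg_unique c1 _; congr ccvg: c2; apply/funext => n.
by rewrite H// add0r invr_ge0.
Qed.

(* The scaling [X_2 ~ 2^(1/alpha) X_1] leaves no room for a Gaussian part (degree
   2) or a drift (degree 1) next to the jump part (degree [alpha]). *)
Lemma stable_exponent (alpha cm cp : R) (X : R -> {RV P >-> R}) :
  0 < alpha < 2 -> alpha != 1 -> 0 <= cm -> 0 <= cp -> stable_process alpha cm cp X ->
  forall t u : R, 0 <= t -> cintegral P setT (fun w => expi (u * X t w)) =
    cexp (t%:C * homog (stable_coef alpha cm cp) (stable_coef' alpha cm cp) alpha u).
Proof.
move=> a02 a1 cm0 cp0 [_ sX [nu [nuE [_ _ [b [s2 [s20 LK]]]]]]].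
have [c Hc] := levy_khintchine_stable a02 a1 cm0 cp0 nuE b s2.
set H := homog _ _ _ in Hc *.
have [a0 a2] := andP a02.
pose r : R := 2 `^ alpha^-1.
have r0 : 0 < r by rewrite powR_gt0.
have scal : levy_khintchine b s2 nu (r * 1) = 2%:C * levy_khintchine b s2 nu 1.
  apply: cexp_scale_inj => t t0; rewrite mulrA -rmorphM [t * 2]mulrC -!LK// ?mulr_ge0//.
  rewrite (@cintegral_same_law (X (2 * t)) (fun w => r * X t w) (fun y => expi (1 * y)))//.
  - by apply: eq_cintegral => w; congr expi; ring.
  - by apply: measurable_funM.
  - by apply: cmeasurable_expi; exact: measurable_mulr.
  - exact: sX.
have hom : H (r * 1) = 2%:C * H 1.
  rewrite /H /homog mulr1 r0 ltr01 powR1 mulr1 /r -powRrM mulVf ?gt_eqF// powRr1//.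
  by rewrite mulrC.
(* The jump parts cancel by homogeneity, leaving [s2 (r^2 - 2) = 0] and then [c (r - 2) = 0]. Taking
   logarithms, [r^2 = 2] would force [alpha = 2] and [r = 2] would force [alpha = 1]. *)
move: scal; rewrite !Hc hom mulrDr => /addrI /eqP; rewrite eq_complex /= => /andP[/eqP e1 /eqP e2].
have ln2 : 0 < ln 2 :> R by rewrite ln_gt0// ltr1n.
have s0 : s2 = 0.
  have e : s2 * (r ^+ 2 - 2) = 0 by move: e1; rewrite !mulr1 expr1n; lra.
  move/eqP: e; rewrite mulf_eq0 => /orP[/eqP //|]; rewrite subr_eq0 => /eqP.
  rewrite /r -powR_mulrn ?powR_ge0// -powRrM => /(congr1 (@ln R)); rewrite ln_powR => /eqP.
  rewrite -subr_eq0 -{2}[ln 2]mul1r -mulrBl mulf_eq0 (gt_eqF ln2) orbF subr_eq0 => /eqP e.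
  suff : alpha = 2 by lra.
  by have := congr1 (fun x => alpha * x) e; rewrite mulrA mulfV ?gt_eqF// mul1r mulr1 => <-.
have c0 : c = 0.
  have e : c * (r - 2) = 0 by move: e2; rewrite !mulr1 s0 !mul0r; lra.
  move/eqP: e; rewrite mulf_eq0 => /orP[/eqP //|]; rewrite subr_eq0 => /eqP.
  rewrite /r => /(congr1 (@ln R)); rewrite ln_powR => /eqP.
  rewrite -subr_eq0 -{2}[ln 2]mul1r -mulrBl mulf_eq0 (gt_eqF ln2) orbF subr_eq0 => /eqP e.
  suff : alpha = 1 by move/eqP: a1.
  by rewrite -[alpha]invrK e invr1.
move=> t u t0; rewrite LK// Hc s0 c0 !mul0r oppr0.
by have -> : (0 +i* 0 : R[i]) = 0 by []; rewrite addr0.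
Qed.

End StableProcess.

(** * Algebra of homogeneous multipliers *)

Section Multiplier.
Context {R : realType}.
Implicit Types (a b c d : R[i]) (p : R) (phi : R -> R[i]).

Definition multiplier a b p phi : R -> R[i] := ifourier (fun u => homog a b p u * fourier phi u).

Lemma fourier_multiplier a b p phi : lizorkin phi ->
  fourier (multiplier a b p phi) = (fun u => homog a b p u * fourier phi u).
Proof.
move=> [_ h]; apply: ifourierK; apply: lizorkin_dual_schwartz; exact: lizorkin_dual_homog.
Qed.

Lemma lizorkin_multiplier a b p phi : lizorkin phi -> lizorkin (multiplier a b p phi).
Proof.
move=> h; split; last by rewrite fourier_multiplier//; apply: lizorkin_dual_homog; case: h.
apply: schwartz_ifourier; apply: lizorkin_dual_schwartz; apply: lizorkin_dual_homog.
by case: h.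
Qed.

(** The product of the two symbols is 1 except at the origin, where the transform of [phi] vanishes
    anyway. *)
Lemma multiplierK a b c d p phi : a * c = 1 -> b * d = 1 -> lizorkin phi ->
  multiplier a b p (multiplier c d (- p) phi) = phi.
Proof.
move=> ac bd h; rewrite {1}/multiplier fourier_multiplier//.
rewrite -[RHS](fourierK (proj1 h)); congr ifourier; apply/funext => u.
rewrite mulrA homogM ac bd subrr.
have [->|u0] := eqVneq u 0; last by rewrite homog1// mul1r.
by rewrite (lizorkin_dual0 (proj2 h)) mulr0.
Qed.

End Multiplier.

(** * The generator as a multiplier *)

Section Generator.
Context {R : realType} {d : measure_display} {T : measurableType d}.
Variable P : probability T R.
Variable X : R -> {RV P >-> R}.
Notation leb := (@lebesgue_measure R).

Lemma semigroup_derivative_unique (f g1 g2 : R -> R[i]) :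
  semigroup_derivative X f g1 -> semigroup_derivative X f g2 -> g1 = g2.
Proof.
move=> d1 d2; apply/funext => x; apply/eqP; rewrite -subr_eq0; apply/eqP; apply: modulus0_eq0.
apply/eqP; rewrite eq_le modulus_ge0 andbT; apply/ler_addgt0Pl => e e0; rewrite addr0.
have e2 : 0 < e / 2 by rewrite divr_gt0.
have [t [/(_ x) h1 /(_ x) h2]] := filter_ex (filterI (d1 _ e2) (d2 _ e2)).
rewrite (splitr e); apply: le_trans (lerD h2 h1); apply: le_trans (modulusB _ _).
by rewrite [X in _ <= modulus X](_ : _ = g1 x - g2 x)//; ring.
Qed.

Lemma integrable_probability_cst (c : R) : P.-integrable setT (EFin \o (fun=> c)).
Proof. exact: finite_measure_integrable_cst. Qed.

Lemma cintegrable_bounded (f : T -> R[i]) (M : R) : cmeasurable f -> (forall w, modulus (f w) <= M) ->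
  cintegrable P f.
Proof. by move=> mf; exact: (@cintegrable_le _ _ _ P f _ mf (integrable_probability_cst M)). Qed.

Lemma schwartz_bounded (f : R -> R[i]) : schwartz f -> exists M : R, forall x, modulus (f x) <= M.
Proof. by move/schwartz_rapid => /(_ 0%N) [M H]; exists M => x; move: (H x); rewrite expr0 mul1r. Qed.

Variable H : R -> R[i].
Hypothesis HE : forall t u : R, 0 <= t ->
  cintegral P setT (fun w => expi (u * X t w)) = cexp (t%:C * H u).

(** Characteristic functions are bounded, here by 2. A positive real part would give, at time
    [2 / Re], the modulus [expR 2], which is at least 3. *)
Lemma exponent_Re_le0 u : complex.Re (H u) <= 0.
Proof.
rewrite leNgt; apply/negP => h.
have t0 : 0 <= 2 / complex.Re (H u) by rewrite divr_ge0// ltW.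
have : modulus (cintegral P setT (fun w => expi (u * X (2 / complex.Re (H u)) w))) <= 2 * Rintegral P setT (fun=> 1).
  apply: modulus_cintegral; first by apply: cmeasurable_expi; apply: measurable_funM.
    exact: integrable_probability_cst.
  by move=> w; rewrite modulus_expi.
have -> : Rintegral P setT (fun=> 1) = 1.
  by rewrite Rintegral_cst// mul1r /= [P _]probability_setT.
rewrite HE// modulus_cexp Re_scale mulrVK ?unitfE ?gt_eqF// leNgt => /negP; apply.
by apply: lt_le_trans (expR_ge1Dx 2); rewrite mulr1; lra.
Qed.

(** Inversion expresses [phi (x + X_t)] through [e^{- i u X_t}]; Fubini puts the expectation inside,
    where it is the characteristic function at [- u]. *)
Lemma semigroup_fourier (phi : R -> R[i]) (t x : R) : 0 <= t -> schwartz phi ->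
  (2 * pi)%:C * semigroup X t phi x =
  cintegral leb setT (fun u => fourier phi u * expi (- (u * x)) * cexp (t%:C * H (- u))).
Proof.
move=> t0 sp; have sf := schwartz_fourier sp.
have mX : measurable_fun setT (fun w => x + X t w) by apply: measurable_funD.
have mp : cmeasurable (fun w => phi (x + X t w)).
  by apply: cmeasurable_comp mX; exact: schwartz_measurable.
have [M HM] := schwartz_bounded sp.
rewrite /semigroup -(cintegralZ _ (cintegrable_bounded mp (fun w => HM _))).
have E w : (2 * pi)%:C * phi (x + X t w) =
  cintegral leb setT (fun u => fourier phi u * expi (- (u * (x + X t w)))).
  by rewrite fourier_inversion.
rewrite (eq_cintegral P E).
rewrite (@cintegral_swap _ _ _ _ _ P leb (fun w u => fourier phi u * expi (- (u * (x + X t w))))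
  (fun=> 1) (fun u => modulus (fourier phi u))).
- apply: eq_cintegral => u.
  have E2 w : fourier phi u * expi (- (u * (x + X t w))) =
      (fourier phi u * expi (- (u * x))) * expi (- u * X t w).
    by rewrite -mulrA -expiD; congr (_ * expi _); ring.
  rewrite (eq_cintegral P E2) cintegralZ ?HE//.
  apply: (@cintegrable_bounded _ 1); first by apply: cmeasurable_expi; apply: measurable_funM.
  by move=> w; rewrite modulus_expi.
- apply: cmeasurableM.
    by apply: (cmeasurable_comp (schwartz_measurable sf)); exact: measurable_snd.
  apply: cmeasurable_expi; apply: measurableT_comp => //; apply: measurable_funM; first exact: measurable_snd.
  by apply: (measurableT_comp mX); exact: measurable_fst.
- by move=> w u; rewrite modulusM modulus_expi mulr1 mul1r.
- by move=> w; exact: ler01.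
- by move=> u; exact: modulus_ge0.
- exact: integrable_probability_cst.
- exact: integrable_modulus (schwartz_integrable sf).
Qed.

Hypothesis mH : cmeasurable (fun u : R => H (- u)).

(** On the Fourier side the error is the second-order remainder of [e^{tH}], bounded by
    [4 t^2 |H|^2] because the real part of [H] is nonpositive. The phase [e^{-iux}] has modulus 1,
    so the estimate is uniform in [x]. *)
Lemma semigroup_expansion (phi g : R -> R[i]) : schwartz phi -> schwartz g ->
  (fun u => H (- u) * fourier phi u) = fourier g ->
  cintegrable leb (fun u : R => H (- u) ^+ 2 * fourier phi u) ->
  exists2 K : R, 0 <= K & forall t x : R, 0 <= t ->
    modulus (semigroup X t phi x - phi x - t%:C * g x) <= K * t ^+ 2.
Proof.
move=> sp sg Eg i2; have sf := schwartz_fourier sp; have sfg := schwartz_fourier sg.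
pose h (u : R) := 4 * modulus (H (- u) ^+ 2 * fourier phi u).
have ih : leb.-integrable setT (EFin \o h) by apply: integrable_scale; exact: integrable_modulus.
have h0 : 0 <= Rintegral leb setT h.
  by apply: Rintegral_ge0 => u _; rewrite mulr_ge0// modulus_ge0.
have p0 : 0 < 2 * pi :> R by rewrite mulr_gt0// pi_gt0.
exists ((2 * pi)^-1 * (2 * Rintegral leb setT h)).
  by rewrite mulr_ge0// ?invr_ge0 ?(ltW p0)// mulr_ge0.
move=> t x t0.
have me : measurable_fun setT (fun u : R => - (u * x)).
  by apply: measurableT_comp => //; exact: measurable_mull.
have mt : cmeasurable (fun u : R => t%:C * H (- u)).
  by apply: cmeasurableM => //; exact: cmeasurable_cst.
have iF : cintegrable leb (fun u => fourier phi u * expi (- (u * x))).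
  exact: (@cintegrable_expi _ _ _ leb (fourier phi) _ me (schwartz_integrable sf)).
have iG : cintegrable leb (fun u => fourier g u * expi (- (u * x))).
  exact: (@cintegrable_expi _ _ _ leb (fourier g) _ me (schwartz_integrable sfg)).
have iE : cintegrable leb (fun u => fourier phi u * expi (- (u * x)) * cexp (t%:C * H (- u))).
  apply: cintegrableMr iF; first exact: cmeasurable_cexp mt.
  move=> u; apply: modulus_cexp_le1; rewrite Re_scale mulr_ge0_le0//; exact: exponent_Re_le0.
have main : (2 * pi)%:C * (semigroup X t phi x - phi x - t%:C * g x) =
    cintegral leb setT (fun u => fourier phi u * expi (- (u * x)) *
      (cexp (t%:C * H (- u)) - 1 - t%:C * H (- u))).
  rewrite !mulrBr semigroup_fourier// mulrCA -!fourier_inversion//.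
  rewrite -(cintegralZ _ iG) -(cintegralB iE iF) -(cintegralB (cintegrableB iE iF) (cintegrableZ _ iG)).
  by apply: eq_cintegral => u; rewrite -Eg; ring.
suff : 2 * pi * modulus (semigroup X t phi x - phi x - t%:C * g x) <= 2 * Rintegral leb setT h * t ^+ 2.
  by rewrite -ler_pdivlMl// mulrA.
rewrite -{1}(gtr0_norm p0) -modulusR -modulusM main.
have -> : 2 * Rintegral leb setT h * t ^+ 2 = 2 * Rintegral leb setT (fun u => t ^+ 2 * h u).
  by rewrite RintegralZl// -mulrA [_ * t ^+ 2]mulrC.
apply: modulus_cintegral; last 1 first.
- move=> u; rewrite modulusM [modulus (_ * expi _)]modulusM modulus_expi mulr1.
  have hR : complex.Re (t%:C * H (- u)) <= 0.
    by rewrite Re_scale mulr_ge0_le0//; exact: exponent_Re_le0.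
  apply: le_trans (ler_wpM2l (modulus_ge0 _) (modulus_cexpB1B hR)) _.
  rewrite /h [modulus (_ ^+ 2 * _)]modulusM [modulus (_ ^+ 2)]modulusX [modulus (t%:C * _)]modulusM.
  rewrite modulusR (ger0_norm t0) exprMn.
  by rewrite le_eqVlt; apply/orP; left; apply/eqP; ring.
- apply: cmeasurableM; first exact: cintegrable_measurable iF.
  apply: cmeasurableB; last exact: mt.
  by apply: cmeasurableB; [apply: cmeasurable_cexp; exact: mt|exact: cmeasurable_cst].
- exact: integrable_scale.
Qed.

Lemma semigroup_derivative_expansion (f g : R -> R[i]) (K : R) : 0 <= K ->
  (forall t x : R, 0 <= t -> modulus (semigroup X t f x - f x - t%:C * g x) <= K * t ^+ 2) ->
  semigroup_derivative X f g.
Proof.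
move=> K0 HK e e0; near=> t => x.
have t0 : 0 < t by near: t; exact: nbhs_right_gt.
have te : t <= e / (K + 1).
  by near: t; apply: nbhs_right_le; rewrite divr_gt0// ltr_wpDl.
have -> : (t^-1)%:C * (semigroup X t f x - f x) - g x =
    (t^-1)%:C * (semigroup X t f x - f x - t%:C * g x).
  by rewrite [in RHS]mulrBr mulrA -rmorphM mulVf ?gt_eqF// mul1r.
rewrite modulusM modulusR gtr0_norm ?invr_gt0// ler_pdivrMl//.
apply: le_trans (HK t x (ltW t0)) _; rewrite expr2 mulrA mulrC ler_pM2l//.
move: te; rewrite ler_pdivlMr ?ltr_wpDl// => te.
by apply: le_trans te; rewrite mulrDr mulr1 mulrC lerDl ltW.
Unshelve. all: by end_near. Qed.

End Generator.

Section StableGenerator.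
Context {R : realType} {d : measure_display} {T : measurableType d}.
Variable P : probability T R.
Notation leb := (@lebesgue_measure R).

Lemma cmeasurable_homog (a b : R[i]) (p : R) : cmeasurable (homog a b p).
Proof.
have -> : homog a b p = (fun x => a * (pospow p x)%:C + b * (pospow p (- x))%:C).
  apply/funext => x; rewrite /homog; case: (ltrgtP x 0) => [x0|x0|->].
  - by rewrite (pospow_le0 _ (ltW x0)) pospow_gt0 ?oppr_gt0// rmorph0 mulr0 add0r.
  - by rewrite (pospow_gt0 _ x0) pospow_le0 ?oppr_le0 ?ltW// rmorph0 mulr0 addr0.
  - by rewrite oppr0 pospow_le0// rmorph0 !mulr0 addr0.
have m := measurable_pospow p.
apply: cmeasurableD; apply: cmeasurableM; try exact: cmeasurable_cst.
  exact: cmeasurableR.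
by apply: cmeasurableR; apply: (measurableT_comp m).
Qed.

(** [L] is known only on the generator domain. The expansion exhibits the multiplier as a uniform
    derivative of the semigroup at [phi], which puts [phi] in the domain; uniqueness of that
    derivative identifies [L phi]. *)
Lemma stable_generator (alpha cm cp : R) (X : R -> {RV P >-> R}) (L : (R -> R[i]) -> (R -> R[i])) :
  0 < alpha < 2 -> alpha != 1 -> 0 <= cm -> 0 <= cp -> stable_process alpha cm cp X ->
  infinitesimal_generator X L -> forall phi, lizorkin phi ->
  L phi = multiplier (stable_coef' alpha cm cp) (stable_coef alpha cm cp) alpha phi.
Proof.
move=> a02 a1 cm0 cp0 sX hL phi lphi.
set A := stable_coef _ _ _; set B := stable_coef' _ _ _; set g := multiplier _ _ _ _.
have HE := stable_exponent a02 a1 cm0 cp0 sX.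
have lg : lizorkin g by exact: lizorkin_multiplier.
have Eg : (fun u => homog A B alpha (- u) * fourier phi u) = fourier g.
  by rewrite fourier_multiplier//; apply/funext => u; rewrite homogN.
have i2 : cintegrable leb (fun u : R => homog A B alpha (- u) ^+ 2 * fourier phi u).
  rewrite (_ : (fun u : R => _) = (fun u => homog B A alpha u * (homog B A alpha u * fourier phi u))).
    apply: schwartz_integrable; apply: lizorkin_dual_schwartz.
    by do 2 apply: lizorkin_dual_homog; case: lphi.
  by apply/funext => u; rewrite homogN expr2 mulrA.
have mH : cmeasurable (fun u : R => homog A B alpha (- u)).
  by apply: (cmeasurable_comp (cmeasurable_homog A B alpha)).
have [K K0 HK] := semigroup_expansion HE mH (proj1 lphi) (proj1 lg) Eg i2.
have dg := semigroup_derivative_expansion K0 HK.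
have dom : generator_domain X phi.
  split; first exact: schwartz_vanishing (proj1 lphi).
  by exists g => //; exact: schwartz_vanishing (proj1 lg).
exact: semigroup_derivative_unique (proj2 (hL _ dom)) dg.
Qed.

End StableGenerator.

(** * Fractional integrals as multipliers *)

Section FractionalIntegral.
Context {R : realType}.
Notation leb := (@lebesgue_measure R).
Notation eps n := (n.+1%:R^-1 : R).
Variables (alpha : R) (phi : R -> R[i]).
Hypothesis a02 : 0 < alpha < 2.
Hypothesis lphi : lizorkin phi.
Let a0 : 0 < alpha.
Proof. by case/andP: a02. Qed.
Let am1 : -1 < alpha - 1.
Proof. by rewrite ltrBrDl subrr. Qed.
Let sphi : schwartz phi.
Proof. by case: lphi. Qed.
Let psi := fourier phi.

Lemma is_cderive_measurable (f g : R -> R[i]) : (forall x, is_cderive f x (g x)) -> cmeasurable f.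
Proof.
move=> H; split; apply: continuous_measurable_fun => x.
  exact: is_derive_continuous (proj1 (H x)).
exact: is_derive_continuous (proj2 (H x)).
Qed.

Lemma cmeasurable_raypow (a : R) : cmeasurable (raypow a : R -> R[i]).
Proof. exact: is_cderive_measurable (is_cderive_raypow a). Qed.

Lemma integrable_frac (x s : R) : s != 0 ->
  leb.-integrable setT (EFin \o (fun y => modulus ((pospow (alpha - 1) y)%:C * phi (x + s * y)))).
Proof.
move=> s0; have sf := schwartz_affine x s0 sphi.
(* Boundedness handles [y <= 1]; decay of order 3 lowers the exponent to [alpha - 4], which is below
   -1, for [y > 1]. *)
have [M0 H0] := schwartz_rapid sf 0%N; have [M3 H3] := schwartz_rapid sf 3%N.
have M00 : 0 <= M0 by apply: le_trans (H0 0); rewrite mulr_ge0// modulus_ge0.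
have M30 : 0 <= M3 by apply: le_trans (H3 0); rewrite mulr_ge0// modulus_ge0.
have [_ a2] := andP a02.
have a4 : alpha - 4 < -1 by lra.
have := integrable_scale (M0 + M3) (integrable_twopow am1 a4).
apply: le_integrable => //.
  apply/measurable_EFinP; apply: measurable_modulus; apply: cmeasurableM.
    by apply: cmeasurableR; exact: measurable_pospow.
  exact: schwartz_measurable.
move=> y _ /=; rewrite lee_fin ger0_norm ?modulus_ge0//; apply: le_trans (ler_norm _).
rewrite modulusM modulusR ger0_norm ?pospow_ge0// /twopow; case: ifP => y1.
  rewrite mulrC ler_wpM2r ?pospow_ge0//.
  by have := H0 y; rewrite expr0 mul1r => /le_trans; apply; rewrite lerDl.
have y0 : 0 < y by move/negbT: y1; rewrite -ltNge; apply: lt_trans.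
rewrite -{1}(subrK 3 (alpha - 1)) (_ : alpha - 1 - 3 = alpha - 4); last by ring.
rewrite -(pospowX _ 3%N) -mulrA [leRHS]mulrC ler_wpM2l ?pospow_ge0//.
by have := H3 y; rewrite (gtr0_norm y0) => /le_trans; apply; rewrite lerDr.
Qed.

(* The kernel [y `^ (alpha - 1)] is not integrable at infinity: hence the
   damping factor. *)
Lemma frac_regularised (x s e : R) : 0 < e ->
  (2 * pi)%:C * cintegral leb setT (fun y => (pospow (alpha - 1) y * expR (- (e * y)))%:C * phi (x + s * y)) =
  cintegral leb setT (fun u => psi u * expi (- (u * x)) * power_integral (alpha - 1) exp_tail0 (e +i* (s * u))).
Proof.
move=> e0; have sf := schwartz_fourier sphi.
have ip := integrable_pospow_exp am1 e0.
have mp : measurable_fun setT (fun y : R => pospow (alpha - 1) y * expR (- (e * y))).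
  by move/integrableP: (ip) => [/measurable_EFinP].
have p0 y : 0 <= pospow (alpha - 1) y * expR (- (e * y)) by rewrite mulr_ge0// ?pospow_ge0 ?expR_ge0.
have [M HM] := schwartz_rapid sphi 0%N.
have maff : measurable_fun setT (fun y : R => x + s * y) by exact: measurable_affine.
have mphi : cmeasurable (fun y : R => phi (x + s * y)).
  by apply: (cmeasurable_comp _ maff); exact: schwartz_measurable.
have i1 : cintegrable leb (fun y => (pospow (alpha - 1) y * expR (- (e * y)))%:C * phi (x + s * y)).
  apply: (@cintegrable_le _ _ _ leb _ _ _ (integrable_scale M ip)).
    by apply: cmeasurableM mphi; exact: cmeasurableR.
  move=> y; rewrite modulusM modulusR ger0_norm// mulrC ler_wpM2r//.
  by have := HM (x + s * y); rewrite expr0 mul1r.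
rewrite -(cintegralZ _ i1).
have E y : (2 * pi)%:C * ((pospow (alpha - 1) y * expR (- (e * y)))%:C * phi (x + s * y)) =
    cintegral leb setT (fun u => (pospow (alpha - 1) y * expR (- (e * y)))%:C *
      (psi u * expi (- (u * (x + s * y))))).
  rewrite mulrCA -fourier_inversion// cintegralZ//.
  apply: (@cintegrable_expi _ _ _ leb psi); last exact: schwartz_integrable.
  by apply: measurableT_comp => //; exact: measurable_mull.
rewrite (eq_cintegral leb E).
rewrite (@cintegral_swap _ _ _ _ _ leb leb (fun y u => (pospow (alpha - 1) y * expR (- (e * y)))%:C *
      (psi u * expi (- (u * (x + s * y))))) (fun y => pospow (alpha - 1) y * expR (- (e * y))) (fun u => modulus (psi u))).
- apply: eq_cintegral => u; rewrite /power_integral -cintegralZ.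
    apply: eq_cintegral => y; rewrite /exp_tail0 /cexp /= !mul0r subr0 addr0.
    rewrite rmorphM [y * e]mulrC.
    have -> : expi (- (u * (x + s * y))) = expi (- (u * x)) * expi (- (y * (s * u))).
      by rewrite -expiD; congr expi; ring.
    move: (pospow _ y) => A; ring.
  exact: power_integrable0.
- apply: cmeasurableM.
    by apply: cmeasurableR; apply: (measurableT_comp mp); exact: measurable_fst.
  apply: cmeasurableM.
    by apply: (cmeasurable_comp (schwartz_measurable sf)); exact: measurable_snd.
  apply: cmeasurable_expi; apply: measurableT_comp => //; apply: measurable_funM; first exact: measurable_snd.
  by apply: (measurableT_comp maff); exact: measurable_fst.
- move=> y u; rewrite modulusM modulusR [modulus (_ * expi _)]modulusM modulus_expi mulr1.
  by rewrite ger0_norm.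
- exact: p0.
- by move=> u; exact: modulus_ge0.
- exact: ip.
- exact: integrable_modulus (schwartz_integrable sf).
Qed.

Lemma power_integral0_scaled (u e : R) : 0 < e ->
  power_integral (alpha - 1) exp_tail0 (e +i* (- u)) =
  (Gamma alpha)%:C * ((e `^ (- alpha))%:C * raypow (- alpha) (u / e)).
Proof.
move=> e0; rewrite -ray_scale ?gt_eqF//.
have i1 : power_integrable (alpha - 1) exp_tail0 (ray (u / e)).
  by apply: power_integrable0 => //; exact: ray_Re.
have [_ ->] := power_integral_scale e0 i1.
rewrite power_integral0_ray// -Gamma_gt0E//.
have -> : - (alpha - 1) - 1 = - alpha by ring.
by rewrite mulrCA.
Qed.

(** The left side is [(e^2 + u^2)^(- alpha / 2)], and dropping [e^2] increases a negative power. *)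
Lemma modulus_scaled_raypow (u e : R) : 0 < e -> u != 0 ->
  modulus ((e `^ (- alpha))%:C * raypow (- alpha) (u / e)) <= `|u| `^ (- alpha).
Proof.
move=> e0 u0; rewrite /raypow mulrA -rmorphM modulusM modulus_expi mulr1 modulusR raypow_abs//.
have u20 : 0 < u ^+ 2 by rewrite exprn_even_gt0.
rewrite ger0_norm ?powR_ge0// -sqr_powR_half.
rewrite mulNr !powRN lef_pV2 ?posrE ?powR_gt0// ?addr_gt0// ?exprn_gt0//.
apply: ge0_ler_powR; rewrite ?nnegrE ?lerDr ?sqr_ge0// ?addr_ge0 ?sqr_ge0//.
by rewrite ltW// divr_gt0.
Qed.

Lemma cvg_harmonic_mulr (y : R) : (fun n => eps n * y) @ \oo --> 0.
Proof. by rewrite -(mul0r y); apply: cvgM; [exact: cvg_harmonic|exact: cvg_cst]. Qed.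

(** Limit of [frac_regularised] as the damping disappears. The left side is dominated by the
    undamped integrand, the right side by [|u|^(- alpha)] times the transform of [phi], which is
    integrable because that transform is flat at 0. *)
Lemma frac_fourier (x s : R) : `|s| = 1 ->
  (2 * pi)%:C * cintegral leb setT (fun y => (pospow (alpha - 1) y)%:C * phi (x + s * y)) =
  (Gamma alpha)%:C * cintegral leb setT (fun u =>
    homog (expi (- (- alpha * (pi / 2)))) (expi (- alpha * (pi / 2))) (- alpha) (- (s * u)) * psi u *
    expi (- (u * x))).
Proof.
move=> s1; have s0 : s != 0 by rewrite -normr_gt0 s1.
have sf := schwartz_fourier sphi.
have su u : u != 0 -> - (s * u) != 0 by move=> u0; rewrite oppr_eq0 mulf_neq0.
have asu u : `|- (s * u)| = `|u| by rewrite normrN normrM s1 mul1r.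
have mphi : cmeasurable (fun y : R => phi (x + s * y)).
  by apply: schwartz_measurable; exact: schwartz_affine.
set a := expi _; set b := expi (- alpha * _).
have lpsi : lizorkin_dual psi by case: lphi.
have psi0 : psi 0 = 0 := lizorkin_dual0 lpsi.
apply: (@ccvg_unique _ (fun n => cintegral leb setT (fun u => psi u * expi (- (u * x)) *
  power_integral (alpha - 1) exp_tail0 (eps n +i* (s * u))))).
  rewrite (funext (fun n => esym (frac_regularised x s (eps_gt0 n)))).
  apply: ccvgZ.
  apply: (@cintegral_dominated_convergence _ _ _ leb _ _ _ _ _ _ (integrable_frac x s0)).
  - move=> n; apply: cmeasurableM mphi; apply: cmeasurableR.
    by move/integrableP: (integrable_pospow_exp am1 (eps_gt0 n)) => [/measurable_EFinP].
  - by apply: cmeasurableM mphi; apply: cmeasurableR; exact: measurable_pospow.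
  - move=> y; rewrite [(pospow _ _)%:C * _]mulrC.
    rewrite (_ : (fun n => _) = (fun n => phi (x + s * y) * (pospow (alpha - 1) y * expR (- (eps n * y)))%:C)).
      apply: ccvgZ; apply: ccvgR; rewrite -[X in _ --> X]mulr1; apply: cvgM; first exact: cvg_cst.
      rewrite -[X in _ --> X]expR0; apply: continuous_cvg; first exact: continuous_expR.
      by rewrite -[X in _ --> X]oppr0; apply: cvgN; exact: cvg_harmonic_mulr.
    by apply/funext => n; rewrite mulrC.
  - move=> n y; rewrite !modulusM !modulusR ler_wpM2r ?modulus_ge0// normrM.
    have [y0|y0] := leP y 0; first by rewrite pospow_le0// normr0 mul0r.
    rewrite ler_piMr// (ger0_norm (expR_ge0 _)) -[leRHS]expR0 ler_expR oppr_le0.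
    by rewrite mulr_ge0// ltW// eps_gt0.
(* [W n u] is [(eps n + i s u)^(- alpha)], so that [Gamma alpha * W n u] is the transform of the
   damped kernel. *)
pose W n u := ((eps n `^ (- alpha))%:C * raypow (- alpha) (- (s * u) / eps n)).
have PE n u : power_integral (alpha - 1) exp_tail0 (eps n +i* (s * u)) = (Gamma alpha)%:C * W n u.
  by rewrite -power_integral0_scaled ?eps_gt0// opprK.
have PW n u : psi u * expi (- (u * x)) * power_integral (alpha - 1) exp_tail0 (eps n +i* (s * u)) =
  (Gamma alpha)%:C * (W n u * psi u * expi (- (u * x))) by rewrite PE; ring.
rewrite (funext (fun n => eq_cintegral leb (PW n))).
have me : cmeasurable (fun u : R => expi (- (u * x))).
  by apply: cmeasurable_expi; apply: measurableT_comp => //; exact: measurable_mull.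
have mW n : cmeasurable (W n).
  apply: cmeasurableM; first exact: cmeasurable_cst.
  apply: (cmeasurable_comp (cmeasurable_raypow _)); apply: measurable_funM => //.
  by apply: measurableT_comp => //; exact: measurable_mulr.
have mh : cmeasurable (fun u : R => homog a b (- alpha) (- (s * u))).
  apply: (cmeasurable_comp (cmeasurable_homog a b (- alpha))).
  by apply: measurableT_comp => //; exact: measurable_mulr.
have iH : leb.-integrable setT (EFin \o (fun u => modulus (homog 1 1 (- alpha) u * psi u))).
  apply: integrable_modulus; apply: schwartz_integrable.
  by apply: lizorkin_dual_schwartz; exact: lizorkin_dual_homog.
have h1 (u : R) : u != 0 -> modulus (homog 1 1 (- alpha) u) = `|u| `^ (- alpha).
  rewrite /homog; case: ltgtP => // u0 _; rewrite mul1r modulusR ger0_norm ?powR_ge0//.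
    by rewrite gtr0_norm.
  by rewrite ltr0_norm.
have WH n u : modulus (W n u * psi u * expi (- (u * x))) <= modulus (homog 1 1 (- alpha) u * psi u).
  have [->|u0] := eqVneq u 0; first by rewrite psi0 !mulr0 mul0r.
  rewrite modulusM modulus_expi mulr1 modulusM [leRHS]modulusM ler_wpM2r ?modulus_ge0// h1//.
  by rewrite -asu; apply: modulus_scaled_raypow; [exact: eps_gt0|exact: su].
have iW n : cintegrable leb (fun u => W n u * psi u * expi (- (u * x))).
  apply: (@cintegrable_le _ _ _ leb _ _ _ iH (WH n)).
  by apply: cmeasurableM me; apply: cmeasurableM => //; exact: schwartz_measurable.
rewrite (funext (fun n => cintegralZ (Gamma alpha)%:C (iW n))); apply: ccvgZ.
apply: (@cintegral_dominated_convergence _ _ _ leb _ _ _ _ _ _ iH).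
- move=> n; exact: cintegrable_measurable (iW n).
- by apply: cmeasurableM me; apply: cmeasurableM => //; exact: schwartz_measurable.
- move=> u; rewrite /=; have [->|u0] := eqVneq u 0.
    have -> : (fun n => W n 0 * psi 0 * expi (- (0 * x))) = (fun=> 0).
      by apply/funext => n; rewrite psi0 mulr0 mul0r.
    by rewrite psi0 mulr0 mul0r; exact: ccvg_cst.
  apply: ccvgM; last exact: ccvg_cst.
  apply: ccvgM; last exact: ccvg_cst.
  by apply: raypow_boundary; exact: su.
- exact: WH.
Qed.

Lemma frac_multiplier (x s : R) : `|s| = 1 ->
  ((Gamma alpha)^-1)%:C * cintegral leb setT (fun y => (pospow (alpha - 1) y)%:C * phi (x + s * y)) =
  ifourier (fun u =>
    homog (expi (- (- alpha * (pi / 2)))) (expi (- alpha * (pi / 2))) (- alpha) (- (s * u)) * psi u) x.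
Proof.
move=> s1; rewrite ifourierE.
have g0 : Gamma alpha != 0 by rewrite Gamma_gt0E// gt_eqF// Gamma_integral_gt0.
have K (p g : R) (A B : R[i]) : p != 0 -> g != 0 -> p%:C * A = g%:C * B -> (g^-1)%:C * A = (p^-1)%:C * B.
  move=> p0 q0 e; have -> : A = (p^-1)%:C * (g%:C * B) by rewrite -e mulrA -rmorphM mulVf// mul1r.
  by rewrite mulrCA [X in _ * X = _]mulrA -rmorphM mulVf// mul1r.
exact: K (pi2_neq0) g0 (frac_fourier x s1).
Qed.

Lemma cintegral_mkcond {d} {T : measurableType d} (mu : {measure set T -> \bar R}) (D : set T) (f : T -> R[i]) :
  cintegral mu D f = cintegral mu setT (fun t => if t \in D then f t else 0).
Proof.
rewrite /cintegral Rintegral_mkcond [X in _ +i* X]Rintegral_mkcond.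
by congr (_ +i* _); apply: eq_Rintegral => t _; rewrite patchE /rpart /ipart; case: ifP.
Qed.

Lemma I_plusE (x : R) : I_plus alpha phi x =
  ((Gamma alpha)^-1)%:C * cintegral leb setT (fun y => (pospow (alpha - 1) y)%:C * phi (x + 1 * y)).
Proof.
rewrite /I_plus; congr (_ * _); rewrite cintegral_mkcond.
pose f (t : R) := (pospow (alpha - 1) t)%:C * phi (x + 1 * t).
have mf : cmeasurable f.
  apply: cmeasurableM; first by apply: cmeasurableR; exact: measurable_pospow.
  by apply: schwartz_measurable; apply: schwartz_affine => //; exact: oner_neq0.
have i1 := @cintegrable_modulus _ _ _ leb _ mf (integrable_frac x (oner_neq0 R)).
rewrite (cintegral_affine (- x) ltr01 i1) mul1r; apply: eq_cintegral => t /=.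
rewrite mem_setE in_itv /= andbT /f; case: ifPn => [xt|].
  rewrite pospow_gt0; last by rewrite mul1r addrC subr_gt0.
  by rewrite !mul1r addrA subrr add0r [- x + t]addrC.
by rewrite -leNgt => tx; rewrite pospow_le0 ?mul0r// mul1r addrC subr_le0.
Qed.

Lemma I_minusE (x : R) : I_minus alpha phi x =
  ((Gamma alpha)^-1)%:C * cintegral leb setT (fun y => (pospow (alpha - 1) y)%:C * phi (x + -1 * y)).
Proof.
rewrite /I_minus; congr (_ * _); rewrite cintegral_mkcond.
pose f (t : R) := (pospow (alpha - 1) t)%:C * phi (x + -1 * t).
have n1 : -1 != 0 :> R by rewrite oppr_eq0 oner_neq0.
have mf : cmeasurable f.
  apply: cmeasurableM; first by apply: cmeasurableR; exact: measurable_pospow.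
  by apply: schwartz_measurable; exact: schwartz_affine.
have i1 := @cintegrable_modulus _ _ _ leb _ mf (integrable_frac x n1).
have i2 : cintegrable leb (fun t => f (- t)).
  by case: i1 => j1 j2; split; [exact: (integrable_opp j1)|exact: (integrable_opp j2)].
rewrite (cintegral_opp mf) (cintegral_affine (- x) ltr01 i2) mul1r; apply: eq_cintegral => t /=.
rewrite mem_setE in_itv /= /f mul1r opprD opprK; case: ifPn => [xt|].
  by rewrite pospow_gt0 ?subr_gt0//; congr (_ * phi _); ring.
by rewrite -leNgt => tx; rewrite pospow_le0 ?mul0r// subr_le0.
Qed.

Lemma I_plus_multiplier : I_plus alpha phi =
  multiplier (expi (- (alpha * (pi / 2)))) (expi (alpha * (pi / 2))) (- alpha) phi.
Proof.
apply/funext => x; rewrite I_plusE (frac_multiplier x (normr1 R)) /multiplier.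
by congr (ifourier _ x); apply/funext => u; rewrite mul1r homogN mulNr opprK.
Qed.

Lemma I_minus_multiplier : I_minus alpha phi =
  multiplier (expi (alpha * (pi / 2))) (expi (- (alpha * (pi / 2)))) (- alpha) phi.
Proof.
apply/funext => x; rewrite I_minusE (frac_multiplier x (normrN1 R)) /multiplier.
by congr (ifourier _ x); apply/funext => u; rewrite mulN1r !mulNr !opprK.
Qed.

End FractionalIntegral.

(** * Inversion of the symbol *)

Section Inverse.
Context {R : realType}.
Notation leb := (@lebesgue_measure R).

Lemma ifourierDZ (k l : R[i]) (f g : R -> R[i]) (x : R) : schwartz f -> schwartz g ->
  ifourier (fun u => k * f u + l * g u) x = k * ifourier f x + l * ifourier g x.
Proof.
move=> sf sg; rewrite !ifourierE.
have me : measurable_fun setT (fun u : R => - (u * x)).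
  by apply: measurableT_comp => //; exact: measurable_mull.
have i1 := @cintegrable_expi _ _ _ leb f _ me (schwartz_integrable sf).
have i2 := @cintegrable_expi _ _ _ leb g _ me (schwartz_integrable sg).
have E (u : R) : (k * f u + l * g u) * expi (- (u * x)) = k * (f u * expi (- (u * x))) + l * (g u * expi (- (u * x))).
  by ring.
rewrite (eq_cintegral leb E) (cintegralD (cintegrableZ k i1) (cintegrableZ l i2)).
rewrite (cintegralZ k i1) (cintegralZ l i2); move: (cintegral _ _ _) (cintegral _ _ _) => I1 I2; ring.
Qed.

Lemma multiplierDZ (k l a b c d : R[i]) (p : R) (phi : R -> R[i]) (x : R) : lizorkin phi ->
  multiplier (k * a + l * c) (k * b + l * d) p phi x = k * multiplier a b p phi x + l * multiplier c d p phi x.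
Proof.
move=> lphi; have s a' b' : schwartz (fun u => homog a' b' p u * fourier phi u).
  by apply: lizorkin_dual_schwartz; apply: lizorkin_dual_homog; case: lphi.
rewrite /multiplier -(ifourierDZ k l x (s a b) (s c d)); congr (ifourier _ x); apply/funext => u.
by rewrite -homogD -!homogZ; ring.
Qed.

(** The angle lies in []0, pi[], and it is [pi / 2] only for [alpha = 1]. *)
Lemma cos_alpha_neq0 (alpha : R) : 0 < alpha < 2 -> alpha != 1 -> cos (alpha * (pi / 2)) != 0.
Proof.
move=> /andP[a0 a2] a1; have p0 := pi_gt0 R.
have [h|h|/eqP h] := ltgtP alpha 1; last by rewrite (negbTE a1) in h.
  by rewrite gt_eqF// cos_gt0_pihalf//; nra.
have : 0 < cos (pi - alpha * (pi / 2)) by rewrite cos_gt0_pihalf//; nra.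
by rewrite cosB cospi sinpi mul0r addr0 mulN1r oppr_gt0 => /lt_eqF ->.
Qed.

Lemma cos_double (alpha : R) : cos (pi * alpha) = 2 * cos (alpha * (pi / 2)) ^+ 2 - 1.
Proof.
have -> : pi * alpha = alpha * (pi / 2) + alpha * (pi / 2) by field.
rewrite cosD -!expr2 (sin2cos2 (alpha * (pi / 2))); ring.
Qed.

Lemma inverse_denominator_neq0 (alpha Mm Mp : R) : 0 < alpha < 2 -> alpha != 1 ->
  0 <= Mm * Mp -> ~ (Mm = 0 /\ Mp = 0) -> Mm ^+ 2 + Mp ^+ 2 + 2 * Mm * Mp * cos (pi * alpha) != 0.
Proof.
move=> a02 a1 MM h; have c0 := cos_alpha_neq0 a02 a1.
have c2 : 0 < cos (alpha * (pi / 2)) ^+ 2 by rewrite exprn_even_gt0.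
apply/eqP => e; apply: h.
(* The half-angle formula writes the denominator as a sum of two nonnegative terms, so both
   vanish. *)
have e' : (Mm - Mp) ^+ 2 + 4 * (Mm * Mp) * cos (alpha * (pi / 2)) ^+ 2 = 0.
  by rewrite -[RHS]e cos_double; ring.
have s0 := sqr_ge0 (Mm - Mp).
have q0 : 0 <= 4 * (Mm * Mp) * cos (alpha * (pi / 2)) ^+ 2.
  by rewrite mulr_ge0 ?(ltW c2)// mulr_ge0.
have /eqP : (Mm - Mp) ^+ 2 = 0 by lra.
rewrite sqrf_eq0 subr_eq0 => /eqP m.
have /eqP : 4 * (Mm * Mp) * cos (alpha * (pi / 2)) ^+ 2 = 0 by lra.
rewrite mulf_eq0 (gt_eqF c2) orbF mulf_eq0 pnatr_eq0 /= m mulf_eq0 orbb => /eqP ->.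
by [].
Qed.

(** The second factor is the complex conjugate of the first divided by its squared modulus. The two
    values of [s] serve the two half axes. *)
Lemma inverse_coefE (alpha Mm Mp : R) (s : R) : (s = alpha * (pi / 2) \/ s = - (alpha * (pi / 2))) ->
  Mm ^+ 2 + Mp ^+ 2 + 2 * Mm * Mp * cos (pi * alpha) != 0 ->
  (Mp%:C * expi s + Mm%:C * expi (- s)) *
  ((inverse_coef alpha Mm Mm Mp)%:C * expi s + (inverse_coef alpha Mp Mm Mp)%:C * expi (- s)) = 1.
Proof.
move=> hs; have hc : cos (pi * alpha) = cos s ^+ 2 - sin s ^+ 2.
  rewrite cos_double; case: hs => ->; rewrite ?cosN ?sinN ?sqrrN (sin2cos2 (alpha * (pi / 2))); ring.
rewrite /inverse_coef; set D := _ + _ => D0.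
have cs := cos2Dsin2 s.
apply/eqP; rewrite eq_complex /= cosN sinN; apply/andP; split; apply/eqP.
  transitivity ((Mm ^+ 2 * (cos s ^+ 2 + sin s ^+ 2) + Mp ^+ 2 * (cos s ^+ 2 + sin s ^+ 2) + 2 * Mm * Mp * (cos s ^+ 2 - sin s ^+ 2)) / D).
    by field.
  by rewrite cs !mulr1 -hc mulfV.
by field.
Qed.

End Inverse.

Theorem theorem1 (R : realType) (d : measure_display) (T : measurableType d)
    (P : probability T R) (alpha cm cp : R) (X : R -> {RV P >-> R})
    (L : (R -> R[i]) -> (R -> R[i]))
    (halpha : 0 < alpha < 2) (halpha1 : alpha != 1)
    (hcm : 0 <= cm) (hcp : 0 <= cp) (hc : ~ (cm = 0 /\ cp = 0))
    (hX : stable_process alpha cm cp X) (hL : infinitesimal_generator X L) :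
  let Mm := cm * Gamma (- alpha) in
  let Mp := cp * Gamma (- alpha) in
  let Km := inverse_coef alpha Mm Mm Mp in
  let Kp := inverse_coef alpha Mp Mm Mp in
  exists Linv : (R -> R[i]) -> (R -> R[i]),
    inverse_in lizorkin L Linv /\
    forall phi, lizorkin phi -> forall x : R,
      Linv phi x = Km%:C * I_minus alpha phi x + Kp%:C * I_plus alpha phi x.
Proof.
move=> Mm Mp Km Kp; set theta := alpha * (pi / 2).
(* [a] and [b] are the values at 1 and -1 of the symbol of [Km I_- + Kp I_+]. *)
pose a := Km%:C * expi theta + Kp%:C * expi (- theta).
pose b := Km%:C * expi (- theta) + Kp%:C * expi theta.
have G0 := Gamma_neg_neq0 halpha halpha1.
have D0 : Mm ^+ 2 + Mp ^+ 2 + 2 * Mm * Mp * cos (pi * alpha) != 0.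
  apply: inverse_denominator_neq0 => //.
    by rewrite /Mm /Mp mulrACA; apply: mulr_ge0; [exact: mulr_ge0|rewrite -expr2 sqr_ge0].
  have G1 c : c * Gamma (- alpha) = 0 -> c = 0.
    by move/eqP; rewrite mulf_eq0 (negbTE G0) orbF => /eqP.
  by move=> [/G1 m1 /G1 m2]; apply: hc.
have LE phi : lizorkin phi ->
    L phi = multiplier (stable_coef' alpha cm cp) (stable_coef alpha cm cp) alpha phi.
  exact: stable_generator hX hL phi.
have MC c : (c * Gamma (- alpha))%:C = (Gamma (- alpha))%:C * c%:C by rewrite mulrC rmorphM.
have aE : stable_coef' alpha cm cp * a = 1.
  have <- := inverse_coefE (or_introl (erefl theta)) D0.
  by congr (_ * _); rewrite /stable_coef' -/theta (MC cm) (MC cp) mulrDr !mulrA.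
have bE : stable_coef alpha cm cp * b = 1.
  have <- := inverse_coefE (or_intror (erefl (- theta))) D0.
  by rewrite opprK; congr (_ * _); rewrite /stable_coef -/theta (MC cm) (MC cp) mulrDr !mulrA.
(* With the inverse defined as a multiplier, both compositions reduce to [aE] and [bE]; the formula
   with fractional integrals is then linearity in the coefficients. *)
exists (multiplier a b (- alpha)); split; first split.
- by move=> phi lphi; rewrite LE//; exact: lizorkin_multiplier.
- by move=> phi lphi; exact: lizorkin_multiplier.
- move=> phi lphi; rewrite (LE _ lphi).
  have aE' : a * stable_coef' alpha cm cp = 1 by rewrite mulrC.
  have bE' : b * stable_coef alpha cm cp = 1 by rewrite mulrC.
  by have := multiplierK (- alpha) aE' bE' lphi; rewrite opprK.
- move=> phi lphi; rewrite LE; last exact: lizorkin_multiplier.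
  exact: multiplierK aE bE lphi.
move=> phi lphi x.
by rewrite (I_minus_multiplier halpha lphi) (I_plus_multiplier halpha lphi) -multiplierDZ.
Qed.
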